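(* Let $K$ be an algebraically closed field of characteristic $p:=\operatorname{char}(K)$. Let $\Sigma_2$ be the labeled seed of a cluster algebra of rank two with exchange matrix $\begin{pmatrix}0&a\\ b&0\end{pmatrix}$, where $a,b\in\mathbb Z$ are non-zero and of opposite sign. Let $X_\eta:=\operatorname{Spec}(\mathcal{A}^{\mathrm{prin}}_{\boldsymbol c}(\Sigma_2))_\eta$ be the fiber above a closed point $\eta=(\eta_1,\eta_2)\in S$ of the family determined by $\phi\colon\operatorname{Spec}(\mathcal{A}^{\mathrm{prin}}_{\boldsymbol c}(\Sigma_2))\to S$. (1) The singular locus of $X_\eta$ consists of two disjoint components (which are not necessarily irreducible and which are possibly empty), $\operatorname{Sing}(X_\eta)=Y_a\sqcup Y_b$, where $$Y_a:=V(a,\ x_1^{|a|}+\eta_2,\ x_2,\ x_1y_1-\eta_1,\ y_2),\qquad Y_b:=V(b,\ x_1,\ x_2^{|b|}+\eta_1,\ y_1,\ x_2y_2-\eta_2).$$ Up to isomorphism, $Y_a$ and $Y_b$ are independent of $\eta$. $Y_a$ or $Y_b$ may be empty depending on $p$; for instance, $a\not\equiv0\bmod p$ implies $Y_a=\varnothing$, and $b\not\equiv0\bmod p$ implies $Y_b=\varnothing$. (2) $\operatorname{Spec}(\mathcal{A}^{\mathrm{prin}}_{\boldsymbol c}(\Sigma_2))$ is isomorphic to a trivial family over $S$, where each fiber is isomorphic to the cluster algebra corresponding to $\Sigma_2$ with trivial coefficients. Hence, fixing $\eta=(\eta_1,\eta_2)\in S$, we have $$X_\eta\cong\operatorname{Spec}(K[x_1',x_2',y_1',y_2']/\langle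 x_1'y_1'-1-x_2'^{|b|},\ x_2'y_2'-1-x_1'^{|a|}\rangle)$$ $$\cong\operatorname{Spec}(K[w_1,w_2,z_1,z_2]/\langle w_1z_1-1+w_2^{|b|},\ w_2z_2-1+w_1^{|a|}\rangle).$$ (3) Let $\alpha,\beta\in\mathbb Z_+$ be the largest positive integers such that $\alpha\mid a$ and $\alpha\not\equiv0\bmod p$, resp. $\beta\mid b$ and $\beta\not\equiv0\bmod p$. Then, in the coordinates $(w_1,w_2,z_1,z_2)$ of (2), $$Y_a\cong\bigcup_{\zeta\in\mu_\alpha(K)}V(a,\ w_1-\zeta,\ w_2,\ z_1-\zeta^{-1},\ z_2),\qquad Y_b\cong\bigcup_{\xi\in\mu_\beta(K)}V(b,\ w_1,\ w_2-\xi,\ z_1,\ z_2-\xi^{-1}),$$ where the disjoint unions range over the $\alpha$-th (resp. $\beta$-th) roots of unity $\mu_\alpha(K)$ (resp. $\mu_\beta(K)$) in $K$. (4) If $\operatorname{Sing}(X_\eta)$ is non-empty, then the singularities classify as follows: Let $Y_{i,j}$ be a connected component of $Y_i$, with $i\in\{a,b\}$. Locally, along $Y_{i,j}$, the fiber $X_\eta$ is isomorphic to a two-dimensional hypersurface singularity of type $A_{p^m-1}$, where $m:=m(i)$ is the positive integer such that $|a|=\alpha p^m$ (if $i=a$), resp. $|b|=\beta p^m$ (if $i=b$).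
   Context: $\boldsymbol c=(c_1,c_2)$ are invertible coefficients; $K_{\boldsymbol c}:=K[c_1^{\pm1},c_2^{\pm1}]$; $S:=\operatorname{Spec}(K_{\boldsymbol c})$; $\phi$ is the structure morphism. For a closed point $\eta\in S$, the fiber $\operatorname{Spec}(\cdot)_\eta:=\phi^{-1}(\eta)$ is a variety over the residue field $\kappa(\eta)=K$, and $\eta_i\in K^\times$ denotes the image of $c_i$ in $\kappa(\eta)$. The cluster algebra with principal coefficients $\mathcal{A}^{\mathrm{prin}}_{\boldsymbol c}(\Sigma_2)$ is used via the following presentation (obtained from the exchange relations of the acyclic seed by Berenstein–Fomin–Zelevinsky and, since $c_1,c_2$ are invertible, after rescaling and renaming coefficients): $$\mathcal{A}^{\mathrm{prin}}_{\boldsymbol c}(\Sigma_2)\cong K_{\boldsymbol c}[x_1,x_2,y_1,y_2]/\langle x_1y_1-c_1-x_2^{|b|},\ x_2y_2-c_2-x_1^{|a|}\rangle;$$ the coordinates $x_1,x_2,y_1,y_2$ in the claim refer to this presentation. The cluster algebra with trivial coefficients is obtained by setting $c_1=c_2=1$. In $V(a,\ldots)$ and $V(b,\ldots)$ the integers $a,b$ are regarded as elements of $K$. ''Singular'' means not regular. A two-dimensional variety over $K$ with an isolated singularity at a closed point $v$ is locally (at $v$) isomorphic to an isolated hypersurface singularity of type $A_k$ if the completion of its local ring at $v$ is isomorphic to $K[[x,y,z]]/\langle xy+z^{k+1}\rangle$.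
   Formalization: In (2), ''isomorphic to a trivial family over S'' fails (p=2, a=2, b=-1: the total space is regular, the trivial family is not); proved instead: the family becomes trivial after pullback along S→S, (c1,c2)↦(c1^|b|,c2^|a|), and every fiber over a closed point is as claimed. *)

(* Defs.v *)
From HB Require Import structures.
From mathcomp Require Import all_boot all_order all_algebra.
From mathcomp Require Import generic_quotient ring_quotient.
From mathcomp Require Import boolp classical_sets functions.
From mathcomp Require Import topology_structure connected.
From mathcomp Require Import mpoly ring.

Set Implicit Arguments.
Unset Strict Implicit.
Unset Printing Implicit Defensive.

Import GRing.Theory.

Local Open Scope classical_set_scope.
Local Open Scope ring_scope.
Local Open Scope quotient_scope.

Section Ideals.
Variable A : comNzRingType.

Definition ideal_gen (G : set A) : set A :=
  [set x | exists2 s : seq (A * A),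
     (forall p, p \in s -> G p.2) & x = \sum_(p <- s) p.1 * p.2].

Lemma ideal_gen0 G : ideal_gen G 0.
Proof. by exists [::] => //; rewrite big_nil. Qed.

Lemma ideal_genD G x y : ideal_gen G x -> ideal_gen G y -> ideal_gen G (x + y).
Proof.
move=> [s Hs ->] [t Ht ->]; exists (s ++ t); last by rewrite big_cat.
by move=> p; rewrite mem_cat => /orP[/Hs|/Ht].
Qed.

Lemma ideal_genM G a x : ideal_gen G x -> ideal_gen G (a * x).
Proof.
move=> [s Hs ->]; exists [seq (a * p.1, p.2) | p <- s].
  by move=> p /mapP[q /Hs Gq ->].
by rewrite big_map mulr_sumr; apply: eq_bigr => p _; rewrite mulrA.
Qed.

Lemma ideal_genB G x y : ideal_gen G x -> ideal_gen G y -> ideal_gen G (x - y).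
Proof. by move=> Gx Gy; rewrite -mulN1r; apply/ideal_genD/ideal_genM. Qed.

Lemma ideal_gen_min G (J : set A) :
  J 0 -> (forall x y, J x -> J y -> J (x + y)) ->
  (forall a x, J x -> J (a * x)) -> G `<=` J -> ideal_gen G `<=` J.
Proof.
move=> J0 JD JM GJ x [s Hs ->]; rewrite big_seq.
by elim/big_ind: _ => // p /Hs /GJ /(JM p.1).
Qed.

Definition ideal_gen_pred (G : set A) : A -> bool := fun x => `[< ideal_gen G x >].

Lemma ideal_gen_idealr G : ~ ideal_gen G 1 -> idealr_closed (ideal_gen_pred G).
Proof.
move=> G1; split.
- exact/asboolP/ideal_gen0.
- by apply/negP => /asboolP.
- move=> a x y /asboolP Gx /asboolP Gy; apply/asboolP.
  exact/ideal_genD/Gy/ideal_genM.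
Qed.

Definition span_ideal G (G1 : ~ ideal_gen G 1) : idealr A :=
  HB.pack (ideal_gen_pred G) (isIdealr.Build A _ (ideal_gen_idealr G1)).

Definition noetherian_ring : Prop :=
  forall I : set A, I 0 -> (forall a x y, I x -> I y -> I (a * x + y)) ->
  exists s : seq A, I = ideal_gen [set` s].

Definition ideal_pow (I : set A) (n : nat) : set A :=
  ideal_gen [set \prod_(i < n) t i | t in [set t : 'I_n -> A | forall i, I (t i)]].

End Ideals.

Definition Spec (A : comNzRingType) : Type :=
  {P : A -> bool | idealr_closed P /\ prime_idealr_closed P}.

HB.instance Definition _ (A : comNzRingType) := gen_eqMixin (Spec A).
HB.instance Definition _ (A : comNzRingType) := gen_choiceMixin (Spec A).

Definition in_pt (A : comNzRingType) (P : Spec A) (x : A) : bool := sval P x.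

Section Zariski.
Variable A : comNzRingType.
Implicit Type P : Spec A.

Lemma in_pt0 P : in_pt P 0.
Proof. by have [[]] := svalP P. Qed.

Lemma in_ptMD P a x y : in_pt P x -> in_pt P y -> in_pt P (a * x + y).
Proof. by have [[_ _ H] _] := svalP P; exact: H. Qed.

Lemma in_pt1 P : in_pt P 1 = false.
Proof. by have [[_ /negPf P1 _] _] := svalP P. Qed.

Lemma in_ptMl P a x : in_pt P x -> in_pt P (a * x).
Proof. by move=> Px; rewrite -[_ * _]addr0 in_ptMD ?in_pt0. Qed.

Lemma in_ptD P x y : in_pt P x -> in_pt P y -> in_pt P (x + y).
Proof. by move=> Px Py; rewrite -[x]mul1r in_ptMD. Qed.

Lemma in_ptM P x y : in_pt P (x * y) = in_pt P x || in_pt P y.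
Proof.
apply/idP/idP => [|/orP[] Pxy].
- by have [_ H] := svalP P; exact: H.
- by rewrite mulrC in_ptMl.
- by rewrite in_ptMl.
Qed.

Definition Vset (E : set A) : set (Spec A) :=
  [set P | forall f, E f -> in_pt P f].

Definition zariski_open : set_system (Spec A) := [set U | exists E, U = ~` Vset E].

Lemma zariski_openT : zariski_open setT.
Proof.
exists [set 1]; apply/seteqP; split=> P // _ /(_ 1 erefl).
by rewrite in_pt1.
Qed.

Lemma zariski_openI : setI_closed zariski_open.
Proof.
move=> _ _ [E ->] [F ->]; exists [set x * y | x in E & y in F].
rewrite -setCU; congr (~` _); apply/seteqP; split=> P.
  case=> PE _ [x Ex [y Fy <-]]; rewrite in_ptM; apply/orP; [left|right]; exact: PE.
move=> PEF; apply: contrapT => /not_orP[/existsNP[x /not_implyP[Ex Px]]].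
move=> /existsNP[y /not_implyP[Fy Py]].
have := PEF _ (ex_intro2 _ _ x Ex (ex_intro2 _ _ y Fy erefl)).
by rewrite in_ptM => /orP[].
Qed.

Lemma zariski_open_bigU (I : Type) (f : I -> set (Spec A)) :
  (forall i, zariski_open (f i)) -> zariski_open (\bigcup_i f i).
Proof.
move=> /choice[E fE]; exists (\bigcup_i E i).
apply/seteqP; split=> P.
  by move=> [i _]; rewrite fE => PE PV; apply: PE => g Eg; apply: PV; exists i.
move=> /existsNP[g /not_implyP[[i _ Eg] Pg]]; exists i => //.
by rewrite fE => /(_ g Eg).
Qed.

HB.instance Definition _ := isOpenTopological.Build (Spec A)
  zariski_openT zariski_openI zariski_open_bigU.

Definition prime_chain (d : nat) : Prop :=
  exists c : 'I_d.+1 -> Spec A, forall i j : 'I_d.+1, (i < j)%N ->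
    (forall f, in_pt (c i) f -> in_pt (c j) f) /\
    (exists2 f, in_pt (c j) f & ~~ in_pt (c i) f).

Definition krull_dim (d : nat) : Prop := prime_chain d /\ ~ prime_chain d.+1.

Definition nonunit : A -> bool := fun x => `[< ~ exists y, y * x = 1 >].

Definition local_ring : Prop :=
  forall x y, nonunit x -> nonunit y -> nonunit (x + y).

Definition regular_local_ring : Prop :=
  [/\ local_ring, noetherian_ring A &
      exists d, krull_dim d /\
        exists gs : d.-tuple A, [set x | nonunit x] = ideal_gen [set` gs]].

End Zariski.

Section SpecMap.
Variables (A B : comNzRingType) (f : {rmorphism A -> B}) (Q : Spec B).

Definition spec_map_pred : A -> bool := fun x => in_pt Q (f x).

Lemma spec_map_idealr : idealr_closed spec_map_pred.
Proof.
rewrite /spec_map_pred; split; rewrite ?unfold_in ?rmorph0 ?rmorph1 ?in_pt0 ?in_pt1 //.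
by move=> a x y Qx Qy; rewrite unfold_in rmorphD rmorphM in_ptD ?in_ptMl.
Qed.

Lemma spec_map_prime : prime_idealr_closed spec_map_pred.
Proof. by move=> x y; rewrite !unfold_in /spec_map_pred rmorphM in_ptM. Qed.

Definition spec_map : Spec A :=
  exist _ spec_map_pred (conj spec_map_idealr spec_map_prime).

End SpecMap.

(* [A] and [B] with structure maps [iA] and [iB] from [K]: an isomorphism of
   affine [K]-schemes Spec B -> Spec A is an isomorphism [A -> B] over [K]. *)
Definition alg_isom (K A B : comNzRingType) (iA : K -> A) (iB : K -> B)
    (f : {rmorphism A -> B}) : Prop :=
  bijective f /\ forall k, f (iA k) = iB k.

Definition alg_isomorphic (K A B : comNzRingType) (iA : K -> A) (iB : K -> B) : Prop :=
  exists f : {rmorphism A -> B}, alg_isom iA iB f.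

Module Localization.
Section Localization.
Variables (A : comNzRingType) (P : Spec A).

Definition den := {s : A | ~~ in_pt P s}.
Definition dval (s : den) : A := sval s.

Lemma den1_subproof : ~~ in_pt P 1. Proof. by rewrite in_pt1. Qed.
Definition den1 : den := exist (fun s => ~~ in_pt P s) 1 den1_subproof.

Lemma denM_subproof (s t : den) : ~~ in_pt P (dval s * dval t).
Proof. by rewrite in_ptM negb_or (valP s) (valP t). Qed.
Definition denM (s t : den) : den :=
  exist (fun s => ~~ in_pt P s) _ (denM_subproof s t).

Lemma dvalM s t : dval (denM s t) = dval s * dval t. Proof. by []. Qed.
Lemma dval1 : dval den1 = 1. Proof. by []. Qed.

Definition frac := (A * den)%type.

Definition equivl (x y : frac) : bool :=
  `[< exists u : den, dval u * (x.1 * dval y.2) = dval u * (y.1 * dval x.2) >].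

Lemma equivl_refl : reflexive equivl.
Proof. by move=> x; apply/asboolP; exists den1. Qed.

Lemma equivl_sym : ssrbool.symmetric equivl.
Proof. by move=> x y; apply/asboolP/asboolP => -[u uE]; exists u; rewrite uE. Qed.

Lemma equivl_trans : transitive equivl.
Proof.
move=> y x z /asboolP[u uE] /asboolP[v vE].
apply/asboolP; exists (denM (denM u v) y.2) => /=.
transitivity (dval v * dval z.2 * (dval u * (x.1 * dval y.2))); first by rewrite ?dvalM ?dval1; ring.
rewrite uE; transitivity (dval u * dval x.2 * (dval v * (y.1 * dval z.2))); first by rewrite ?dvalM ?dval1; ring.
by rewrite vE; rewrite ?dvalM ?dval1; ring.
Qed.

Canonical equivl_equiv := EquivRel equivl equivl_refl equivl_sym equivl_trans.

Definition type : Type := {eq_quot equivl}.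

HB.instance Definition _ : EqQuotient _ equivl type := EqQuotient.on type.
HB.instance Definition _ := Choice.on type.

Lemma equivlP (x y : frac) :
  (exists u : den, dval u * (x.1 * dval y.2) = dval u * (y.1 * dval x.2)) <->
  \pi_type x = \pi_type y.
Proof.
split=> [xy|/eqmodP/asboolP //]; by apply/eqmodP/asboolP.
Qed.

Lemma repr_piP (x : frac) : exists u : den,
  dval u * ((repr (\pi_type x)).1 * dval x.2) = dval u * (x.1 * dval (repr (\pi_type x)).2).
Proof. by apply/equivlP; rewrite reprK. Qed.

Definition addl (x y : frac) : frac :=
  (x.1 * dval y.2 + y.1 * dval x.2, denM x.2 y.2).
Definition add := lift_op2 type addl.

Lemma pi_add : {morph \pi : x y / addl x y >-> add x y}.
Proof.
move=> x y; unlock add; apply/equivlP => /=.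
have [u uE] := repr_piP x; have [v vE] := repr_piP y.
move: (repr _) uE (repr _) vE => x' uE y' vE.
exists (denM u v) => /=; apply/eqP; rewrite -subr_eq0; apply/eqP.
transitivity (dval v * dval y.2 * dval y'.2 *
    (dval u * (x.1 * dval x'.2) - dval u * (x'.1 * dval x.2)) +
  dval u * dval x.2 * dval x'.2 *
    (dval v * (y.1 * dval y'.2) - dval v * (y'.1 * dval y.2))); first by rewrite ?dvalM ?dval1; ring.
by rewrite uE vE !subrr !mulr0 addr0.
Qed.
Canonical pi_add_morph := PiMorph2 pi_add.

Definition oppl (x : frac) : frac := (- x.1, x.2).
Definition opp := lift_op1 type oppl.

Lemma pi_opp : {morph \pi : x / oppl x >-> opp x}.
Proof.
move=> x; unlock opp; apply/equivlP => /=.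
by have [u uE] := repr_piP x; exists u; rewrite !mulNr !mulrN uE.
Qed.
Canonical pi_opp_morph := PiMorph1 pi_opp.

Definition mull (x y : frac) : frac := (x.1 * y.1, denM x.2 y.2).
Definition mul := lift_op2 type mull.

Lemma pi_mul : {morph \pi : x y / mull x y >-> mul x y}.
Proof.
move=> x y; unlock mul; apply/equivlP => /=.
have [u uE] := repr_piP x; have [v vE] := repr_piP y.
move: (repr _) uE (repr _) vE => x' uE y' vE.
exists (denM u v) => /=.
transitivity ((dval u * (x.1 * dval x'.2)) * (dval v * (y.1 * dval y'.2))); first by rewrite ?dvalM ?dval1; ring.
by rewrite -uE -vE; rewrite ?dvalM ?dval1; ring.
Qed.
Canonical pi_mul_morph := PiMorph2 pi_mul.

Definition tofrac (a : A) : type := \pi_type (a, den1).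

Lemma pi_eq (x y : frac) :
  x.1 * dval y.2 = y.1 * dval x.2 -> \pi_type x = \pi_type y.
Proof. by move=> xy; apply/equivlP; exists den1; rewrite xy. Qed.

Lemma addA : associative add.
Proof.
elim/quotW=> x; elim/quotW=> y; elim/quotW=> z; rewrite -!pi_add.
by apply: pi_eq => /=; rewrite ?dvalM ?dval1; ring.
Qed.

Lemma addC : commutative add.
Proof.
elim/quotW=> x; elim/quotW=> y; rewrite -!pi_add.
by apply: pi_eq => /=; rewrite ?dvalM ?dval1; ring.
Qed.

Lemma add0 : left_id (tofrac 0) add.
Proof.
elim/quotW=> x; rewrite /tofrac -!pi_add.
by apply: pi_eq => /=; rewrite ?dvalM ?dval1; ring.
Qed.

Lemma addN : left_inverse (tofrac 0) opp add.
Proof.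
elim/quotW=> x; rewrite /tofrac -pi_opp -!pi_add.
by apply: pi_eq => /=; rewrite ?dvalM ?dval1; ring.
Qed.

HB.instance Definition _ := GRing.isZmodule.Build type addA addC add0 addN.

Lemma mulA : associative mul.
Proof.
elim/quotW=> x; elim/quotW=> y; elim/quotW=> z; rewrite -!pi_mul.
by apply: pi_eq => /=; rewrite ?dvalM ?dval1; ring.
Qed.

Lemma mulC : commutative mul.
Proof.
elim/quotW=> x; elim/quotW=> y; rewrite -!pi_mul.
by apply: pi_eq => /=; rewrite ?dvalM ?dval1; ring.
Qed.

Lemma mul1 : left_id (tofrac 1) mul.
Proof.
elim/quotW=> x; rewrite /tofrac -!pi_mul.
by apply: pi_eq => /=; rewrite ?dvalM ?dval1; ring.
Qed.

Lemma mul_addl : left_distributive mul add.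
Proof.
elim/quotW=> x; elim/quotW=> y; elim/quotW=> z.
rewrite -!(pi_add, pi_mul).
by apply: pi_eq => /=; rewrite ?dvalM ?dval1; ring.
Qed.

Lemma nonzero1 : tofrac 1 != tofrac 0.
Proof.
apply/eqP => /equivlP[u /=]; rewrite !mulr1 mulr0 => u0.
by have := svalP u; rewrite -/(dval u) u0 in_pt0.
Qed.

HB.instance Definition _ :=
  GRing.Zmodule_isComNzRing.Build type mulA mulC mul1 mul_addl nonzero1.

Lemma nonunit_pi (x : frac) : nonunit (\pi_type x) = in_pt P x.1.
Proof.
apply/asboolP/idP => [Nx|Px [y]].
  apply: contrapT => /negP Px; apply: Nx.
  exists (\pi_type (dval x.2, exist (fun s => ~~ in_pt P s) x.1 Px)).
  rewrite -[LHS]pi_mul; apply: pi_eq => /=; rewrite ?dvalM ?dval1; ring.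
elim/quotW: y => y; rewrite -[LHS]pi_mul => /equivlP[u /=].
rewrite mulr1 mul1r => /(congr1 (in_pt P)); rewrite !in_ptM Px orbT orbT.
by rewrite (negPf (svalP u)) (negPf (svalP x.2)) (negPf (svalP y.2)).
Qed.

Lemma nonunit_idealr : idealr_closed (@nonunit type).
Proof.
split.
- by change (is_true (nonunit (\pi_type (0, den1)))); rewrite nonunit_pi in_pt0.
- by change (is_true (~~ nonunit (\pi_type (1, den1)))); rewrite nonunit_pi in_pt1.
- elim/quotW=> a; elim/quotW=> x; elim/quotW=> y.
  change (nonunit (\pi_type x) -> nonunit (\pi_type y) ->
    nonunit (add (mul (\pi_type a) (\pi_type x)) (\pi_type y))).
  rewrite -pi_mul -pi_add !nonunit_pi /= => Px Py.
  by rewrite in_ptD // !in_ptM ?Px ?Py ?orbT.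
Qed.

Definition maxideal : idealr type :=
  HB.pack (@nonunit type) (isIdealr.Build type _ nonunit_idealr).

End Localization.
End Localization.
HB.export Localization.

Notation localize := Localization.type.
Notation loc_map := Localization.tofrac.

Definition Sing (A : comNzRingType) : set (Spec A) :=
  [set P | ~ regular_local_ring (localize P)].
Arguments Sing : clear implicits.

(* The I-adic completion, as the ring of Cauchy sequences modulo the ideal of
   null sequences. *)

Module Completion.
Section Completion.
Variables (A : comNzRingType) (I : idealr A).

Definition Ipow (n : nat) : set A := ideal_pow [set x | (I : A -> bool) x] n.

Definition cauchy : (nat -> A) -> bool := fun u => `[< forall n, exists N,
  forall i j, (N <= i)%N -> (N <= j)%N -> Ipow n (u i - u j) >].

Lemma cauchy_subring : subring_closed cauchy.
Proof.
split.
- by apply/asboolP => n; exists 0%N => i j _ _; rewrite subrr; exact: ideal_gen0.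
- move=> u v /asboolP Cu /asboolP Cv; apply/asboolP => n.
  have [N uN] := Cu n; have [M vM] := Cv n; exists (maxn N M) => i j.
  rewrite !geq_max => /andP[Ni Mi] /andP[Nj Mj].
  have -> : (u - v) i - (u - v) j = (u i - u j) - (v i - v j) by rewrite !fctE; ring.
  by apply: ideal_genB; [exact: uN|exact: vM].
- move=> u v /asboolP Cu /asboolP Cv; apply/asboolP => n.
  have [N uN] := Cu n; have [M vM] := Cv n; exists (maxn N M) => i j.
  rewrite !geq_max => /andP[Ni Mi] /andP[Nj Mj].
  have -> : (u * v) i - (u * v) j = v i * (u i - u j) + u j * (v i - v j).
    by rewrite !fctE; ring.
  by apply: ideal_genD; apply: ideal_genM; [exact: uN|exact: vM].
Qed.

HB.instance Definition _ := GRing.isSubringClosed.Build (nat -> A) cauchy cauchy_subring.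

Definition cseq : Type := {u : nat -> A | cauchy u}.
HB.instance Definition _ := [isSub for (@proj1_sig _ _ : cseq -> _)].
HB.instance Definition _ := [Choice of cseq by <:].
HB.instance Definition _ := [SubChoice_isSubComNzRing of cseq by <:].

Definition null : cseq -> bool := fun u => `[< forall n, exists N,
  forall i, (N <= i)%N -> Ipow n (val u i) >].

Lemma null_idealr : idealr_closed null.
Proof.
split.
- by apply/asboolP => n; exists 0%N => i _; rewrite rmorph0; exact: ideal_gen0.
- apply/negP => /asboolP/(_ 1%N)[N /(_ N (leqnn N))]; rewrite rmorph1.
  have J1 : @ideal_gen A [set x | (I : A -> bool) x] `<=` [set x | (I : A -> bool) x].
    apply: ideal_gen_min => //=.
    + exact: (idealr0 I).
    + by move=> x y; exact: (@rpredD _ I).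
    + by move=> a x; exact: (@idealMr _ I).
  have I1 : ((I : A -> bool) 1) = false := idealr1 I.
  move=> H; suff /J1 : ideal_gen [set x | (I : A -> bool) x] (1 : A) by rewrite /mkset I1.
  apply: ideal_gen_min H.
    + exact: ideal_gen0.
    + exact: ideal_genD.
    + exact: ideal_genM.
    + move=> _ [t It <-]; rewrite big_ord1; exists [:: (1, t ord0)].
        by move=> p; rewrite inE => /eqP -> /=; exact: It.
      by rewrite big_seq1 mul1r.
- move=> a u v /asboolP Nu /asboolP Nv; apply/asboolP => n.
  have [N uN] := Nu n; have [M vM] := Nv n; exists (maxn N M) => i.
  rewrite geq_max => /andP[Ni Mi]; rewrite rmorphD rmorphM /=.
  by apply: ideal_genD; [apply/ideal_genM/uN|exact: vM].
Qed.

Definition null_ideal : idealr cseq :=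
  HB.pack null (isIdealr.Build cseq _ null_idealr).

Definition type : Type := {ideal_quot null_ideal}.
HB.instance Definition _ := GRing.ComNzRing.on type.

Lemma cauchy_cst (a : A) : cauchy (fun=> a).
Proof. by apply/asboolP => n; exists 0%N => i j _ _; rewrite subrr; exact: ideal_gen0. Qed.

Definition from (a : A) : type :=
  \pi_{ideal_quot null_ideal} (exist (fun u => cauchy u) _ (cauchy_cst a)).

End Completion.
End Completion.
HB.export Completion.

Definition fps (n : nat) (R : comNzRingType) : Type := 'X_{1..n} -> R.

Section PowerSeries.
Variables (n : nat) (R : comNzRingType).
Implicit Types f g h : fps n R.

HB.instance Definition _ := GRing.Zmodule.on (fps n R).

Definition fpsC (c : R) : fps n R := fun m => c * (m == 0%MM)%:R.
Definition fpsX (i : 'I_n) : fps n R := fun m => (m == U_(i)%MM)%:R.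

Lemma fpsDE f g m : (f + g) m = f m + g m. Proof. by []. Qed.

Definition fps_mul f g : fps n R := fun m =>
  \sum_(k : 'X_{1..n < (mdeg m).+1, (mdeg m).+1} | m == (k.1 + k.2)%MM)
    f k.1 * g k.2.

Definition fps_trunc (d : nat) f : {mpoly R[n]} :=
  \sum_(m : 'X_{1..n < d}) f m *: 'X_[m].

Lemma fps_truncE d f m : (mdeg m < d)%N -> (fps_trunc d f)@_m = f m.
Proof. exact: mcoeff_mpoly. Qed.

Lemma fps_mulE_aux (p q : {mpoly R[n]}) f g m :
  (forall k, (mdeg k <= mdeg m)%N -> p@_k = f k) ->
  (forall k, (mdeg k <= mdeg m)%N -> q@_k = g k) ->
  fps_mul f g m = (p * q)@_m.
Proof.
move=> fp gq; rewrite mcoeffM; apply: eq_bigr => k /eqP mE.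
have := congr1 mdeg mE; rewrite mdegD => dE; congr (_ * _).
- by rewrite fp //; apply: leq_trans (eq_leq (esym dE)); rewrite leq_addr.
- by rewrite gq //; apply: leq_trans (eq_leq (esym dE)); rewrite leq_addl.
Qed.

Lemma fps_mulE d f g m : (mdeg m < d)%N ->
  fps_mul f g m = (fps_trunc d f * fps_trunc d g)@_m.
Proof. by move=> md; apply: fps_mulE_aux => k km; rewrite fps_truncE // (leq_ltn_trans km). Qed.

Lemma fps_mulA : associative fps_mul.
Proof.
move=> f g h; apply/funext => m; set d := (mdeg m).+1.
rewrite (@fps_mulE_aux (fps_trunc d f) (fps_trunc d g * fps_trunc d h)); last 2 first.
- by move=> k km; rewrite fps_truncE.
- by move=> k km; rewrite -fps_mulE.
rewrite (@fps_mulE_aux (fps_trunc d f * fps_trunc d g) (fps_trunc d h)) ?mulrA //.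
- by move=> k km; rewrite -fps_mulE.
- by move=> k km; rewrite fps_truncE.
Qed.

Lemma fps_mulC : commutative fps_mul.
Proof. by move=> f g; apply/funext => m; rewrite !(@fps_mulE (mdeg m).+1) // mulrC. Qed.

Lemma fps_mul1 : left_id (fpsC 1) fps_mul.
Proof.
move=> f; apply/funext => m.
rewrite (@fps_mulE_aux 1 (fps_trunc (mdeg m).+1 f)) ?mul1r ?fps_truncE //.
- by move=> k _; rewrite mcoeff1 /fpsC mul1r.
- by move=> k km; rewrite fps_truncE.
Qed.

Lemma fps_mulDl : left_distributive fps_mul +%R.
Proof.
move=> f g h; apply/funext => m; set d := (mdeg m).+1.
rewrite (@fps_mulE_aux (fps_trunc d f + fps_trunc d g) (fps_trunc d h)).
- by rewrite mulrDl mcoeffD fpsDE -!fps_mulE.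
- by move=> k km; rewrite mcoeffD !fps_truncE.
- by move=> k km; rewrite fps_truncE.
Qed.

Lemma fps_nonzero1 : fpsC 1 != 0.
Proof.
apply/eqP => /(congr1 (fun f : fps n R => f 0%MM)); rewrite /fpsC eqxx mulr1 => /eqP.
by rewrite oner_eq0.
Qed.

HB.instance Definition _ := GRing.Zmodule_isComNzRing.Build (fps n R)
  fps_mulA fps_mulC fps_mul1 fps_mulDl fps_nonzero1.

Lemma fps_mul_coef0 f g : (f * g) 0%MM = f 0%MM * g 0%MM.
Proof.
have -> : (f * g) 0%MM = (fps_trunc 1 f * fps_trunc 1 g)@_0 by apply: fps_mulE; rewrite mdeg0.
by rewrite rmorphM /= !fps_truncE ?mdeg0.
Qed.

End PowerSeries.

Section Ak.
Variables (K : comNzRingType) (k : nat).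

Definition Ak_eq : fps 3 K :=
  fpsX K (@Ordinal 3 0 isT) * fpsX K (@Ordinal 3 1 isT)
    + fpsX K (@Ordinal 3 2 isT) ^+ k.+1.

Lemma Ak_proper : ~ ideal_gen [set Ak_eq] 1.
Proof.
pose J : set (fps 3 K) := [set f | f 0%MM = 0].
have X0 i : fpsX K i 0%MM = 0 by rewrite /fpsX eq_sym mnm1_eq0.
move=> H; suff : J 1 by rewrite /J /= /GRing.one /= /fpsC eqxx mulr1 => /eqP; rewrite oner_eq0.
apply: ideal_gen_min H.
- by [].
- by move=> f g f0 g0; change ((f + g) 0%MM = 0); rewrite fpsDE f0 g0 addr0.
- by move=> f g g0; change ((f * g) 0%MM = 0); rewrite fps_mul_coef0 g0 mulr0.
- by move=> _ ->; change (Ak_eq 0%MM = 0); rewrite /Ak_eq fpsDE exprS !fps_mul_coef0 !X0 !mul0r addr0.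
Qed.

Definition Ak_ring : Type := {ideal_quot (span_ideal Ak_proper)}.
HB.instance Definition _ := GRing.ComNzRing.on Ak_ring.

Definition Ak_cst (c : K) : Ak_ring :=
  \pi_{ideal_quot (span_ideal Ak_proper)} (@fpsC 3 K c).

End Ak.

(* The affine surface Spec F over K (structure map [i]) has at the point [v] an
   isolated singularity which is locally of type [A_k]. *)
Definition sing_type_A (K F : comNzRingType) (i : K -> F) (k : nat) (v : Spec F) : Prop :=
  [/\ krull_dim F 2,
      closed [set v],
      exists2 U : set (Spec F), open U & U `&` Sing F = [set v] &
      alg_isomorphic
        (fun c => Completion.from (Localization.maxideal v) (loc_map v (i c)))
        (@Ak_cst K k)].

Definition is_component (T : topologicalType) (Y C : set T) : Prop :=
  exists2 x, Y x & C = connected_component Y x.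

Lemma ideal_gen_eval_proper (R : comNzRingType) (n : nat)
    (G : set {mpoly R[n]}) (v : 'I_n -> R) :
  (forall g, G g -> g.@[v] = 0) -> forall p, ideal_gen G p -> p.@[v] = 0.
Proof.
move=> Gv p Gp; apply: (@ideal_gen_min _ G [set p | p.@[v] = 0]) Gp => //=.
- by rewrite meval0.
- by move=> f g f0 g0; rewrite mevalD f0 g0 addr0.
- by move=> f g g0; rewrite mevalM g0 mulr0.
Qed.

Notation X4_0 := 'X_(@Ordinal 4 0 isT).
Notation X4_1 := 'X_(@Ordinal 4 1 isT).
Notation X4_2 := 'X_(@Ordinal 4 2 isT).
Notation X4_3 := 'X_(@Ordinal 4 3 isT).

Definition pt4 (R : Type) (r0 r1 r2 r3 : R) (i : 'I_4) : R :=
  nth r0 [:: r0; r1; r2; r3] i.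

(* The Laurent polynomial ring K[c1^±1, c2^±1], presented as
   K[c1, c2, d1, d2] / (c1 d1 - 1, c2 d2 - 1). *)
Section Laurent.
Variable K : comNzRingType.

Definition laurent_rels : set {mpoly K[4]} :=
  [set X4_0 * X4_2 - 1; X4_1 * X4_3 - 1].

Lemma laurent_proper : ~ ideal_gen laurent_rels 1.
Proof.
move=> /(@ideal_gen_eval_proper _ _ _ (fun=> 1)) H.
have /eqP : (1 : {mpoly K[4]}).@[fun=> 1] = 0.
  by apply: H => _ [] ->; rewrite mevalB meval1 mevalM !mevalXU mulr1 subrr.
by rewrite meval1 oner_eq0.
Qed.

Definition laurent : Type := {ideal_quot (span_ideal laurent_proper)}.
HB.instance Definition _ := GRing.ComNzRing.on laurent.

Definition laurent_pi (f : {mpoly K[4]}) : laurent :=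
  \pi_{ideal_quot (span_ideal laurent_proper)} f.

Definition laurent_cst (k : K) : laurent := laurent_pi k%:MP.
Definition laurent_c1 : laurent := laurent_pi X4_0.
Definition laurent_c2 : laurent := laurent_pi X4_1.

End Laurent.

(* The four variables are in the order x1, x2, y1, y2. The rank two cluster
   algebra with principal coefficients is the case R = K[c1^±1, c2^±1],
   (t1, t2) = (c1, c2); trivial coefficients are t1 = t2 = 1. The base change of
   [cluster t1 t2 a b] along tau : R -> R' is [cluster (tau t1) (tau t2) a b];
   in particular [cluster (1 : R) 1 a b] over R is the trivial family on Spec R
   when R is a K-algebra. *)
Section Cluster.
Variables (R : comNzRingType) (t1 t2 : R) (a b : int).

Definition cluster_rels : set {mpoly R[4]} :=
  [set X4_0 * X4_2 - t1%:MP - X4_1 ^+ `|b|%N;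
       X4_1 * X4_3 - t2%:MP - X4_0 ^+ `|a|%N].

Let pt : 'I_4 -> R := pt4 1 1 (t1 + 1) (t2 + 1).

Lemma cluster_eval0 p : ideal_gen cluster_rels p -> p.@[pt] = 0.
Proof.
apply: ideal_gen_eval_proper => _ [] ->;
  by rewrite !mevalB mevalM rmorphXn /= !mevalXU mevalC /pt /pt4 /= expr1n; ring.
Qed.

Lemma cluster_proper : ~ ideal_gen cluster_rels 1.
Proof. by move=> /cluster_eval0/eqP; rewrite meval1 oner_eq0. Qed.

Definition cluster : Type := {ideal_quot (span_ideal cluster_proper)}.
HB.instance Definition _ := GRing.ComNzRing.on cluster.

Definition cluster_pi (f : {mpoly R[4]}) : cluster :=
  \pi_{ideal_quot (span_ideal cluster_proper)} f.

Definition cluster_cst (c : R) : cluster := cluster_pi c%:MP.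

End Cluster.

(* Only meant for closed points m, where the residue field is R/m and hence the
   fiber ring is A (x)_R R/m = A/mA. *)
Section Fiber.
Variables (R : comNzRingType) (t1 t2 : R) (a b : int) (m : Spec R).

Let A : comNzRingType := cluster t1 t2 a b.

Let pt : 'I_4 -> R := pt4 1 1 (t1 + 1) (t2 + 1).

Lemma fiber_proper :
  ~ ideal_gen [set cluster_cst t1 t2 a b c | c in [set c | in_pt m c]] 1.
Proof.
pose ev (x : A) : R := (repr x).@[pt].
have evE f : ev (cluster_pi t1 t2 a b f) = f.@[pt].
  apply/eqP; rewrite -subr_eq0 -mevalB; apply/eqP/(@cluster_eval0 _ _ _ a b).
  suff : Quotient.equiv (span_ideal (@cluster_proper R t1 t2 a b))
      (repr (cluster_pi t1 t2 a b f)) f by move=> /asboolP.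
  by rewrite Quotient.equivE Quotient.idealrBE; apply/eqP; rewrite reprK.
have piE (x : A) : x = cluster_pi t1 t2 a b (repr x) by rewrite /cluster_pi reprK.
have evD x y : ev (x + y) = ev x + ev y.
  rewrite {1}[x]piE {1}[y]piE.
  have -> : (cluster_pi t1 t2 a b (repr x) + cluster_pi t1 t2 a b (repr y) : A)
      = cluster_pi t1 t2 a b (repr x + repr y) by rewrite /cluster_pi rmorphD.
  by rewrite evE mevalD.
have evM x y : ev (x * y) = ev x * ev y.
  rewrite {1}[x]piE {1}[y]piE.
  have -> : (cluster_pi t1 t2 a b (repr x) * cluster_pi t1 t2 a b (repr y) : A)
      = cluster_pi t1 t2 a b (repr x * repr y) by rewrite /cluster_pi rmorphM.
  by rewrite evE mevalM.
have ev0 : ev 0 = 0 by rewrite -(rmorph0 \pi_{ideal_quot _}) evE meval0.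
have ev1 : ev 1 = 1 by rewrite -(rmorph1 \pi_{ideal_quot _}) evE meval1.
move=> H; suff : in_pt m (ev 1) by rewrite ev1 in_pt1.
apply: (@ideal_gen_min _ _ [set x | in_pt m (ev x)]) H => /=.
- by rewrite ev0 in_pt0.
- by move=> x y; rewrite evD; exact: in_ptD.
- by move=> x y; rewrite evM; exact: in_ptMl.
- by move=> _ [c mc <-] /=; rewrite evE mevalC.
Qed.

Definition fiber : Type := {ideal_quot (span_ideal fiber_proper)}.
HB.instance Definition _ := GRing.ComNzRing.on fiber.

Definition fiber_pi (x : cluster t1 t2 a b) : fiber :=
  \pi_{ideal_quot (span_ideal fiber_proper)} x.

End Fiber.

(* The variables are in the order w1, w2, z1, z2. *)
Section WCluster.
Variables (K : comNzRingType) (a b : int).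

Definition wcluster_rels : set {mpoly K[4]} :=
  [set X4_0 * X4_2 - 1 + X4_1 ^+ `|b|%N; X4_1 * X4_3 - 1 + X4_0 ^+ `|a|%N].

Lemma wcluster_proper : ~ ideal_gen wcluster_rels 1.
Proof.
move=> /(@ideal_gen_eval_proper _ _ _ (pt4 1 1 0 0)) H.
have /eqP : (1 : {mpoly K[4]}).@[pt4 1 1 0 0] = 0.
  apply: H => _ [] ->;
    by rewrite mevalD mevalB mevalM rmorphXn /= !mevalXU meval1 /pt4 /= expr1n; ring.
by rewrite meval1 oner_eq0.
Qed.

Definition wcluster : Type := {ideal_quot (span_ideal wcluster_proper)}.
HB.instance Definition _ := GRing.ComNzRing.on wcluster.

Definition wcluster_pi (f : {mpoly K[4]}) : wcluster :=
  \pi_{ideal_quot (span_ideal wcluster_proper)} f.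

Definition wcluster_cst (k : K) : wcluster := wcluster_pi k%:MP.

End WCluster.
Arguments wcluster_cst {K} a b k.

Section WSing.
Variables (K : fieldType) (a b : int).

Let w1 : wcluster K a b := wcluster_pi a b X4_0.
Let w2 : wcluster K a b := wcluster_pi a b X4_1.
Let z1 : wcluster K a b := wcluster_pi a b X4_2.
Let z2 : wcluster K a b := wcluster_pi a b X4_3.

Definition W_a (zeta : K) : set (Spec (wcluster K a b)) :=
  Vset [set a%:~R; w1 - wcluster_cst a b zeta; w2;
            z1 - wcluster_cst a b zeta^-1; z2].

Definition W_b (xi : K) : set (Spec (wcluster K a b)) :=
  Vset [set b%:~R; w1; w2 - wcluster_cst a b xi; z1;
            z2 - wcluster_cst a b xi^-1].

End WSing.
Arguments W_a {K} a b zeta.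
Arguments W_b {K} a b xi.

Section PrincipalCoefficients.
Variables (K : fieldType) (a b : int) (eta : Spec (laurent K)).

Definition Xfib : comNzRingType := fiber (laurent_c1 K) (laurent_c2 K) a b eta.

Definition Xfib_pi (f : {mpoly (laurent K)[4]}) : Xfib :=
  fiber_pi eta (cluster_pi (laurent_c1 K) (laurent_c2 K) a b f).

Definition Xfib_cst (k : K) : Xfib := Xfib_pi (laurent_cst k)%:MP.

Let x1 : Xfib := Xfib_pi X4_0.
Let x2 : Xfib := Xfib_pi X4_1.
Let y1 : Xfib := Xfib_pi X4_2.
Let y2 : Xfib := Xfib_pi X4_3.

(* [eta] is a closed point and [eta1], [eta2] in K are the images of c1, c2 in
   its residue field. *)
Definition closed_point_at (eta1 eta2 : K) : Prop :=
  [/\ closed [set eta],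
      in_pt eta (laurent_c1 K - laurent_cst eta1) &
      in_pt eta (laurent_c2 K - laurent_cst eta2)].

Definition Y_a (eta1 eta2 : K) : set (Spec Xfib) :=
  Vset [set a%:~R; x1 ^+ `|a|%N + Xfib_cst eta2; x2;
            x1 * y1 - Xfib_cst eta1; y2].

Definition Y_b (eta1 eta2 : K) : set (Spec Xfib) :=
  Vset [set b%:~R; x1; x2 ^+ `|b|%N + Xfib_cst eta1; y1;
            x2 * y2 - Xfib_cst eta2].

End PrincipalCoefficients.
Arguments Y_a {K} a b eta eta1 eta2.
Arguments Y_b {K} a b eta eta1 eta2.

(* The finite surjective cover S -> S, (c1, c2) |-> (c1^|b|, c2^|a|), which adjoins
   the roots of the coefficients needed to normalize them to 1. The family with
   principal coefficients is trivial only after this pullback: over S itself, if p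
   divides a but not b, the scheme of non-smooth points over S is x2 = y2 = 0,
   x1^|a| + c2 = 0, which is integral, whereas for the trivial family it is
   x1^|a| + 1 = 0, which is not reduced. *)
Definition root_cover (K : comNzRingType) (a b : int)
    (tau : {rmorphism laurent K -> laurent K}) : Prop :=
  [/\ forall k, tau (laurent_cst k) = laurent_cst k,
      tau (laurent_c1 K) = laurent_c1 K ^+ `|b|%N &
      tau (laurent_c2 K) = laurent_c2 K ^+ `|a|%N].

Definition is_characteristic (K : nzRingType) (p : nat) : Prop :=
  if p == 0%N then [pchar K] =i pred0 else p \in [pchar K].

(* The largest divisor of [n] that is nonzero mod [p]; mod 0 is equality. *)
Definition max_divisor_nmod (p n : nat) : nat :=
  \max_(d <- divisors n | (d != 0 %[mod p])%N) d.

(* Main.v *)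
(* Rescaling the variables by roots of the coefficients brings every fiber to the
   form w1 z1 = 1 - w2^|b|, w2 z2 = 1 - w1^|a|, which is symmetric in the two
   indices and is covered by the charts w1 <> 0 and w2 <> 0.

   The surface F is integral, because it embeds in K(w1, w2), and any three of its
   elements are algebraically dependent, by counting monomials. Reducing a
   dependence relation modulo a chain of primes P0 < P1 < P2 shows that every
   element of F is constant modulo P2. Hence F has dimension two and primes of
   height two are closed points, with no appeal to the Nullstellensatz, Krull's
   theorems or transcendence degree. Outside (w1, w2, z2) = (zeta, 0, 0) with p | a
   the maximal ideal of the local ring is then generated by explicit elements, as
   many as the height.

   At such a point write |a| = alpha p^m, q = p^m, and w1^alpha - 1 =
   (w1 - zeta) u with u a local unit. Then w2 z2 = 1 - w1^|a| = -((w1 - zeta) u)^q,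
   so x = w2 / u^q, y = z2, z = w1 - zeta satisfy xy + z^q = 0 and generate the
   maximal ideal. Truncating power series gives a map from K[[x,y,z]]/(xy + z^q)
   onto the completion; it is injective because there is a local map back from F to
   that ring, in which the ideal (xy + z^q) is closed. The map back also shows that
   the cotangent space is three-dimensional, so the point is singular. *)

Require Import Defs.
From HB Require Import structures.
From mathcomp Require Import all_boot all_order all_algebra.
From mathcomp Require Import generic_quotient ring_quotient.
From mathcomp Require Import boolp classical_sets functions.
From mathcomp Require Import topology_structure connected.
From mathcomp Require Import mpoly ring.
Import GRing.Theory.

Set Implicit Arguments.
Unset Strict Implicit.
Unset Printing Implicit Defensive.

Local Open Scope classical_set_scope.
Local Open Scope ring_scope.
Local Open Scope quotient_scope.

(** * Ideals, quotients and localizations *)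

(** Where w1 is invertible, z1 is redundant and w2 z2 lies in K[w1], so up to a power of w1 every
    element lies in K[w1][w2] + K[w1][z2]. This normal form stands in for elimination theory: it
    gives the embedding in the function field, and evaluating it at a point shows that the
    coordinate differences generate the maximal ideal. The two charts suffice because w1 z1 + w2^|b|
    = 1. Regularity is a count: generators of the maximal ideal against an explicit chain of primes
    of the same length. At a singular point the count fails because q > 1 leaves xy + z^q without
    linear part. The map back from F does triple duty: it identifies the residue field with K, makes
    the linear parts of the three generators independent, and yields injectivity on the completion.
    The ideal (xy + z^q) is closed for an elementary reason: division by it has an explicit formula
    in which each coefficient of the quotient uses finitely many coefficients of the dividend. *)

Section RMorphismPack.
Variables A B : nzRingType.

Lemma rmorphism_of (f : A -> B) :
  {morph f : x y / x + y} -> {morph f : x y / x * y} -> f 1 = 1 ->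
  exists g : {rmorphism A -> B}, forall x, g x = f x.
Proof.
move=> fD fM f1.
have f0 : f 0 = 0 by apply: (addrI (f 0)); rewrite -fD !addr0.
have fB : zmod_morphism f.
  move=> x y; apply: (addIr (f y)); rewrite -fD !subrK //.
pose g : {rmorphism A -> B} :=
  HB.pack f (GRing.isZmodMorphism.Build A B f fB)
            (GRing.isMonoidMorphism.Build A B f (conj f1 fM)).
by exists g.
Qed.

End RMorphismPack.

Lemma mem_ideal_gen (A : comNzRingType) (G : set A) x : G x -> ideal_gen G x.
Proof.
move=> Gx; exists [:: (1, x)]; last by rewrite big_seq1 mul1r.
by move=> p; rewrite inE => /eqP ->.
Qed.

Section IdealGen.
Variable A : comNzRingType.
Implicit Types (G H : set A) (I : idealr A).

Lemma ideal_genMr G a x : ideal_gen G x -> ideal_gen G (x * a).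
Proof. by rewrite mulrC; exact: ideal_genM. Qed.

Lemma ideal_genN G x : ideal_gen G x -> ideal_gen G (- x).
Proof. by rewrite -mulN1r; exact: ideal_genM. Qed.

Lemma sub_ideal_gen G H : G `<=` ideal_gen H -> ideal_gen G `<=` ideal_gen H.
Proof.
by apply: ideal_gen_min; [exact: ideal_gen0|exact: ideal_genD|exact: ideal_genM].
Qed.

Lemma ideal_gen_morph (B : comNzRingType) (f : {rmorphism A -> B}) G x :
  ideal_gen G x -> ideal_gen (f @` G) (f x).
Proof.
apply: (@ideal_gen_min A G [set x | ideal_gen (f @` G) (f x)]) => /=.
- by rewrite rmorph0; exact: ideal_gen0.
- by move=> u v Gu Gv; rewrite rmorphD; exact: ideal_genD.
- by move=> u v Gv; rewrite rmorphM; exact: ideal_genM.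
- by move=> u Gu; apply: mem_ideal_gen; exists u.
Qed.

Lemma ideal_gen_ker (B : comNzRingType) (f : {rmorphism A -> B}) G x :
  (forall g, G g -> f g = 0) -> ideal_gen G x -> f x = 0.
Proof.
move=> fG; apply: (@ideal_gen_min A G [set x | f x = 0]) => //=.
- exact: rmorph0.
- by move=> u v Gu Gv; rewrite rmorphD Gu Gv addr0.
- by move=> u v Gv; rewrite rmorphM Gv mulr0.
Qed.

Lemma ideal_gen_in_pt (P : Spec A) G :
  (forall g, G g -> in_pt P g) -> forall x, ideal_gen G x -> in_pt P x.
Proof.
move=> GP; apply: (@ideal_gen_min A G [set x | in_pt P x]) => //=.
- exact: in_pt0.
- exact: in_ptD.
- exact: in_ptMl.
Qed.

Lemma in_ptN (P : Spec A) x : in_pt P (- x) = in_pt P x.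
Proof.
have PN y : in_pt P y -> in_pt P (- y) by move=> Py; rewrite -mulN1r in_ptMl.
by apply/idP/idP => [/PN|/PN //]; rewrite opprK.
Qed.

Lemma in_ptB (P : Spec A) x y : in_pt P x -> in_pt P y -> in_pt P (x - y).
Proof. by move=> Px Py; rewrite in_ptD ?in_ptN. Qed.

Lemma in_pt_congr (P : Spec A) x y : in_pt P (x - y) -> in_pt P x = in_pt P y.
Proof.
move=> Pxy; apply/idP/idP => H; first by rewrite -[y](subKr x) in_ptB.
by rewrite -[x](subrK y) in_ptD.
Qed.

Lemma in_ptX (P : Spec A) x n : in_pt P (x ^+ n) = (0 < n)%N && in_pt P x.
Proof.
elim: n => [|n IHn]; first by rewrite expr0 in_pt1.
by rewrite exprS in_ptM IHn; case: n {IHn} => [|n]; rewrite ?orbF ?orbb.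
Qed.

Lemma in_pt_unit (P : Spec A) x y : y * x = 1 -> in_pt P x = false.
Proof.
by move=> xy; apply/negP => Px; have := in_ptMl y Px; rewrite xy in_pt1.
Qed.

Lemma Spec_eq (P Q : Spec A) : (forall x, in_pt P x = in_pt Q x) -> P = Q.
Proof.
case: P Q => [p hp] [q hq] /= /funext pq.
by move: pq hp hq; rewrite /in_pt /= => -> hp hq; congr exist; exact: Prop_irrelevance.
Qed.

Lemma Spec_of (p : A -> bool) : p 0 -> ~~ p 1 ->
  (forall x y, p x -> p y -> p (x + y)) -> (forall x y, p y -> p (x * y)) ->
  (forall x y, p (x * y) -> p x || p y) ->
  exists P : Spec A, forall x, in_pt P x = p x.
Proof.
move=> p0 p1 pD pM pP.
have pI : idealr_closed p.
  by split=> // a x y px py; apply: pD => //; exact: pM.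
by exists (exist _ p (conj pI pP)).
Qed.

(** The source of explicit primes: the zero prime is the kernel of the identity, primes of height
    one are kernels of restrictions to curves. *)
Lemma ker_pt (B : comNzRingType) (f : {rmorphism A -> B}) :
  (forall x y : B, x * y = 0 -> x = 0 \/ y = 0) ->
  exists P : Spec A, forall x, in_pt P x <-> f x = 0.
Proof.
move=> B0; have [|||||P PE] := @Spec_of (fun x => f x == 0).
- by rewrite rmorph0.
- by rewrite rmorph1 oner_eq0.
- by move=> x y /eqP fx /eqP fy; rewrite rmorphD fx fy addr0.
- by move=> x y /eqP fy; rewrite rmorphM fy mulr0.
- by move=> x y; rewrite rmorphM => /eqP/B0[] ->; rewrite eqxx ?orbT.
- by exists P => x; rewrite PE; split=> /eqP.
Qed.

Lemma quot_piP I x y :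
  \pi_{ideal_quot I} x = \pi_{ideal_quot I} y <-> (I : A -> bool) (x - y).
Proof.
rewrite -[(I : A -> bool) (x - y)]/(x - y \in (I : {pred A})) Quotient.idealrBE.
by split=> /eqP.
Qed.

Lemma quot_pi0P I x : \pi_{ideal_quot I} x = 0 <-> (I : A -> bool) x.
Proof. by rewrite -(rmorph0 \pi_{ideal_quot I}) quot_piP subr0. Qed.

Lemma quot_lift I (B : comNzRingType) (f : {rmorphism A -> B}) :
  (forall x, (I : A -> bool) x -> f x = 0) ->
  exists g : {rmorphism {ideal_quot I} -> B},
    forall x, g (\pi_{ideal_quot I} x) = f x.
Proof.
move=> fI; pose g (y : {ideal_quot I}) := f (repr y).
have gE x : g (\pi_{ideal_quot I} x) = f x.
  apply/eqP; rewrite -subr_eq0 -rmorphB; apply/eqP/fI.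
  by apply/quot_piP; rewrite reprK.
have [|||h hE] := @rmorphism_of _ _ g.
- move=> x y; rewrite -[x]reprK -[y]reprK -rmorphD !gE; exact: rmorphD.
- move=> x y; rewrite -[x]reprK -[y]reprK -rmorphM !gE; exact: rmorphM.
- by rewrite -(rmorph1 \pi_{ideal_quot I}) gE rmorph1.
by exists h => x; rewrite hE gE.
Qed.

End IdealGen.

Lemma span_idealE (A : comNzRingType) (G : set A) (G1 : ~ ideal_gen G 1) x :
  (span_ideal G1 : A -> bool) x <-> ideal_gen G x.
Proof. by split=> /asboolP. Qed.

Lemma rmorph_inv (A B : comNzRingType) (f : {rmorphism A -> B}) :
  bijective f -> exists g : {rmorphism B -> A}, cancel f g /\ cancel g f.
Proof.
move=> [g fg gf]; have [|||h hE] := @rmorphism_of _ _ g.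
- by move=> x y; rewrite -{1}(gf x) -{1}(gf y) -rmorphD fg.
- by move=> x y; rewrite -{1}(gf x) -{1}(gf y) -rmorphM fg.
- by rewrite -(rmorph1 f) fg.
by exists h; split=> x; rewrite hE.
Qed.

Section LocalizationTheory.
Variables (A : comNzRingType) (P : Spec A).
Local Notation L := (localize P).

Lemma loc_map_rmorphism : exists g : {rmorphism A -> L}, forall x, g x = loc_map P x.
Proof.
apply: rmorphism_of => //.
- move=> x y; rewrite -[RHS]Localization.pi_add; apply: Localization.pi_eq => /=.
  by rewrite ?Localization.dvalM ?Localization.dval1 ?mulr1.
- move=> x y; rewrite -[RHS]Localization.pi_mul; apply: Localization.pi_eq => /=.
  by rewrite ?Localization.dvalM ?Localization.dval1 ?mulr1.
Qed.

Lemma loc_fraction (l : L) :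
  exists x s, ~~ in_pt P s /\ l * loc_map P s = loc_map P x.
Proof.
elim/quotW: l => -[x s]; exists x, (Localization.dval s); split; first exact: (svalP s).
rewrite -[LHS]Localization.pi_mul; apply: Localization.pi_eq => /=.
by rewrite ?Localization.dvalM ?Localization.dval1 ?mulr1.
Qed.

Lemma nonunit_loc x : nonunit (loc_map P x) = in_pt P x.
Proof. exact: Localization.nonunit_pi. Qed.

Lemma loc_unit s : ~~ in_pt P s -> exists t : L, t * loc_map P s = 1.
Proof.
rewrite -nonunit_loc => /asboolPn H; apply: contrapT => H'; exact: H.
Qed.

Lemma loc_eq0 x : loc_map P x = 0 -> exists2 s, ~~ in_pt P s & s * x = 0.
Proof.
case/Localization.equivlP => u /=; rewrite ?Localization.dval1 !mulr1 mulr0 => ux.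
by exists (Localization.dval u) => //; exact: (svalP u).
Qed.

(** The value at [l] is characterized by [h l * f s = f x] for every fraction representing [l].
    Since [f s] is a unit, the ring laws may be checked after multiplication by the image of a
    common denominator. *)
Lemma loc_lift (B : comNzRingType) (f : {rmorphism A -> B}) :
  (forall s, ~~ in_pt P s -> exists t, t * f s = 1) ->
  exists g : {rmorphism L -> B}, forall x, g (loc_map P x) = f x.
Proof.
move=> fU; have [j jE] := loc_map_rmorphism.
have [h hE] : exists h : L -> B,
    forall l x s, ~~ in_pt P s -> l * loc_map P s = loc_map P x -> h l * f s = f x.
  have /choice[h hE] : forall l : L, exists b,
      forall x s, ~~ in_pt P s -> l * loc_map P s = loc_map P x -> b * f s = f x.
    move=> l; have [y [t [Pt lt]]] := loc_fraction l.
    have [t' tt'] := fU t Pt; exists (t' * f y) => x s Ps ls.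
    have : loc_map P (y * s - x * t) = 0.
      by rewrite -jE rmorphB !rmorphM !jE -lt -ls; ring.
    move=> /loc_eq0[u Pu]; have [u' uu'] := fU u Pu.
    move=> /(congr1 f); rewrite rmorph0 rmorphM rmorphB !rmorphM => /(congr1 ( *%R u')).
    rewrite mulrA uu' mul1r mulr0 => /eqP; rewrite subr_eq0 => /eqP ys.
    by rewrite -mulrA ys mulrCA tt' mulr1.
  by exists h => l; exact: hE.
have [|||g gE] := @rmorphism_of L B h.
- move=> l m; have [x [s [Ps ls]]] := loc_fraction l; have [y [t [Pt mt]]] := loc_fraction m.
  have Pst : ~~ in_pt P (s * t) by rewrite in_ptM negb_or Ps.
  have [u uE] := fU _ Pst.
  rewrite -[LHS]mul1r -[RHS]mul1r -uE -!mulrA; congr (u * _).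
  rewrite mulrC (hE (l + m) (x * t + y * s)) //; last first.
    by rewrite -!jE !rmorphD !rmorphM !jE -ls -mt; ring.
  by rewrite !rmorphM rmorphD !rmorphM -(hE _ _ _ Ps ls) -(hE _ _ _ Pt mt); ring.
- move=> l m; have [x [s [Ps ls]]] := loc_fraction l; have [y [t [Pt mt]]] := loc_fraction m.
  have Pst : ~~ in_pt P (s * t) by rewrite in_ptM negb_or Ps.
  have [u uE] := fU _ Pst.
  rewrite -[LHS]mul1r -[RHS]mul1r -uE -!mulrA; congr (u * _).
  rewrite mulrC (hE (l * m) (x * y)) //; last first.
    by rewrite -!jE !rmorphM !jE -ls -mt; ring.
  by rewrite !rmorphM -(hE _ _ _ Ps ls) -(hE _ _ _ Pt mt); ring.
- have P1 : ~~ in_pt P 1 by rewrite in_pt1.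
  by rewrite -[LHS]mulr1 -(rmorph1 f) (hE 1 1 1) // mul1r.
exists g => x; rewrite gE -[LHS]mulr1 -(rmorph1 f); apply: hE; first by rewrite in_pt1.
by rewrite -!jE rmorph1 mulr1.
Qed.

Lemma loc_nonunit_gen (gs : seq A) :
  (forall g, g \in gs -> in_pt P g) ->
  (forall x, in_pt P x -> exists2 s, ~~ in_pt P s & ideal_gen [set` gs] (s * x)) ->
  [set l : L | nonunit l] = ideal_gen [set` map (loc_map P) gs].
Proof.
move=> gsP Pgs; have [j jE] := loc_map_rmorphism.
have jgs : [set` map (loc_map P) gs] = j @` [set` gs].
  apply/seteqP; split=> [_ /mapP[g gg ->]|_ [g gg <-]] /=; first by exists g.
  by rewrite jE; apply: map_f.
apply/seteqP; split=> [l /= Nl|].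
  have [x [s [Ps ls]]] := loc_fraction l; have [s' ss'] := loc_unit Ps.
  have lE : l = s' * loc_map P x by rewrite -ls mulrCA ss' mulr1.
  have Px : in_pt P x.
    rewrite -nonunit_loc -ls mulrC; have [_ _ H] := Localization.nonunit_idealr P.
    rewrite -[_ * _]addr0; apply: H => //.
    by have [] := Localization.nonunit_idealr P.
  have [t Pt /(ideal_gen_morph j)] := Pgs x Px; rewrite -jgs => /(ideal_genM s').
  have [t' tt'] := loc_unit Pt; move=> /(ideal_genM t').
  by rewrite rmorphM !jE; congr ideal_gen; rewrite lE mulrCA; congr (_ * _); rewrite mulrA tt' mul1r.
rewrite jgs; have [N0 N1 NM] := Localization.nonunit_idealr P.
apply: ideal_gen_min => //=.
- by move=> x y Nx Ny; rewrite -[x]mul1r; exact: NM.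
- by move=> x y Ny; rewrite -[_ * _]addr0; exact: NM.
- by move=> _ [g gg <-]; rewrite jE /= nonunit_loc; exact: gsP.
Qed.

Lemma loc_local_ring : local_ring L.
Proof.
have [N0 N1 NM] := Localization.nonunit_idealr P.
by move=> x y Nx Ny; rewrite -[x]mul1r; exact: NM.
Qed.

Lemma loc_noetherian : noetherian_ring A -> noetherian_ring L.
Proof.
move=> nA J J0 JM; have [j jE] := loc_map_rmorphism.
have [||s sE] := nA [set x | J (j x)]; first by rewrite /= rmorph0.
- by move=> a x y /= Jx Jy; rewrite rmorphD rmorphM; exact: JM.
have jgs : [set` map (loc_map P) s] = j @` [set` s].
  apply/seteqP; split=> [_ /mapP[g gg ->]|_ [g gg <-]] /=; first by exists g.
  by rewrite jE; apply: map_f.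
have JMl x y : J y -> J (x * y) by move=> Jy; rewrite -[_ * _]addr0; exact: JM.
exists (map (loc_map P) s); rewrite jgs; apply/seteqP; split=> [l Jl|].
  have [x [t [Pt lt]]] := loc_fraction l; have [t' tt'] := loc_unit Pt.
  have lE : l = t' * loc_map P x by rewrite -lt mulrCA tt' mulr1.
  have : [set x | J (j x)] x by rewrite /= jE -lt mulrC; exact: JMl.
  by rewrite sE => /(ideal_gen_morph j)/(ideal_genM t'); rewrite jE -lE.
apply: (@ideal_gen_min _ _ J) => [//| | |].
- by move=> x y Jx Jy; rewrite -[x]mul1r; exact: JM.
- exact: JMl.
- move=> _ [x xs <-]; have : ideal_gen [set` s] x by exact: mem_ideal_gen.
  by rewrite -sE.
Qed.

End LocalizationTheory.

(** * Chains of primes and the Hilbert basis theorem *)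

Section PrimeChains.
Variable A : comNzRingType.
Implicit Types P Q : Spec A.

Definition spec_lt P Q : Prop :=
  (forall f, in_pt P f -> in_pt Q f) /\ (exists2 f, in_pt Q f & ~~ in_pt P f).

(* The chain need not end at [P]: these are the chains of the local ring at [P]. *)
Definition chain_below P (d : nat) : Prop :=
  exists2 c : 'I_d.+1 -> Spec A,
    forall i j : 'I_d.+1, (i < j)%N -> spec_lt (c i) (c j) &
    forall i f, in_pt (c i) f -> in_pt P f.

Lemma spec_lt_trans P Q R : spec_lt P Q -> spec_lt Q R -> spec_lt P R.
Proof.
move=> [PQ _] [QR [f Rf Qf]]; split=> [g /PQ/QR //|].
by exists f => //; apply: contra Qf; exact: PQ.
Qed.

Lemma chain_below0 P : chain_below P 0.
Proof. by exists (fun=> P) => // i j; rewrite !ord1. Qed.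

Lemma prime_chain1 P Q : spec_lt P Q -> chain_below Q 1.
Proof.
move=> PQ; exists (fun i => if (i == 0 :> nat) then P else Q) => /=.
  by move=> [[|[|i]] hi] [[|[|j]] hj].
by move=> [[|[|i]] hi] //= f; case: PQ => H _; exact: H.
Qed.

Lemma chain_below2 P Q R : spec_lt P Q -> spec_lt Q R -> chain_below R 2.
Proof.
move=> PQ QR; have PR := spec_lt_trans PQ QR.
exists (fun i => if (i == 0 :> nat) then P else if (i == 1 :> nat) then Q else R) => /=.
  by move=> [[|[|[|i]]] hi] [[|[|[|j]]] hj].
by move=> [[|[|[|i]]] hi] //= f; [case: PR => H _|case: QR => H _]; exact: H.
Qed.

Lemma prime_chain_split d :
  prime_chain A d -> exists P, chain_below P d.
Proof.
move=> [c cP]; exists (c ord_max), c => // i f.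
have [->//|ni] := eqVneq i ord_max.
have [|H _] := cP i ord_max; last exact: H.
by rewrite ltn_neqAle -ltnS ltn_ord andbT; move: ni; rewrite -val_eqE.
Qed.

(** [Q] is the last member but one of the chain: it lies strictly below the last one, which is
    contained in [P]. *)
Lemma chain_below_inv P d :
  chain_below P d.+1 -> exists2 Q, chain_below Q d & spec_lt Q P.
Proof.
move=> [c cP cb].
have le (i j : 'I_d.+2) : (i <= j)%N -> forall f, in_pt (c i) f -> in_pt (c j) f.
  rewrite leq_eqVlt => /orP[/eqP ij f|ij].
    by rewrite (_ : i = j) //; exact: val_inj.
  by have [] := cP i j ij.
exists (c (widen_ord (leqnSn d.+1) ord_max)).
  exists (c \o widen_ord (leqnSn d.+1)) => [i j ij|i f]; first exact: cP.
  by apply: le; rewrite /= -ltnS.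
have [H [f cf ncf]] := cP (widen_ord (leqnSn d.+1) ord_max) ord_max (ltnSn d).
by split=> [g /H/cb //|]; exists f => //; exact: cb cf.
Qed.

Lemma chain_below_le P d e : (d <= e)%N -> chain_below P e -> chain_below P d.
Proof.
move=> de [c cP cb].
by exists (c \o widen_ord (de : d < e.+1)%N) => [i j ij|i f]; [exact: cP|exact: cb].
Qed.

Lemma chain_below_prime_chain P d : chain_below P d -> prime_chain A d.
Proof. by move=> [c cP _]; exists c. Qed.

(** Membership is required for all numerators of [l]; one numerator decides it, because an element
    outside [P] is also outside [Q]. *)
Lemma loc_ext P Q : (forall f, in_pt Q f -> in_pt P f) ->
  exists Q' : Spec (localize P), forall x, in_pt Q' (loc_map P x) = in_pt Q x.
Proof.
move=> QP; have [j jE] := loc_map_rmorphism P.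
pose q (l : localize P) := `[< forall x s, ~~ in_pt P s ->
  l * loc_map P s = loc_map P x -> in_pt Q x >].
have qE x : q (loc_map P x) = in_pt Q x.
  apply/asboolP/idP => [H|Qx y s Ps].
    by apply: (H x 1); rewrite ?in_pt1 // -!jE rmorph1 mulr1.
  move=> /eqP; rewrite -subr_eq0 -!jE -rmorphM -rmorphB jE => /eqP/loc_eq0[t Pt].
  move=> /(congr1 (in_pt Q)); rewrite in_pt0 in_ptM.
  have /negPf -> /= : ~~ in_pt Q t by apply: contra Pt; exact: QP.
  by move/in_pt_congr <-; rewrite in_ptM Qx.
have qM l s : ~~ in_pt P s -> q (l * loc_map P s) = q l.
  move=> Ps; have [x [t [Pt lt]]] := loc_fraction l.
  apply/asboolP/asboolP => H y u Pu.
    move=> lu; have := H (y * s) u Pu; rewrite in_ptM.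
    have /negPf -> /= : ~~ in_pt Q s by apply: contra Ps; exact: QP.
    by rewrite orbF; apply; rewrite -mulrA (mulrC (loc_map P s)) mulrA lu -!jE rmorphM.
  by rewrite -mulrA -!jE -rmorphM !jE; apply: H; rewrite in_ptM negb_or Ps.
(* Common denominators reduce the axioms of a prime ideal for [q] to those for [Q]. *)
have cd (l m : localize P) : exists x y s, [/\ ~~ in_pt P s,
    l * loc_map P s = loc_map P x & m * loc_map P s = loc_map P y].
  have [x [s [Ps ls]]] := loc_fraction l; have [y [t [Pt mt]]] := loc_fraction m.
  exists (x * t), (y * s), (s * t); split; first by rewrite in_ptM negb_or Ps.
    by rewrite -!jE !rmorphM !jE -ls mulrA.
  by rewrite -!jE !rmorphM !jE -mt; ring.
have qD l m : exists x y, q l = in_pt Q x /\ q m = in_pt Q y /\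
    q (l * m) = in_pt Q (x * y) /\ q (l + m) = in_pt Q (x + y).
  have [x [y [s [Ps ls ms]]]] := cd l m; exists x, y.
  rewrite -(qM l s Ps) ls -(qM m s Ps) ms !qE; do 3!split=> //.
    rewrite -(qM _ s Ps) -(qM _ s Ps).
    by rewrite -mulrA mulrACA ls ms -!jE -rmorphM !jE qE.
  by rewrite -(qM _ s Ps) mulrDl ls ms -!jE -rmorphD !jE qE.
have [|||||Q' Q'E] := @Spec_of (localize P) q.
- by rewrite -(rmorph0 j) jE qE in_pt0.
- by rewrite -(rmorph1 j) jE qE in_pt1.
- by move=> l m; have [x [y [-> [-> [_ ->]]]]] := qD l m; exact: in_ptD.
- by move=> l m; have [x [y [_ [-> [-> _]]]]] := qD l m; exact: in_ptMl.
- by move=> l m; have [x [y [-> [-> [-> _]]]]] := qD l m; rewrite in_ptM.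
by exists Q' => x; rewrite Q'E qE.
Qed.

Lemma loc_prime_chain P d : prime_chain (localize P) d <-> chain_below P d.
Proof.
have [j jE] := loc_map_rmorphism P; split.
  move=> [c cP]; exists (fun i => spec_map j (c i)).
    move=> a b /cP[ab [l bl al]]; split=> [f|]; first by rewrite /in_pt /=; exact: ab.
    have [x [s [Ps ls]]] := loc_fraction l; exists x.
      by rewrite /in_pt /= /spec_map_pred jE -ls mulrC in_ptMl.
    rewrite /in_pt /= /spec_map_pred jE -ls in_ptM negb_or al -(jE s).
    by have [t tE] := loc_unit Ps; rewrite jE (in_pt_unit _ tE).
  move=> i f; rewrite {1}/in_pt /= /spec_map_pred jE -[in_pt P f]negbK => cf.
  by apply/negP => /loc_unit[t tE]; have := in_pt_unit (c i) tE; rewrite cf.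
move=> [c cP cb]; have /choice[c' c'E] i := loc_ext (cb i).
exists c' => a b /cP[ab [f bf af]]; split; last first.
  by exists (loc_map P f); rewrite c'E.
move=> l; have [x [s [Ps ls]]] := loc_fraction l.
have [t tE] := loc_unit Ps; have -> : l = t * loc_map P x by rewrite -ls mulrCA tE mulr1.
rewrite !in_ptM !c'E => /orP[tl|/ab ->]; last by rewrite orbT.
by have := in_ptMl (loc_map P s) tl; rewrite mulrC tE in_pt1.
Qed.

Lemma regular_loc P (gs : seq A) : noetherian_ring A ->
  (forall g, g \in gs -> in_pt P g) ->
  (forall x, in_pt P x -> exists2 s, ~~ in_pt P s & ideal_gen [set` gs] (s * x)) ->
  chain_below P (size gs) -> ~ chain_below P (size gs).+1 ->
  regular_local_ring (localize P).
Proof.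
move=> nA gsP Pgs cb ncb; split; first exact: loc_local_ring; first exact: loc_noetherian.
exists (size gs); split; first by split; rewrite loc_prime_chain.
have sz : size (map (loc_map P) gs) == size gs by rewrite size_map.
by exists (Tuple sz); exact: loc_nonunit_gen.
Qed.

End PrimeChains.

Section Noetherian.

Lemma noetherian_field (K : fieldType) : noetherian_ring K.
Proof.
move=> I I0 IM; have [[x Ix x0]|I00] := pselect (exists2 x, I x & x != 0).
  exists [:: 1]; apply/seteqP; split=> y _.
    by exists [:: (y, 1)]; rewrite ?big_seq1 ?mulr1 // => p; rewrite inE => /eqP -> /=; rewrite inE.
  by rewrite -[y]addr0 -(mulfVK x0 y); exact: IM.
exists [::]; apply/seteqP; split=> y.
  move=> Iy; suff -> : y = 0 by exact: ideal_gen0.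
  by apply/eqP/negPn/negP => y0; apply: I00; exists y.
move=> [[|p s] ps ->]; first by rewrite big_nil.
by have := ps p; rewrite inE eqxx => /(_ isT).
Qed.

Lemma noetherian_surj (A B : comNzRingType) (f : {rmorphism A -> B}) :
  (forall y, exists x, f x = y) -> noetherian_ring A -> noetherian_ring B.
Proof.
move=> fs nA J J0 JM; have [||s sE] := nA [set x | J (f x)]; first by rewrite /= rmorph0.
- by move=> a x y /= Jx Jy; rewrite rmorphD rmorphM; exact: JM.
exists (map f s).
have -> : [set` map f s] = f @` [set` s].
  apply/seteqP; split=> [_ /mapP[g gg ->]|_ [g gg <-]] /=; first by exists g.
  exact: map_f.
apply/seteqP; split=> [y Jy|].
  have [x xy] := fs y; rewrite -xy; apply: ideal_gen_morph; rewrite -sE /=.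
  by rewrite xy.
apply: (@ideal_gen_min _ _ J) => [//| | |].
- by move=> x y Jx Jy; rewrite -[x]mul1r; exact: JM.
- by move=> x y Jy; rewrite -[_ * _]addr0; exact: JM.
- move=> _ [x xs <-]; have : ideal_gen [set` s] x by exact: mem_ideal_gen.
  by rewrite -sE.
Qed.

(** Hilbert's argument: the ideals of leading coefficients in each degree are stationary from some
    degree [N] on, and each degree up to [N] contributes its own generators. *)
Lemma noetherian_poly (R : comNzRingType) :
  noetherian_ring R -> noetherian_ring {poly R}.
Proof.
move=> nR I I0 IM.
have IMl x y : I y -> I (x * y) by move=> Iy; rewrite -[_ * _]addr0; exact: IM.
have ID x y : I x -> I y -> I (x + y) by move=> Ix Iy; rewrite -[x]mul1r; exact: IM.
(* Only an upper bound on the size is imposed: the coefficient may be 0, which makes [L n] an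
   ideal. *)
pose L n : set R := [set c | exists f, [/\ I f, (size f <= n.+1)%N & f`_n = c]].
have LS n k : L n `<=` L (n + k)%N.
  move=> c [f [If sf fc]]; exists (f * 'X^k); split.
  - by rewrite mulrC; exact: IMl.
  - by rewrite (leq_trans (size_polyMleq _ _)) // size_polyXn addnS /= -addSn leq_add2r.
  - by rewrite coefMXn ltnNge leq_addl /= addnK.
have L0 n : L n 0 by exists 0; rewrite size_poly0 coef0.
have LM n a x y : L n x -> L n y -> L n (a * x + y).
  move=> [f [If sf fc]] [g [Ig sg gc]]; exists (a%:P * f + g); split; first exact: IM.
  - rewrite (leq_trans (size_polyD _ _)) // geq_max sg andbT mul_polyC.
    exact: leq_trans (size_scale_leq _ _) sf.
  - by rewrite coefD coefCM fc gc.
have [||s sE] := nR (\bigcup_n L n); first by exists 0%N.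
- move=> a x y [n _ Lx] [m _ Ly]; exists (n + m)%N => //; apply: LM; first exact: LS.
  by rewrite addnC; exact: LS.
have [N LN] : exists N, forall n, L n `<=` L N.
  have [N NE] : exists N, [set` s] `<=` L N.
    have : [set` s] `<=` \bigcup_n L n by rewrite sE => x; exact: mem_ideal_gen.
    elim: (s) => [|x t IHt] tL; first by exists 0%N.
    have [|N NE] := IHt; first by move=> y ty; apply: tL; rewrite /= inE ty orbT.
    have [|m _ Lm] := tL x; first by rewrite /= inE eqxx.
    exists (N + m)%N => y /=; rewrite inE => /predU1P[->|/NE]; last exact: LS.
    by rewrite addnC; exact: LS.
  exists N => n; apply: (@subset_trans _ (\bigcup_n L n)); first by move=> x Lx; exists n.
  rewrite sE; apply: ideal_gen_min => //.
  - by move=> x y Lx Ly; rewrite -[x]mul1r; exact: LM.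
  - by move=> x y Ly; rewrite -[_ * _]addr0; exact: LM.
have /choice[t tE] n : exists t : seq R, L n = ideal_gen [set` t].
  by apply: nR => [|a x y]; [exact: L0|exact: LM].
have /choice[F FE] (nc : nat * R) : exists f,
    L nc.1 nc.2 -> [/\ I f, (size f <= nc.1.+1)%N & f`_nc.1 = nc.2].
  have [[f fP]|nL] := pselect (L nc.1 nc.2); [by exists f|by exists 0].
pose gs := [seq F (n, c) | n <- iota 0 N.+1, c <- t n].
have gsI : ideal_gen [set` gs] `<=` I.
  apply: ideal_gen_min => // _ /allpairsPdep[n [c [_ cn ->]]].
  by case: (FE (n, c)) => //=; rewrite tE; exact: mem_ideal_gen.
exists gs; apply/seteqP; split=> // f.
have [k] := ubnP (size f); elim: k f => // k IHk f; rewrite ltnS => sf If.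
have [->|f0] := eqVneq f 0; first exact: ideal_gen0.
pose d := (size f).-1; have fd : size f = d.+1 by rewrite prednK // lt0n size_poly_eq0.
(* For [d > N] a combination of generators in degree [N] is shifted by ['X^(d - N)]; subtracting it
   cancels the leading term of [f]. *)
pose n := minn d N.
have Ln : L n f`_d.
  have Ld : L d f`_d by exists f; rewrite fd.
  by rewrite /n /minn; case: ifP => // _; exact: LN Ld.
have [h [hg sh hn]] : exists h,
    [/\ ideal_gen [set` gs] h, (size h <= n.+1)%N & h`_n = f`_d].
  move: Ln; rewrite tE; apply: (@ideal_gen_min _ _ [set c | exists h,
    [/\ ideal_gen [set` gs] h, (size h <= n.+1)%N & h`_n = c]]) => /=.
  - by exists 0; rewrite size_poly0 coef0; split=> //; exact: ideal_gen0.
  - move=> x y [g [Ig sg gc]] [h [Ih sh hc]]; exists (g + h); split.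
    + exact: ideal_genD.
    + by rewrite (leq_trans (size_polyD _ _)) // geq_max sg.
    + by rewrite coefD gc hc.
  - move=> x y [g [Ig sg gc]]; exists (x%:P * g); split; first exact: ideal_genM.
    + by rewrite mul_polyC; exact: leq_trans (size_scale_leq _ _) sg.
    + by rewrite coefCM gc.
  - move=> c /= cn; have [|IF sF Fc] := FE (n, c) => /=.
      by rewrite tE; exact: mem_ideal_gen.
    exists (F (n, c)); split=> //; apply: mem_ideal_gen.
    by apply/allpairsPdep; exists n, c; rewrite mem_iota /= ltnS geq_minr.
have nd : (n <= d)%N by exact: geq_minl.
have -> : f = (f - 'X^(d - n) * h) + 'X^(d - n) * h by rewrite subrK.
apply: ideal_genD; last exact: ideal_genM.
apply: IHk; last by rewrite addrC -mulrN; apply: ID => //; apply/IMl; rewrite -mulN1r; apply/IMl/gsI.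
apply: (@leq_ltn_trans d); last by rewrite fd in sf.
apply/leq_sizeP => j; rewrite leq_eqVlt coefB coefXnM => /predU1P[<-|dj].
  by rewrite ltnNge leq_subr /= subKn // hn subrr.
rewrite nth_default ?fd // ltnNge (leq_trans (leq_subr _ _) (ltnW dj)) /=.
by rewrite nth_default ?subrr // (leq_trans sh) // ltn_subRL subnK.
Qed.

End Noetherian.

(** * The surface and its presentation *)

Section PolyEvaluation.
Variables (R S : comNzRingType) (f : {rmorphism R -> S}).
Implicit Type p : {poly R}.

(** In nested evaluations [hev (hev f s) t] the variable of the coefficients goes to [s] and the
    outer variable to [t]. *)
Definition hev (s : S) : {rmorphism {poly R} -> S} :=
  horner_morph (fun x : R => mulrC s (f x)).

Lemma hevC s c : hev s c%:P = f c. Proof. exact: horner_morphC. Qed.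
Lemma hevX s : hev s 'X = s. Proof. exact: horner_morphX. Qed.

Lemma hevE s n p : (size p <= n)%N -> hev s p = \sum_(k < n) f p`_k * s ^+ k.
Proof.
move=> pn; rewrite /hev /= /horner_morph (@horner_coef_wide _ n).
  by apply: eq_bigr => k _; rewrite coef_map.
exact: leq_trans (size_poly _ _) pn.
Qed.

Lemma hev_ind (G : S -> Prop) s :
  (forall c, G (f c)) -> G s -> (forall x y, G x -> G y -> G (x + y)) ->
  (forall x y, G x -> G y -> G (x * y)) -> forall p, G (hev s p).
Proof.
move=> GC Gs GD GM p; elim/poly_ind: p => [|p c IHp]; first by rewrite rmorph0 -(rmorph0 f).
by rewrite rmorphD rmorphM hevX hevC; apply/GD/GC/GM.
Qed.

Lemma hev_uniq (g : {rmorphism {poly R} -> S}) s :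
  (forall c, g c%:P = f c) -> g 'X = s -> forall p, g p = hev s p.
Proof.
move=> gC gX p; elim/poly_ind: p => [|p c IHp]; first by rewrite !rmorph0.
by rewrite !rmorphD !rmorphM IHp hevX hevC gC gX.
Qed.

(** Factors ['X] of [p] can be cancelled because [s] is outside [P]; then the nonzero constant term
    differs from the value of [p] by a multiple of [s], so it lies in [Q]. Each use removes one
    variable from an algebraic relation at the price of moving up one prime. *)
Lemma spec_lt_poly (P Q : Spec S) s p : spec_lt P Q -> in_pt Q s -> ~~ in_pt P s ->
  p != 0 -> in_pt P (hev s p) -> exists2 r, r != 0 & in_pt Q (f r).
Proof.
move=> [PQ _] Qs Ps; have [n] := ubnP (size p); elim: n p => // n IHn p.
elim/poly_ind: p => [|p c _]; first by rewrite eqxx.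
have [->|c0 _ _ ] := eqVneq c 0.
  rewrite addr0 rmorphM hevX in_ptM (negPf Ps) orbF => sp p0.
  apply: IHn; last by apply: contraNneq p0 => ->; rewrite mul0r.
  by rewrite size_mulX in sp => //; apply: contraNneq p0 => ->; rewrite mul0r.
rewrite rmorphD rmorphM hevX hevC => /PQ H; exists c => //.
by rewrite -(addKr (hev s p * s) (f c)) addrC in_ptB ?in_ptMl.
Qed.

End PolyEvaluation.

Lemma hev_comp (R S T : comNzRingType) (f : {rmorphism R -> S})
    (g : {rmorphism S -> T}) (h : {rmorphism R -> T}) s :
  (forall c, g (f c) = h c) -> forall p, g (hev f s p) = hev h (g s) p.
Proof.
move=> fgh p; elim/poly_ind: p => [|p c IHp]; first by rewrite !rmorph0.
by rewrite !rmorphD !rmorphM IHp !hevX !hevC fgh.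
Qed.

(* [F] is the algebra of w1 z1 = 1 - w2^B, w2 z2 = 1 - w1^A, given by generation and
   universal property rather than as a quotient: the fibers of the family and the
   model [wcluster] are all of this form after rescaling, and exchanging the indices
   (lemma [wpres_sym]) moves between the charts w1 <> 0 and w2 <> 0. *)
Record wpres (K F : comNzRingType) (i : {rmorphism K -> F}) (w1 w2 z1 z2 : F)
    (A B : nat) : Prop := WPres {
  wpres_rel1 : w1 * z1 = 1 - w2 ^+ B;
  wpres_rel2 : w2 * z2 = 1 - w1 ^+ A;
  wpres_ind : forall G : F -> Prop, (forall c, G (i c)) ->
    G w1 -> G w2 -> G z1 -> G z2 -> (forall x y, G x -> G y -> G (x + y)) ->
    (forall x y, G x -> G y -> G (x * y)) -> forall x, G x;
  wpres_univ : forall (R : comNzRingType) (j : {rmorphism K -> R}) (u1 u2 v1 v2 : R),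
    u1 * v1 = 1 - u2 ^+ B -> u2 * v2 = 1 - u1 ^+ A ->
    exists g : {rmorphism F -> R}, [/\ forall c, g (i c) = j c,
      g w1 = u1, g w2 = u2, g z1 = v1 & g z2 = v2] }.

Lemma wpres_sym (K F : comNzRingType) (i : {rmorphism K -> F}) w1 w2 z1 z2 A B :
  wpres i w1 w2 z1 z2 A B -> wpres i w2 w1 z2 z1 B A.
Proof.
move=> [r1 r2 ind univ]; split=> //; first by move=> G ? ? ? ? ?; exact: ind.
by move=> R j u1 u2 v1 v2 uv1 uv2; have [g [? ? ? ? ?]] := univ R j _ _ _ _ uv2 uv1; exists g.
Qed.

(** * Linear algebra on polynomials of bounded bidegree *)

Section BiPoly.
Variable K : fieldType.
Implicit Types p q : {poly {poly K}}.

(** Strict bounds on both degrees, so that these polynomials form a space of dimension [s * s]. *)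
Definition bideg_le (s : nat) p := forall a b, (s <= a)%N || (s <= b)%N -> p`_a`_b = 0.

Lemma bideg_le_ex p : exists s, bideg_le s p.
Proof.
exists (maxn (size p) (\max_(a < size p) size (p`_a)%R)) => a b.
have [sa|as_] := leqP (size p) a; first by rewrite (nth_default _ sa) coef0.
rewrite leqNgt (leq_trans as_ (leq_maxl _ _)) /= => sb.
apply/nth_default/(leq_trans _ sb)/(leq_trans _ (leq_maxr _ _)).
exact: (leq_bigmax (Ordinal as_)).
Qed.

Lemma bideg_le_leq s t p : (s <= t)%N -> bideg_le s p -> bideg_le t p.
Proof.
by move=> st ps a b /orP[] h; apply: ps; rewrite (leq_trans st h) ?orbT.
Qed.

Lemma bideg_leM s t p q : bideg_le s p -> bideg_le t q -> bideg_le (s + t) (p * q).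
Proof.
move=> ps qt a b ab; rewrite coefM coef_sum big1 // => -[k /= ka] _.
rewrite coefM big1 // => -[l /= lb] _; move: ab.
have [?|ks] := leqP s k; first by rewrite ps ?mul0r //; apply/orP; left.
have [?|ls] := leqP s l; first by rewrite ps ?mul0r //; apply/orP; right.
case/orP => ab; rewrite [X in _ * X]qt ?mulr0 //; apply/orP; [left|right].
  by rewrite leq_subRL //; apply: leq_trans ab; rewrite leq_add2r ltnW.
by rewrite leq_subRL //; apply: leq_trans ab; rewrite leq_add2r ltnW.
Qed.

(** The successor accounts for [n = 0]: with strict bounds, the constant 1 has bound 1. *)
Lemma bideg_leX s n p : bideg_le s p -> bideg_le (n * s).+1 (p ^+ n).
Proof.
move=> ps; elim: n => [|n IHn]; last first.
  by rewrite exprS mulSn -addnS; exact: bideg_leM.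
move=> a b; rewrite expr0 coef1; case: a => [|a] /=; last by rewrite coef0.
by case: b => // b _; rewrite coef1.
Qed.

(** The matrix of coefficients has more rows than columns, hence a nonzero row vector in its
    kernel. *)
Lemma bideg_lin_dep (T : finType) (v : T -> {poly {poly K}}) (s : nat) :
  (forall t, bideg_le s (v t)) -> (s * s < #|T|)%N ->
  exists2 c : T -> K, exists t, c t != 0 & \sum_t (c t)%:P%:P * v t = 0.
Proof.
move=> vs sT.
pose M : 'M[K]_(#|T|, s * s) :=
  \matrix_k mxvec (\matrix_(a < s, b < s) (v (enum_val k))`_a`_b).
have [u uM u0] : exists2 u : 'rV[K]_#|T|, u *m M = 0 & u != 0.
  have : kermx M != 0.
    rewrite -mxrank_eq0 mxrank_ker subn_eq0 -ltnNge.
    exact: leq_ltn_trans (rank_leq_col _) sT.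
  case/rowV0Pn => u /sub_kermxP uM u0; by exists u.
exists (fun t => u 0 (enum_rank t)).
  have /rV0Pn[k uk] := u0; exists (enum_val k); by rewrite enum_valK.
apply/polyP => a; apply/polyP => b; rewrite !coef0 !coef_sum.
under eq_bigr do rewrite coefCM coefCM.
have [ab|] := boolP ((s <= a)%N || (s <= b)%N).
  by rewrite big1 // => t _; rewrite vs ?mulr0.
rewrite negb_or -!ltnNge => /andP[sa sb].
have := congr1 (fun N : 'M__ => N 0 (mxvec_index (Ordinal sa) (Ordinal sb))) uM.
rewrite mxE [RHS]mxE => uM0; rewrite -[RHS]uM0 (reindex (@enum_val T T)); last first.
  by exists enum_rank => k _; [exact: enum_valK|exact: enum_rankK].
by apply: eq_bigr => k _; rewrite enum_valK mxE mxvecE mxE.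
Qed.

End BiPoly.

(** * The surface is integral *)

(** Carries the algebraic independence of [w1], [w2] to the reversed order, as needed on the chart
    [w2 != 0]. *)
Lemma hev_swap (K S : comNzRingType) (f : {rmorphism K -> S}) s t (p : {poly {poly K}}) :
  hev (hev f s) t p = hev (hev f t) s (swapXY p).
Proof.
apply/esym; apply: (@hev_uniq _ _ (hev f s) (hev (hev f t) s \o swapXY)) => /= [c|].
  apply: (@hev_uniq _ _ f (hev (hev f t) s \o swapXY \o polyC)) => [d|] /=.
    by rewrite swapXY_polyC map_polyC /= !hevC.
  by rewrite swapXY_Y hevX.
by rewrite swapXY_X hevC hevX.
Qed.

Section NormalForm.
Variables (K : fieldType) (F : comNzRingType) (i : {rmorphism K -> F}).
Variables (w1 w2 z1 z2 : F) (A B : nat).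
Hypotheses (A0 : (0 < A)%N) (H : wpres i w1 w2 z1 z2 A B).
Local Notation ev2 s t := (hev (hev i s) t).

(** This is the subring generated over K by [w1], [w2] and [z2]: mixed products collapse since
    [w2 * z2] is a polynomial in [w1]. *)
Let N0 f := exists p q : {poly {poly K}}, f = ev2 w1 w2 p + ev2 w1 z2 q.

Lemma hev_w1_pow : hev i w1 (1 - 'X^A) = w2 * z2.
Proof. by rewrite rmorphB rmorph1 rmorphXn /= hevX (wpres_rel2 H). Qed.

(** The multipliers [T] that preserve [N0] are closed under sums and products, so generators
    suffice. *)
Let N0M f g : N0 f -> N0 g -> N0 (f * g).
Proof.
have N0D x y : N0 x -> N0 y -> N0 (x + y).
  move=> [p [q ->]] [r [s ->]]; exists (p + r), (q + s); rewrite !rmorphD /=; ring.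
pose T x := forall y, N0 y -> N0 (x * y).
have TD x y : T x -> T y -> T (x + y).
  by move=> Tx Ty u Nu; rewrite mulrDl; apply: N0D; [exact: Tx|exact: Ty].
have TM x y : T x -> T y -> T (x * y).
  by move=> Tx Ty u Nu; rewrite -mulrA; apply/Tx/Ty.
have TC c : T (i c).
  move=> _ [p [q ->]]; exists (c%:P%:P * p), (c%:P%:P * q).
  by rewrite !rmorphM !hevC mulrDr.
have T1 : T w1.
  move=> _ [p [q ->]]; exists ('X%:P * p), ('X%:P * q).
  by rewrite !rmorphM !hevC !hevX mulrDr.
(* Only the constant term of [q] keeps the factor [x]; in every other term one [y] combines with [x]
   to a polynomial in [w1]. *)
have half e x y : x * y = hev i w1 e ->
    forall q, exists p c, x * ev2 w1 y q = ev2 w1 x p + ev2 w1 y c.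
  move=> xy q; elim/poly_ind: q => [|q c _].
    by exists 0, 0; rewrite !rmorph0 mulr0 addr0.
  exists (c%:P * 'X), (e%:P * q).
  by rewrite !rmorphD !rmorphM !hevX !hevC -xy; ring.
have T2 : T w2.
  move=> _ [p [q ->]]; have [r [s E]] := half _ w2 z2 (esym hev_w1_pow) q.
  by exists ('X * p + r), s; rewrite mulrDr E rmorphD rmorphM hevX; ring.
have Tz2 : T z2.
  move=> _ [p [q ->]]; have [|r [s E]] := half (1 - 'X^A) z2 w2 _ p.
    by rewrite hev_w1_pow mulrC.
  by exists s, ('X * q + r); rewrite mulrDr E rmorphD rmorphM hevX; ring.
move=> [p [q ->]]; suff : T (ev2 w1 w2 p + ev2 w1 z2 q) by apply.
have T1c c : T (hev i w1 c) by exact: (@hev_ind _ _ i T w1 TC T1 TD TM c).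
apply: (TD); first exact: (@hev_ind _ _ (hev i w1) T w2 T1c T2 TD TM).
exact: (@hev_ind _ _ (hev i w1) T z2 T1c Tz2 TD TM).
Qed.

(** The power of [w1] serves to clear [z1], as [w1 * z1 = 1 - w2 ^+ B]. *)
Lemma w1_normal_form f : exists n, exists p q : {poly {poly K}},
  w1 ^+ n * f = ev2 w1 w2 p + ev2 w1 z2 q.
Proof.
have w1N n : N0 (w1 ^+ n).
  by exists ('X^n)%:P, 0; rewrite hevC rmorphXn /= hevX rmorph0 addr0.
elim/(wpres_ind H): f => [c|||||x y [n Nx] [m Ny]|x y [n Nx] [m Ny]].
- by exists 0%N, c%:P%:P, 0; rewrite !hevC rmorph0 mul1r addr0.
- by exists 0%N, 'X%:P, 0; rewrite hevC hevX rmorph0 mul1r addr0.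
- by exists 0%N, 'X, 0; rewrite hevX rmorph0 mul1r addr0.
- exists 1%N, (1 - 'X^B), 0; rewrite rmorphB rmorph1 rmorphXn /= hevX rmorph0 addr0.
  by rewrite expr1 (wpres_rel1 H).
- by exists 0%N, 0, 'X; rewrite hevX rmorph0 mul1r add0r.
- exists (n + m)%N; have [p [q E]] := N0M (w1N m) Nx; have [r [s E']] := N0M (w1N n) Ny.
  exists (p + r), (q + s); rewrite mulrDr {2}addnC !exprD -!mulrA.
  by rewrite [w1 ^+ n * _]mulrCA [w1 ^+ m * (w1 ^+ n * _)]mulrCA E E' !rmorphD /=; ring.
- exists (n + m)%N; have [p [q E]] := N0M Nx Ny.
  by exists p, q; rewrite -E exprD; ring.
Qed.

(** After multiplication by [phi w2 ^+ d] the image of the normal form is a polynomial in the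
    independent elements [phi w1] and [phi w2]. In [phi w2] the part from [p] has only degrees at
    least [d] and the part from [q] only smaller ones, so both vanish. *)
Lemma normal_form_inj (Om : idomainType) (phi : {rmorphism F -> Om})
    (j : {rmorphism K -> Om}) :
  (forall c, phi (i c) = j c) ->
  injective (hev (hev j (phi w1)) (phi w2)) ->
  forall f, phi f = 0 -> exists n, w1 ^+ n * f = 0.
Proof.
move=> phij inj f f0; have [n [p [q E]]] := w1_normal_form f; exists n.
(* The constant term of [q] is a polynomial in [w1] and can be moved to [p]. *)
wlog [q' qE] : p q E / exists q', q = q' * 'X.
  move: E; elim/poly_ind: q => [|q c _]; first by move=> E H'; apply: (H' p 0) => //; exists 0; rewrite mul0r.
  rewrite rmorphD /= hevC => E H'; apply: (H' (p + c%:P) (q * 'X)); last by exists q.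
  by rewrite E rmorphD /= hevC; ring.
have ev2phi s t r : phi (ev2 s t r) = hev (hev j (phi s)) (phi t) r.
  by apply: hev_comp => c; exact: hev_comp.
pose d := size q'; pose c : {poly K} := 1 - 'X^A.
have c0 : c != 0.
  rewrite subr_eq0 eq_sym -subr_eq0; apply: contraTneq (isT) => cE.
  by have := size_XnsubC (1 : K) A0; rewrite polyC1 cE size_poly0.
have cphi : hev j (phi w1) c = phi w2 * phi z2.
  by rewrite -(hev_comp _ phij) hev_w1_pow rmorphM.
(* Each [z2] uses up one factor [w2] and leaves [c]; the top coefficient of [q'] lands in the
   constant term of [r], which is how [q' = 0] is detected. *)
pose r : {poly {poly K}} := \sum_(k < d) (q'`_k * c ^+ k.+1) *: 'X^(d - k.+1).
have rE : hev (hev j (phi w1)) (phi w2) r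
    = phi w2 ^+ d * hev (hev j (phi w1)) (phi z2) q.
  rewrite qE rmorphM hevX (@hevE _ _ _ _ d q') // mulr_suml mulr_sumr.
  rewrite rmorph_sum; apply: eq_bigr => k _ /=.
  rewrite -mul_polyC rmorphM hevC rmorphM !rmorphXn /= hevX cphi exprMn.
  have -> : phi w2 ^+ d = phi w2 ^+ (d - k.+1) * phi w2 ^+ k.+1 by rewrite -exprD subnK.
  move: (horner_morph _ _) (phi w2 ^+ _) (phi w2 ^+ _) => h u v.
  by rewrite exprSr; ring.
have pr0 : p * 'X^d + r = 0.
  apply: inj; rewrite rmorph0 rmorphD rmorphM rmorphXn /= hevX rE.
  have := congr1 phi E; rewrite rmorphM f0 mulr0 rmorphD !ev2phi => E0.
  by rewrite mulrC -mulrDr -E0 mulr0.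
have q'0 : q' = 0.
  apply/eqP; rewrite -size_poly_eq0 -/d; apply/negPn/negP => d0.
  have : (p * 'X^d + r)`_0 = 0 by rewrite pr0 coef0.
  rewrite coefD coefMXn lt0n d0 add0r coef_sum.
  have dm : (d.-1 < d)%N by rewrite prednK // lt0n.
  rewrite (bigD1 (Ordinal dm)) //= big1 ?addr0 => [|k kd]; last first.
    rewrite coefZ coefXn; case: eqP; rewrite ?mulr0 // => /esym/eqP.
    rewrite subn_eq0 => dk; case/eqP: kd; apply: val_inj => /=.
    by apply/eqP; rewrite eqn_leq -ltnS prednK ?lt0n // ltn_ord -ltnS prednK ?lt0n.
  rewrite prednK ?lt0n // subnn expr0 coefZ coef1 mulr1 => /eqP.
  by rewrite mulf_eq0 expf_eq0 (negPf c0) andbF orbF -lead_coefE lead_coef_eq0 -size_poly_eq0 (negPf d0).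
have p0 : p = 0.
  have d0 : d = 0%N by rewrite /d q'0 size_poly0.
  by move: pr0; rewrite /r d0 big_ord0 expr0 mulr1 addr0.
by rewrite E qE q'0 mul0r p0 !rmorph0 addr0.
Qed.

End NormalForm.

Section Domain.
Variables (K : fieldType) (F : comNzRingType) (i : {rmorphism K -> F}).
Variables (w1 w2 z1 z2 : F) (A B : nat).
Hypotheses (A0 : (0 < A)%N) (B0 : (0 < B)%N) (H : wpres i w1 w2 z1 z2 A B).
Local Notation ev2 s t := (hev (hev i s) t).

Lemma w1_w2_coprime : exists u v, u * w1 + v * w2 = 1.
Proof.
exists z1, (w2 ^+ B.-1); rewrite mulrC (wpres_rel1 H) -exprSr prednK //.
by rewrite subrK.
Qed.

(** In the expansion of [(u * x + v * y) ^+ (n + m)] every term contains [x ^+ n] or [y ^+ m]. *)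
Lemma coprime_pow_eq0 (x y f u v : F) n m : u * x + v * y = 1 ->
  x ^+ n * f = 0 -> y ^+ m * f = 0 -> f = 0.
Proof.
move=> uv xf yf; have E : (u * x + v * y) ^+ (n + m) * f = 0.
  rewrite exprDn mulr_suml big1 // => k _; rewrite !exprMn mulrnAl.
  rewrite -[RHS](mul0rn _ 'C(n + m, k)); congr (_ *+ _).
  have [mk|km] := leqP m k.
    have yk : y ^+ k * f = 0 by rewrite -(subnK mk) exprD -mulrA yf mulr0.
    transitivity (u ^+ (n + m - k) * x ^+ (n + m - k) * v ^+ k * (y ^+ k * f)).
      by rewrite !mulrA.
    by rewrite yk mulr0.
  have nk : (n <= n + m - k)%N.
    by rewrite leq_subRL ?(leq_trans (ltnW km)) ?leq_addl // (addnC (k : nat)) leq_add2l ltnW.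
  have xk : x ^+ (n + m - k) * f = 0 by rewrite -(subnK nk) exprD -mulrA xf mulr0.
  transitivity (u ^+ (n + m - k) * (v ^+ k * y ^+ k) * (x ^+ (n + m - k) * f)).
    by move: (u ^+ _) (x ^+ _) (v ^+ _) (y ^+ _) => a b c d; ring.
  by rewrite xk mulr0.
by rewrite uv expr1n mul1r in E.
Qed.

(** An element of the kernel is annihilated by a power of [w1] and, by symmetry, by a power of [w2];
    these are coprime. *)
Lemma wpres_embedding : exists phi : {rmorphism F -> {fraction {poly {poly K}}}},
  injective phi.
Proof.
pose Om : fieldType := ({fraction {poly {poly K}}})%type.
pose tf : {poly {poly K}} -> Om := @FracField.tofrac {poly {poly K}}.
have tf_inj : injective tf by move=> x y /eqP; rewrite tofrac_eq => /eqP.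
pose x := tf 'X%:P; pose y := tf 'X.
pose j := (@FracField.tofrac {poly {poly K}}) \o polyC \o polyC : {rmorphism K -> Om}.
have x0 : x != 0 by rewrite tofrac_eq0 polyC_eq0 polyX_eq0.
have y0 : y != 0 by rewrite tofrac_eq0 polyX_eq0.
have [||phi [phii phi1 phi2 _ _]] := wpres_univ H j (u1 := x) (u2 := y)
   (v1 := (1 - y ^+ B) / x) (v2 := (1 - x ^+ A) / y); rewrite 1?mulrC ?divfK //.
have tfE p : tf p = hev (hev j x) y p.
  apply: (@hev_uniq _ _ (hev j x) (@FracField.tofrac {poly {poly K}})) => // c.
  by apply: (@hev_uniq _ _ j ((@FracField.tofrac {poly {poly K}}) \o polyC)).
have inj12 : injective (hev (hev j (phi w1)) (phi w2)).
  by rewrite phi1 phi2 => p q; rewrite -!tfE => /tf_inj.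
have inj21 : injective (hev (hev j (phi w2)) (phi w1)).
  move=> p q; rewrite hev_swap [RHS]hev_swap => /inj12 /(congr1 swapXY).
  by rewrite !swapXYK.
exists phi; apply/raddf_inj => f f0.
have [n E1] := normal_form_inj A0 H phii inj12 f0.
have [m E2] := normal_form_inj B0 (wpres_sym H) phii inj21 f0.
by have [u [v uv]] := w1_w2_coprime; exact: coprime_pow_eq0 uv E1 E2.
Qed.

Lemma wpres_domain (f g : F) : f * g = 0 -> f = 0 \/ g = 0.
Proof.
have [phi phi_inj] := wpres_embedding; move=> /(congr1 phi)/eqP.
rewrite rmorphM rmorph0 mulf_eq0.
by move=> /orP[] /eqP E; [left|right]; apply: phi_inj; rewrite E rmorph0.
Qed.

End Domain.

(** * Dimension *)

Section PrimesOverField.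
Variables (K : closedFieldType) (F : comNzRingType) (i : {rmorphism K -> F}).

Lemma in_pt_cst (P : Spec F) c : in_pt P (i c) = (c == 0).
Proof.
have [->|c0] := eqVneq c 0; first by rewrite rmorph0 in_pt0.
by apply/(@in_pt_unit _ _ _ (i c^-1)); rewrite -rmorphM mulVf // rmorph1.
Qed.

(** [r] splits into linear factors, and its leading coefficient is a unit, so [P] contains one of
    the factors. *)
Lemma in_pt_poly_root (P : Spec F) t r : r != 0 -> in_pt P (hev i t r) ->
  exists c, in_pt P (t - i c).
Proof.
move=> r0; have [rs {1}->] := closed_field_poly_normal r.
rewrite -mul_polyC rmorphM hevC in_ptM in_pt_cst lead_coef_eq0 (negPf r0) /=.
elim: rs => [|x rs IHrs]; first by rewrite big_nil rmorph1 in_pt1.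
rewrite big_cons rmorphM in_ptM rmorphB hevX hevC => /orP[Px|/IHrs //].
by exists x.
Qed.

End PrimesOverField.

Section Dimension.
Variables (K : closedFieldType) (F : comNzRingType) (i : {rmorphism K -> F}).
Variables (w1 w2 z1 z2 : F) (A B : nat).
Hypotheses (A0 : (0 < A)%N) (B0 : (0 < B)%N) (H : wpres i w1 w2 z1 z2 A B).
Local Notation ev12 := (hev (hev i w1) w2).

(** Stated for all large exponents so that several elements admit a common one. *)
Lemma clear_denominators f : exists n, forall m, (n <= m)%N ->
  exists p, (w1 * w2) ^+ m * f = ev12 p.
Proof.
suff [n [p E]] : exists n, exists p, (w1 * w2) ^+ n * f = ev12 p.
  exists n => m nm; exists (('X%:P * 'X) ^+ (m - n) * p).
  by rewrite rmorphM rmorphXn rmorphM /= hevC !hevX -E mulrA -exprD subnK.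
elim/(wpres_ind H): f => [c|||||x y [n [p E]] [m [q E']]|x y [n [p E]] [m [q E']]].
- by exists 0%N, c%:P%:P; rewrite !hevC mul1r.
- by exists 0%N, 'X%:P; rewrite hevC hevX mul1r.
- by exists 0%N, 'X; rewrite hevX mul1r.
- exists 1%N, ((1 - 'X^B) * 'X); rewrite rmorphM rmorphB rmorph1 rmorphXn /= hevX.
  by rewrite -(wpres_rel1 H); ring.
- exists 1%N, ((1 - 'X%:P ^+ A) * 'X%:P).
  rewrite rmorphM rmorphB rmorph1 rmorphXn /= hevC hevX.
  by rewrite -(wpres_rel2 H); ring.
- exists (n + m)%N, (('X%:P * 'X) ^+ m * p + ('X%:P * 'X) ^+ n * q).
  rewrite rmorphD !rmorphM !rmorphXn !rmorphM /= hevC !hevX -E -E'.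
  by rewrite mulrDr !mulrA -!exprD addnC.
- exists (n + m)%N, (p * q); rewrite rmorphM -E -E' exprD.
  by move: (_ ^+ n) (_ ^+ m) => u v; ring.
Qed.

(** Tested on the curve [w1 = w2], with values in a rational function field. *)
Lemma w1w2_neq0 : w1 * w2 != 0.
Proof.
have neq0 (v : F) (j : {rmorphism F -> {fraction {poly K}}}) : j v != 0 -> v != 0.
  by apply: contraNneq => ->; rewrite rmorph0.
pose tf := @FracField.tofrac {poly K}; pose x := tf 'X.
have x0 : x != 0 by rewrite tofrac_eq0 polyX_eq0.
have [||phi [_ phi1 phi2 _ _]] := wpres_univ H (@FracField.tofrac {poly K} \o polyC)
   (u1 := x) (u2 := x) (v1 := (1 - x ^+ B) / x) (v2 := (1 - x ^+ A) / x);
   rewrite 1?mulrC ?divfK //.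
by apply: (neq0 _ phi); rewrite rmorphM phi1 phi2 mulf_neq0.
Qed.

(* The N^3 products f^a g^b h^c, a, b, c < N, become polynomials in w1, w2 of
   bidegree O(N) after multiplication by a common power of w1 w2, so they live in a
   space of dimension O(N^2). *)
Lemma alg_dependent (f g h : F) :
  exists2 Q : {poly {poly {poly K}}}, Q != 0 & hev (hev (hev i h) g) f Q = 0.
Proof.
have [n [pf [pg [ph [Ef Eg Eh]]]]] : exists n, exists pf pg ph,
    [/\ (w1 * w2) ^+ n * f = ev12 pf, (w1 * w2) ^+ n * g = ev12 pg
      & (w1 * w2) ^+ n * h = ev12 ph].
  have [nf Hf] := clear_denominators f; have [ng Hg] := clear_denominators g.
  have [nh Hh] := clear_denominators h; pose n := (nf + ng + nh)%N.
  have [|pf ?] := Hf n; first by rewrite /n -addnA leq_addr.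
  have [|pg ?] := Hg n; first by rewrite /n addnAC leq_addl.
  have [|ph ?] := Hh n; first by rewrite /n leq_addl.
  by exists n, pf, pg, ph.
pose D : {poly {poly K}} := ('X%:P * 'X) ^+ n; pose d := ev12 D.
have dE : d = (w1 * w2) ^+ n by rewrite /d rmorphXn rmorphM /= hevC !hevX.
have [s [Ds fs gs hs]] : exists s, [/\ bideg_le s D, bideg_le s pf, bideg_le s pg & bideg_le s ph].
  have [s0 S0] := bideg_le_ex D; have [s1 S1] := bideg_le_ex pf.
  have [s2 S2] := bideg_le_ex pg; have [s3 S3] := bideg_le_ex ph.
  exists (s0 + s1 + s2 + s3)%N; split.
  - by apply: bideg_le_leq S0; rewrite -!addnA leq_addr.
  - by apply: bideg_le_leq S1; rewrite (addnC s0) -!addnA leq_addr.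
  - by apply: bideg_le_leq S2; rewrite addnAC leq_addl.
  - by apply: bideg_le_leq S3; rewrite leq_addl.
(* The [N ^ 3] products will have bidegree below [3 * (N * s.+2)], so a dependence exists once [N]
   exceeds [(3 * s.+2) ^ 2]. *)
pose N := ((3 * s.+2) ^ 2).+1.
(* Padding with powers of [D] gives all terms the common factor [d ^+ N], whatever the exponent
   [a]. *)
pose term (p : {poly {poly K}}) a := D ^+ (N - a) * p ^+ a.
have term_bd p a : bideg_le s p -> (a <= N)%N -> bideg_le (N * s.+2) (term p a).
  move=> ps aN; have := bideg_leM (bideg_leX (n := N - a) Ds) (bideg_leX (n := a) ps); apply: bideg_le_leq.
  rewrite addnS addSn -mulnDl subnK // -[s.+2]addn2 mulnDr -addn2 leq_add2l.
  by rewrite leq_pmull.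
have termE x p a : (w1 * w2) ^+ n * x = ev12 p -> (a <= N)%N ->
    ev12 (term p a) = d ^+ N * x ^+ a.
  move=> E aN; rewrite /term rmorphM (rmorphXn ev12 (N - a)) (rmorphXn ev12 a) -/d -E -dE.
  by rewrite exprMn mulrA -exprD subnK.
pose v (t : 'I_N * 'I_N * 'I_N) := term pf t.1.1 * term pg t.1.2 * term ph t.2.
have vs t : bideg_le (3 * (N * s.+2)) (v t).
  rewrite mulSn mul2n -addnn addnA; apply: bideg_leM; first apply: bideg_leM.
  - by apply: term_bd => //; rewrite ltnW.
  - by apply: term_bd => //; rewrite ltnW.
  - by apply: term_bd => //; rewrite ltnW.
have [|c [t0 ct0] cv] := bideg_lin_dep vs.
  rewrite !card_prod card_ord (mulnCA 3) mulnACA ltn_mul2l /=.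
  by rewrite /N expnS expn1 ltnS leqnn.
pose C a b e : K := if (insub a, insub b, insub e) is (Some a', Some b', Some e')
  then c (a', b', e') else 0.
have CE (t : 'I_N * 'I_N * 'I_N) : C t.1.1 t.1.2 t.2 = c t.
  by case: t => -[a b] e; rewrite /C /= !valK.
exists (\poly_(a < N) \poly_(b < N) \poly_(e < N) C a b e).
  apply: contra_neq ct0 => /(congr1 (fun Q : {poly {poly {poly K}}} => Q`_t0.1.1`_t0.1.2`_t0.2)).
  by rewrite !coef0 !(coef_poly, ltn_ord) CE.
rewrite (@hevE _ _ _ _ N) ?size_poly //.
have d0 : d ^+ (N * 3) != 0.
  rewrite dE -exprM; elim: (n * (N * 3))%N => [|k IHk]; rewrite ?expr0 ?oner_eq0 // exprS.
  apply/eqP => /(wpres_domain A0 B0 H)[] /eqP; last by rewrite (negPf IHk).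
  by rewrite (negPf w1w2_neq0).
have E0 : d ^+ (N * 3) * \sum_t i (c t) * h ^+ t.2 * g ^+ t.1.2 * f ^+ t.1.1 = 0.
  rewrite mulr_sumr -[RHS](rmorph0 ev12) -[in RHS]cv [RHS]rmorph_sum; apply: eq_bigr => t _.
  rewrite rmorphM !hevC /v rmorphM [ev12 (_ * term pg _)]rmorphM.
  rewrite (termE _ _ _ Ef) ?(termE _ _ _ Eg) ?(termE _ _ _ Eh) 1?ltnW //.
  rewrite mulnSr muln2 -addnn !exprD.
  by move: (d ^+ N) (h ^+ _) (g ^+ _) (f ^+ _) => x y z u; ring.
have [/eqP|E1] := wpres_domain A0 B0 H E0; first by rewrite (negPf d0).
transitivity (\sum_a \sum_b \sum_e i (c (a, b, e)) * h ^+ e * g ^+ b * f ^+ a); last first.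
  by rewrite -[RHS]E1 pair_bigA pair_bigA; apply: eq_bigr => -[[a b] e].
apply: eq_bigr => a _; rewrite coef_poly ltn_ord (@hevE _ _ _ _ N) ?size_poly // mulr_suml.
apply: eq_bigr => b _; rewrite coef_poly ltn_ord (@hevE _ _ _ _ N) ?size_poly // !mulr_suml.
by apply: eq_bigr => e _; rewrite coef_poly ltn_ord (CE (a, b, e)).
Qed.

(** A relation between [f], [g] and [t], with [f] in [P1] outside [P0] and [g] in [P] outside [P1],
    loses first [f] and then [g]. What remains is a nonzero polynomial in [t] alone whose value lies
    in [P]. *)
Lemma chain_const_mod (P : Spec F) : chain_below P 2 ->
  forall t, exists c, in_pt P (t - i c).
Proof.
move=> c2 t; have [P1 c1 lt12] := chain_below_inv c2; have [P0 _ lt01] := chain_below_inv c1.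
have [_ [f P1f P0f]] := lt01; have [_ [g Pg P1g]] := lt12.
have [Q Q0 QE] := alg_dependent f g t.
have QP : in_pt P0 (hev (hev (hev i t) g) f Q) by rewrite QE in_pt0.
have [R R0 RP] := spec_lt_poly lt01 P1f P0f Q0 QP.
have [r r0 rP] := spec_lt_poly lt12 Pg P1g R0 RP.
exact: in_pt_poly_root r0 rP.
Qed.

(** A member of [P] outside [Q] would be constant modulo [Q]: the constant 0 puts it in [Q], any
    other one gives a unit in [P]. *)
Lemma no_chain3 (P : Spec F) : ~ chain_below P 3.
Proof.
move=> c3; have [Q c2 [QP [w Pw Qw]]] := chain_below_inv c3.
have [c Qc] := chain_const_mod c2 w; have [c0|c0] := eqVneq c 0.
  by move: Qc; rewrite c0 rmorph0 subr0 (negPf Qw).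
by have := in_ptB Pw (QP _ Qc); rewrite subKr in_pt_cst (negPf c0).
Qed.

End Dimension.

(** * Regular closed points *)

Section Congruences.
Variables (R F : comNzRingType) (G : set F).
Implicit Type p : {poly R}.

Lemma ideal_gen_hev (f g : {rmorphism R -> F}) s t :
  (forall c, ideal_gen G (f c - g c)) -> ideal_gen G (s - t) ->
  forall p, ideal_gen G (hev f s p - hev g t p).
Proof.
move=> fg st p; elim/poly_ind: p => [|p c IHp].
  by rewrite !rmorph0 subrr; exact: ideal_gen0.
rewrite !rmorphD !rmorphM !hevX !hevC.
have -> : hev f s p * s + f c - (hev g t p * t + g c)
  = (hev f s p - hev g t p) * s + hev g t p * (s - t) + (f c - g c) by ring.
by apply/ideal_genD/fg/ideal_genD/ideal_genM/st; exact: ideal_genMr.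
Qed.

Lemma ideal_gen_subX (x y : F) n : ideal_gen G (x - y) -> ideal_gen G (x ^+ n - y ^+ n).
Proof. by rewrite subrXX => xy; exact: ideal_genMr. Qed.

End Congruences.

Lemma mul_divK (L : fieldType) (a x : L) : x != 0 -> x * (a / x) = a.
Proof. by move=> x0; rewrite mulrC divfK. Qed.

Section Primes.
Variables (K : closedFieldType) (F : comNzRingType) (i : {rmorphism K -> F}).

Lemma noetherian_wpres w1 w2 z1 z2 A B : wpres i w1 w2 z1 z2 A B -> noetherian_ring F.
Proof.
move=> H; apply: (@noetherian_surj _ _ (hev (hev (hev (hev i w1) w2) z1) z2)); last first.
  by do 4!apply: noetherian_poly; exact: noetherian_field.
elim/(wpres_ind H) => [c|||||x y [p <-] [q <-]|x y [p <-] [q <-]].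
- by exists c%:P%:P%:P%:P; rewrite !hevC.
- by exists 'X%:P%:P%:P; rewrite !hevC hevX.
- by exists 'X%:P%:P; rewrite !hevC hevX.
- by exists 'X%:P; rewrite !hevC hevX.
- by exists 'X; rewrite hevX.
- by exists (p + q); rewrite rmorphD.
- by exists (p * q); rewrite rmorphM.
Qed.

End Primes.

Section RegularPoints.
Variables (K : closedFieldType) (F : comNzRingType) (i : {rmorphism K -> F}).
Variables (w1 w2 z1 z2 : F) (A B : nat).
Hypotheses (A0 : (0 < A)%N) (B0 : (0 < B)%N) (H : wpres i w1 w2 z1 z2 A B).
Variable P : Spec F.
Hypothesis w1P : ~~ in_pt P w1.
Local Notation ev12 := (hev (hev i w1) w2).
Local Notation const t := (exists c, in_pt P (t - i c)).

Lemma generic_prime : exists P0 : Spec F, forall x, in_pt P0 x <-> x = 0.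
Proof. by apply: (@ker_pt _ _ idfun) => x y; exact: wpres_domain A0 B0 H x y. Qed.

Lemma chain_below1 f : in_pt P f -> f != 0 -> chain_below P 1.
Proof.
move=> Pf f0; have [P0 P0E] := generic_prime; apply: (@prime_chain1 _ P0).
split=> [x /P0E ->|]; first exact: in_pt0.
by exists f => //; apply/negP => /P0E/eqP; rewrite (negPf f0).
Qed.

(** The local ring is the function field: no generators and dimension zero. *)
Lemma regular_generic : (forall f, in_pt P f -> f = 0) -> regular_local_ring (localize P).
Proof.
move=> P0; apply: (@regular_loc _ _ [::]) => //.
- exact: noetherian_wpres H.
- by move=> x /P0 ->; exists 1; rewrite ?in_pt1 // mulr0; exact: ideal_gen0.
- exact: chain_below0.
- by move=> /chain_below_inv[Q _ [_ [f /P0 ->]]]; rewrite in_pt0.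
Qed.

Lemma hev_cst (x y : K) p : exists c, hev (hev i (i x)) (i y) p = i c.
Proof.
pose G t := exists c, t = i c.
have GD s t : G s -> G t -> G (s + t).
  by move=> [c ->] [d ->]; exists (c + d); rewrite rmorphD.
have GM s t : G s -> G t -> G (s * t).
  by move=> [c ->] [d ->]; exists (c * d); rewrite rmorphM.
have GC c : G (i c) by exists c.
have GX c : G (hev i (i x) c) by exact: (@hev_ind _ _ i G).
exact: (@hev_ind _ _ (hev i (i x)) G).
Qed.

Lemma hev_cst_poly (x : K) t q : exists s, hev (hev i (i x)) t q = hev i t s.
Proof.
pose G u := exists s, u = hev i t s.
have GD s u : G s -> G u -> G (s + u).
  by move=> [c ->] [d ->]; exists (c + d); rewrite rmorphD.
have GM s u : G s -> G u -> G (s * u).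
  by move=> [c ->] [d ->]; exists (c * d); rewrite rmorphM.
have GC c : G (i c) by exists c%:P; rewrite hevC.
have GX c : G (hev i (i x) c) by exact: (@hev_ind _ _ i G).
by apply: (@hev_ind _ _ (hev i (i x)) G) => //; exists 'X; rewrite hevX.
Qed.

Lemma in_pt_w1X n : in_pt P (w1 ^+ n) = false.
Proof. by rewrite in_ptX (negPf w1P) andbF. Qed.

Lemma z1_const x y : in_pt P (w1 - i x) -> in_pt P (w2 - i y) ->
  in_pt P (z1 - i ((1 - y ^+ B) / x)).
Proof.
move=> Px Py; have x0 : x != 0.
  by apply: contraNneq w1P => x0; move: Px; rewrite x0 rmorph0 subr0.
suff : in_pt P (w1 * (z1 - i ((1 - y ^+ B) / x))) by rewrite in_ptM (negPf w1P).
have -> : w1 * (z1 - i ((1 - y ^+ B) / x))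
    = - (w2 ^+ B - i y ^+ B) - i ((1 - y ^+ B) / x) * (w1 - i x).
  rewrite !mulrBr -(rmorphM i) (wpres_rel1 H) divfK //.
  by rewrite rmorphB rmorph1 rmorphXn /=; ring.
apply: in_ptB; last exact: in_ptMl.
by rewrite in_ptN subrXX mulrC in_ptMl.
Qed.

Section ClosedPoint.
Variables x y u : K.
Hypotheses (Px : in_pt P (w1 - i x)) (Py : in_pt P (w2 - i y)) (Pu : in_pt P (z2 - i u)).
Local Notation G3 := [set` [:: w1 - i x; w2 - i y; z2 - i u]].

(** Evaluating the normal form at the point makes [w1 ^+ n * f] congruent to a constant modulo the
    three differences. That constant lies in [P], hence is 0. *)
Lemma closed_point_gen f : in_pt P f -> exists n, ideal_gen G3 (w1 ^+ n * f).
Proof.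
move=> Pf; have [n [p [q E]]] := w1_normal_form H f; exists n.
have G3P : forall g, ideal_gen G3 g -> in_pt P g.
  by apply: ideal_gen_in_pt => g /=; rewrite !inE => /or3P[] /eqP ->.
have gx : ideal_gen G3 (w1 - i x) by apply: mem_ideal_gen; rewrite /= !inE eqxx.
have gy : ideal_gen G3 (w2 - i y) by apply: mem_ideal_gen; rewrite /= !inE eqxx orbT.
have gu : ideal_gen G3 (z2 - i u) by apply: mem_ideal_gen; rewrite /= !inE eqxx !orbT.
have gi r : ideal_gen G3 (hev i w1 r - hev i (i x) r).
  by apply: ideal_gen_hev => // c; rewrite subrr; exact: ideal_gen0.
have [c cE] := hev_cst x y p; have [d dE] := hev_cst x u q.
have gc : ideal_gen G3 (w1 ^+ n * f - i (c + d)).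
  rewrite E rmorphD opprD addrACA -cE -dE; apply: ideal_genD; exact: ideal_gen_hev.
have : in_pt P (i (c + d)).
  by rewrite -(in_pt_congr (G3P _ gc)) in_ptMl.
by rewrite in_pt_cst => /eqP cd; rewrite cd rmorph0 subr0 in gc.
Qed.

Lemma closed_point_rel : y * u = 1 - x ^+ A.
Proof.
apply/eqP; rewrite -subr_eq0 -(in_pt_cst i P).
have -> : i (y * u - (1 - x ^+ A)) = - (i u * (w2 - i y)) - w2 * (z2 - i u) - (w1 ^+ A - i x ^+ A).
  rewrite !rmorphB rmorphM rmorph1 rmorphXn mulrBr [w2 * _]mulrBr (wpres_rel2 H) /=; ring.
apply: in_ptB; last by rewrite subrXX mulrC in_ptMl.
by apply: in_ptB; rewrite ?in_ptN in_ptMl.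
Qed.

Lemma closed_point_x0 : x != 0.
Proof. by apply: contraNneq w1P => x0; move: Px; rewrite x0 rmorph0 subr0. Qed.

(** Tested on the curve [w1 = 1], [z2 = 0], where [w2] is a free coordinate. *)
Lemma w2_not_const c : w2 - i c != 0.
Proof.
have [||phi [phii _ phi2 _ _]] := wpres_univ H (@polyC K)
   (u1 := 1) (u2 := 'X) (v1 := 1 - 'X^B) (v2 := 0).
- by rewrite mul1r.
- by rewrite mulr0 expr1n subrr.
apply/eqP => /(congr1 phi)/eqP; rewrite rmorphB rmorph0 phi2 phii.
by rewrite polyXsubC_eq0.
Qed.

(** The intermediate prime is the kernel of the restriction to a curve through the point: the line
    [w1 = x], [w2 = 0] if [y = 0], and the curve [w2 = y] otherwise. *)
Lemma closed_point_chain2 : chain_below P 2.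
Proof.
have [P0 P0E] := generic_prime.
have [y0|y0] := eqVneq y 0.
  have xA : x ^+ A = 1.
    by move: closed_point_rel; rewrite y0 mul0r => /eqP; rewrite eq_sym subr_eq0 => /eqP.
  have [||phi [phii phi1 phi2 phi3 phi4]] := wpres_univ H (@polyC K)
     (u1 := x%:P) (u2 := 0) (v1 := (x^-1)%:P) (v2 := 'X).
  - by rewrite -polyCM divff ?closed_point_x0 // expr0n gtn_eqF // subr0.
  - by rewrite mul0r -rmorphXn xA subrr.
  have [Q QE] : exists Q : Spec F, forall x, in_pt Q x <-> phi x = 0.
    by apply: ker_pt => p q /eqP; rewrite mulf_eq0 => /orP[] /eqP; [left|right].
  (* Restricting to the line and then setting [z2 = u] gives the value at the point, so the kernel
     of [phi] is contained in [P]. *)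
  have evP f : in_pt P (f - i (phi f).[u]).
    elim/(wpres_ind H): f => [c|||||f g Pf Pg|f g Pf Pg].
    - by rewrite phii hornerC subrr in_pt0.
    - by rewrite phi1 hornerC.
    - by rewrite phi2 horner0 -y0.
    - rewrite phi3 hornerC; have := z1_const Px Py.
      by rewrite y0 expr0n gtn_eqF // subr0 mul1r.
    - by rewrite phi4 hornerX.
    - by rewrite rmorphD hornerD rmorphD opprD addrACA in_ptD.
    - rewrite rmorphM hornerM rmorphM.
      have -> : f * g - i (phi f).[u] * i (phi g).[u]
        = g * (f - i (phi f).[u]) + i (phi f).[u] * (g - i (phi g).[u]) by ring.
      by rewrite in_ptD ?in_ptMl.
  apply: (@chain_below2 _ P0 Q).
    split=> [f /P0E ->|]; first exact: in_pt0.
    exists w2; first by apply/QE.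
    by apply/negP => /P0E w20; have := w2_not_const 0; rewrite w20 rmorph0 subrr eqxx.
  split=> [f /QE f0|]; first by have := evP f; rewrite f0 horner0 rmorph0 subr0.
  exists (z2 - i u) => //; apply/negP => /QE/eqP.
  by rewrite rmorphB phii phi4 polyXsubC_eq0.
pose Om : fieldType := ({fraction {poly K}})%type.
pose tf : {poly K} -> Om := @FracField.tofrac {poly K}; pose X := tf 'X.
pose j := (@FracField.tofrac {poly K}) \o polyC : {rmorphism K -> Om}.
have X0 : X != 0 by rewrite tofrac_eq0 polyX_eq0.
have jy0 : j y != 0 by rewrite /= tofrac_eq0 polyC_eq0.
have [||phi [phii phi1 phi2 _ _]] := wpres_univ H j
   (u1 := X) (u2 := j y) (v1 := (1 - (j y) ^+ B) / X) (v2 := (1 - X ^+ A) / j y).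
- exact: mul_divK.
- exact: mul_divK.
have [Q QE] : exists Q : Spec F, forall x, in_pt Q x <-> phi x = 0.
  by apply: ker_pt => p q /eqP; rewrite mulf_eq0 => /orP[] /eqP; [left|right].
have w2P : in_pt P w2 = false by rewrite (in_pt_congr Py) in_pt_cst (negPf y0).
apply: (@chain_below2 _ P0 Q).
  split=> [f /P0E ->|]; first exact: in_pt0.
  exists (w2 - i y); first by apply/QE; rewrite rmorphB phi2 phii subrr.
  by apply/negP => /P0E/eqP; rewrite (negPf (w2_not_const y)).
split=> [f /QE f0|]; last first.
  exists (w1 - i x) => //; apply/negP => /QE/eqP.
  by rewrite rmorphB phii phi1 -tofracB tofrac_eq0 polyXsubC_eq0.
(* If [f] vanishes on the curve, then [p] becomes the zero polynomial in [w1] at [w2 = y], so its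
   value in F is a multiple of [w2 - i y]. *)
have [n /(_ n (leqnn n))[p E]] := clear_denominators H f.
suff : in_pt P ((w1 * w2) ^+ n * f).
  by rewrite in_ptM in_ptX in_ptM (negPf w1P) w2P andbF.
pose r := hev (idfun : {rmorphism {poly K} -> {poly K}}) y%:P p.
have tfE q : tf q = hev j X q.
  by apply: (@hev_uniq _ _ j (@FracField.tofrac {poly K})).
have r0 : r = 0.
  apply/eqP; rewrite -tofrac_eq0 -/tf.
  have -> : tf r = hev (hev j X) (j y) p by apply: (@hev_comp _ _ _ idfun (@FracField.tofrac {poly K})).
  have := congr1 phi E; rewrite rmorphM f0 mulr0 => /esym/eqP.
  have -> : phi (ev12 p) = hev (hev j (phi w1)) (phi w2) p.
    by apply: hev_comp => c; exact: hev_comp.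
  by rewrite phi1 phi2.
have PW2 g : ideal_gen [set w2 - i y] g -> in_pt P g.
  by apply: ideal_gen_in_pt => ? ->.
rewrite E (in_pt_congr (y := hev (hev i w1) (i y) p)); last first.
  apply: PW2; apply: ideal_gen_hev => [c|]; last exact: mem_ideal_gen.
  by rewrite subrr; exact: ideal_gen0.
suff -> : hev (hev i w1) (i y) p = 0 by rewrite in_pt0.
transitivity (hev i w1 r); last by rewrite r0 rmorph0.
by apply/esym; rewrite (hev_comp (f := idfun) (h := hev i w1)) // hevC.
Qed.

(** The Jacobian criterion by hand: up to a local unit [v], one of the three generators is
    redundant. For [y != 0] it is [z2 - i u], for [u != 0] it is [w2 - i y], and for [A] nonzero in
    K it is [w1 - i x]. *)
Lemma regular_closed_point : A%:R != 0 :> K \/ y != 0 \/ u != 0 ->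
  regular_local_ring (localize P).
Proof.
move=> smooth.
suff [v Pv [g1 [g2 [Pg1 Pg2 vG]]]] : exists2 v, ~~ in_pt P v & exists g1 g2,
    [/\ in_pt P g1, in_pt P g2 & forall g, G3 g -> ideal_gen [set` [:: g1; g2]] (v * g)].
  apply: (@regular_loc _ _ [:: g1; g2]).
  - exact: noetherian_wpres H.
  - by move=> g; rewrite !inE => /orP[] /eqP ->.
  - move=> f /closed_point_gen[n wf]; exists (v * w1 ^+ n).
      by rewrite in_ptM negb_or Pv in_pt_w1X.
    rewrite -mulrA; move: wf.
    apply: (@ideal_gen_min _ _ [set g | ideal_gen [set` [:: g1; g2]] (v * g)]) => //=.
    + by rewrite mulr0; exact: ideal_gen0.
    + by move=> g h; rewrite mulrDr; exact: ideal_genD.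
    + by move=> a g; rewrite mulrCA; exact: ideal_genM.
  - exact: closed_point_chain2.
  - exact: no_chain3 A0 B0 H P.
have rel := closed_point_rel.
have G2 (g1 g2 v : F) : ideal_gen [set` [:: g1; g2]] (v * (w1 - i x)) ->
    ideal_gen [set` [:: g1; g2]] (v * (w2 - i y)) ->
    ideal_gen [set` [:: g1; g2]] (v * (z2 - i u)) ->
    forall g, G3 g -> ideal_gen [set` [:: g1; g2]] (v * g).
  by move=> ? ? ? g /=; rewrite !inE => /or3P[] /eqP ->.
have g1in (g1 g2 : F) : ideal_gen [set` [:: g1; g2]] g1.
  by apply: mem_ideal_gen; rewrite /= !inE eqxx.
have g2in (g1 g2 : F) : ideal_gen [set` [:: g1; g2]] g2.
  by apply: mem_ideal_gen; rewrite /= !inE eqxx orbT.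
have [y0|y0] := eqVneq y 0; last first.
  exists w2; first by rewrite (in_pt_congr Py) in_pt_cst.
  exists (w1 - i x), (w2 - i y); split=> //; apply: G2; try exact: ideal_genM.
  have -> : w2 * (z2 - i u) = - (w1 ^+ A - i x ^+ A) - i u * (w2 - i y).
    rewrite !mulrBr (wpres_rel2 H) -(rmorphM i) [u * y]mulrC rel.
    by rewrite rmorphB rmorph1 rmorphXn /=; ring.
  apply: ideal_genB; last exact: ideal_genM.
  by apply/ideal_genN/ideal_gen_subX.
have xA : x ^+ A = 1.
  by move: rel; rewrite y0 mul0r => /eqP; rewrite eq_sym subr_eq0 => /eqP.
have wA : w2 * z2 = - (w1 ^+ A - i x ^+ A).
  by rewrite -rmorphXn xA rmorph1 (wpres_rel2 H) opprB.
have [u0|u0] := eqVneq u 0; last first.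
  exists z2; first by rewrite (in_pt_congr Pu) in_pt_cst.
  exists (w1 - i x), (z2 - i u); split=> //; apply: G2; try exact: ideal_genM.
  rewrite y0 rmorph0 subr0 mulrC wA.
  by apply/ideal_genN/ideal_gen_subX.
have A1 : A%:R != 0 :> K by case: smooth => [//|[]]; rewrite ?y0 ?u0 eqxx.
(* The cofactor of [w1 - i x] in [w1 ^+ A - i x ^+ A]; its value at the point is the derivative of
   the power, nonzero as [A] and [x] are. *)
pose v := \sum_(k < A) w1 ^+ (A.-1 - k) * i x ^+ k.
exists v.
  have Pv : in_pt P (v - i (A%:R * x ^+ A.-1)).
    have -> : i (A%:R * x ^+ A.-1) = \sum_(k < A) i x ^+ (A.-1 - k) * i x ^+ k.
      rewrite (eq_bigr (fun=> i x ^+ A.-1)).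
        by rewrite sumr_const card_ord rmorphM rmorphXn rmorph_nat /= mulr_natl.
      by move=> k _; rewrite -exprD subnK // -ltnS prednK.
    rewrite -sumrB; elim/big_ind: _ => [|a b|k _]; [exact: in_pt0|exact: in_ptD|].
    by rewrite -mulrBl mulrC in_ptMl // subrXX mulrC in_ptMl.
  by rewrite (in_pt_congr Pv) in_pt_cst mulf_neq0 // expf_neq0 // closed_point_x0.
exists w2, z2; split.
- by rewrite -[w2]subr0 -(rmorph0 i) -y0.
- by rewrite -[z2]subr0 -(rmorph0 i) -u0.
apply: G2; rewrite ?y0 ?u0 ?rmorph0 ?subr0; try exact: ideal_genM.
rewrite mulrC -subrXX -[_ - _]opprK -wA.
by apply/ideal_genN/ideal_genM.
Qed.

End ClosedPoint.

End RegularPoints.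

(** * The regular locus *)

Section HeightOne.
Variables (K : closedFieldType) (F : comNzRingType) (i : {rmorphism K -> F}).
Variables (w1 w2 z1 z2 : F) (A B : nat).
Hypotheses (A0 : (0 < A)%N) (B0 : (0 < B)%N) (H : wpres i w1 w2 z1 z2 A B).
Variable P : Spec F.
Local Notation ev12 := (hev (hev i w1) w2).
Local Notation const t := (exists c, in_pt P (t - i c)).

(* A prime cut out locally by a single element is handled without Krull's
   Hauptidealsatz: a chain of length two below [P] would make [P] a closed point. *)
Lemma regular_height1 f g : in_pt P f -> f != 0 ->
  ~ (const w1 /\ const w2 /\ const z1 /\ const z2) -> in_pt P g ->
  (forall x, in_pt P x -> exists2 s, ~~ in_pt P s & ideal_gen [set g] (s * x)) ->
  regular_local_ring (localize P).
Proof.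
move=> Pf f0 nc Pg gen; apply: (@regular_loc _ _ [:: g]).
- exact: noetherian_wpres H.
- by move=> x; rewrite inE => /eqP ->.
- move=> x /gen[s Ps sx]; exists s => //; move: sx.
  by apply: sub_ideal_gen => y ->; apply: mem_ideal_gen; rewrite /= inE.
- exact: (chain_below1 A0 B0 H Pf f0).
- by move=> c2; apply: nc; do !split; exact: chain_const_mod A0 B0 H _ c2 _.
Qed.

(* The contraction of [P] to K[w1][w2] does not meet K[w1], so over K(w1) it is generated
   by an element of minimal degree; pseudo-division keeps this inside K[w1][w2]. *)
Lemma regular_transcendental f : in_pt P f -> f != 0 -> ~~ in_pt P w1 -> ~~ in_pt P w2 ->
  ~ const w1 -> regular_local_ring (localize P).
Proof.
move=> Pf f0 w1P w2P nc.
(* A nonzero polynomial in [w1] inside [P] would make [w1] constant modulo [P]. *)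
have tr r : r != 0 -> ~~ in_pt P (hev i w1 r).
  by move=> r0; apply/negP => /(in_pt_poly_root r0).
have PwX n : in_pt P ((w1 * w2) ^+ n) = false.
  by rewrite in_ptX in_ptM (negPf w1P) (negPf w2P) andbF.
have ww n : (w1 * w2) ^+ n != 0.
  by apply/eqP => E; have := PwX n; rewrite E in_pt0.
(* Sizes of the nonzero elements of the contraction of [P]; clearing the denominators of [f]
   provides one. *)
pose sz k := `[< exists p, [/\ p != 0, in_pt P (ev12 p) & size p = k] >].
have ex_sz : exists k, sz k.
  have [n /(_ n (leqnn n))[p E]] := clear_denominators H f.
  exists (size p); apply/asboolP; exists p; split=> //; last by rewrite -E in_ptMl.
  apply/eqP => p0; move: E; rewrite p0 rmorph0.
  by move=> /(wpres_domain A0 B0 H)[] /eqP; [rewrite (negPf (ww n))|rewrite (negPf f0)].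
have [_ /asboolP[g [g0 Pg <-]] gmin] := ex_minnP ex_sz.
apply: (regular_height1 Pf f0 (g := ev12 g)) => //; first by case.
move=> x Px; have [n /(_ n (leqnn n))[p E]] := clear_denominators H x.
(* The factor introduced by pseudo-division is a nonzero polynomial in [w1], hence outside [P]. *)
pose lc := lead_coef g ^+ scalp p g; pose s := hev i w1 lc.
have Ps : ~~ in_pt P s by apply: tr; rewrite expf_neq0 // lead_coef_eq0.
have divE : lc%:P * p = p %/ g * g + p %% g by rewrite mul_polyC Pdiv.Idomain.divp_eq.
have r0 : p %% g = 0.
  apply/eqP; apply: contraT => r0.
  have : sz (size (p %% g)).
    apply/asboolP; exists (p %% g); split=> //.
    have -> : p %% g = lc%:P * p - p %/ g * g by rewrite divE addrC addKr.
    rewrite rmorphB in_ptB //.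
      by rewrite rmorphM -E mulrA in_ptMl.
    by rewrite rmorphM in_ptMl.
  by move/gmin; rewrite leqNgt ltn_modp g0.
exists (s * (w1 * w2) ^+ n); first by rewrite in_ptM negb_or Ps PwX.
rewrite -mulrA E; have -> : s = ev12 lc%:P by rewrite hevC.
rewrite -rmorphM divE r0 addr0 rmorphM; apply: ideal_genM; exact: mem_ideal_gen.
Qed.

(** Such a [P] is a line [w1 = x], [w2 = 0] with [z2] free. Up to powers of [w1], everything is a
    polynomial in [z2] modulo [w1 - i x] and [w2], and only the zero polynomial has its value in
    [P]. As [z2 * w2] is a multiple of [w1 - i x] with [z2] outside [P], the single generator
    [w1 - i x] remains. *)
Lemma regular_line f : in_pt P f -> f != 0 ->
  ~ (const w1 /\ const w2 /\ const z1 /\ const z2) -> ~~ in_pt P w1 -> in_pt P w2 ->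
  regular_local_ring (localize P).
Proof.
move=> Pf f0 nc w1P Pw2.
have [x Px] : const w1.
  apply: (@in_pt_poly_root _ _ i P w1 ('X^A - 1)).
    by rewrite -size_poly_eq0 size_XnsubC.
  rewrite rmorphB rmorphXn rmorph1 /= hevX -opprB in_ptN -(wpres_rel2 H).
  by rewrite mulrC in_ptMl.
have Pw20 : in_pt P (w2 - i 0) by rewrite rmorph0 subr0.
have nz2 : ~ const z2.
  move=> z2c; apply: nc; split; first by exists x.
  split; first by exists 0.
  by split=> //; eexists; exact: (z1_const H w1P Px Pw20).
have xA : x ^+ A = 1.
  apply/eqP; rewrite -subr_eq0 -(in_pt_cst i P) rmorphB rmorph1 rmorphXn /=.
  rewrite -(in_pt_congr (x := w1 ^+ A - 1)).
    by rewrite -opprB in_ptN -(wpres_rel2 H) mulrC in_ptMl.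
  by rewrite opprB addrA subrK subrXX mulrC in_ptMl.
apply: (regular_height1 Pf f0 nc Px) => y Py.
have [n [p [q E]]] := w1_normal_form H y.
have z2P : ~~ in_pt P z2 by apply/negP => Pz2; apply: nz2; exists 0; rewrite rmorph0 subr0.
exists (z2 * w1 ^+ n); first by rewrite in_ptM negb_or z2P in_ptX (negPf w1P) andbF.
pose G2 := [set w1 - i x; w2].
have G2P : forall g, ideal_gen G2 g -> in_pt P g by apply: ideal_gen_in_pt => g [] ->.
have gx : ideal_gen G2 (w1 - i x) by apply: mem_ideal_gen; left.
have gw : ideal_gen G2 (w2 - i 0) by apply: mem_ideal_gen; right; rewrite rmorph0 subr0.
have gi r : ideal_gen G2 (hev i w1 r - hev i (i x) r).
  by apply: ideal_gen_hev => // c; rewrite subrr; exact: ideal_gen0.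
have [c cE] := hev_cst i x 0 p; have [r rE] := hev_cst_poly i x z2 q.
have gc : ideal_gen G2 (w1 ^+ n * y - hev i z2 (c%:P + r)).
  rewrite E rmorphD opprD addrACA hevC -cE -rE; apply: ideal_genD.
    exact: ideal_gen_hev.
  by apply: ideal_gen_hev => //; rewrite subrr; exact: ideal_gen0.
have cr0 : c%:P + r = 0.
  apply/eqP; apply: contraT => cr0; case: nz2; apply: (in_pt_poly_root cr0).
  by rewrite -(in_pt_congr (G2P _ gc)) in_ptMl.
rewrite cr0 rmorph0 subr0 in gc; rewrite -mulrA; move: gc.
apply: (@ideal_gen_min _ _ [set g | ideal_gen [set w1 - i x] (z2 * g)]) => /=.
+ by rewrite mulr0; exact: ideal_gen0.
+ by move=> g h; rewrite mulrDr; exact: ideal_genD.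
+ by move=> a g; rewrite mulrCA; exact: ideal_genM.
+ move=> _ [] -> /=; first by apply/ideal_genM/mem_ideal_gen.
  have -> : z2 * w2 = - (w1 ^+ A - i x ^+ A).
    by rewrite mulrC (wpres_rel2 H) -rmorphXn xA rmorph1 opprB.
  by apply/ideal_genN/ideal_gen_subX/mem_ideal_gen.
Qed.

End HeightOne.

Section RegularLocus.
Variables (K : closedFieldType) (F : comNzRingType) (i : {rmorphism K -> F}).
Variables (w1 w2 z1 z2 : F) (A B : nat).
Hypotheses (A0 : (0 < A)%N) (B0 : (0 < B)%N) (H : wpres i w1 w2 z1 z2 A B).

(** [P] is zero, a closed point, or neither. In the last case, if [w2] is also outside [P], then
    [w1] and [w2] cannot both be constant modulo [P], since their values determine those of [z1] and
    [z2]. *)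
Lemma regular_or_singular (P : Spec F) : ~~ in_pt P w1 ->
  regular_local_ring (localize P) \/
  [/\ A%:R = 0 :> K, in_pt P w2, in_pt P z2 & exists2 x, x ^+ A = 1 & in_pt P (w1 - i x)].
Proof.
move=> w1P; have [Pz|/existsNP[f /not_implyP[Pf /eqP f0]]] :=
    pselect (forall f, in_pt P f -> f = 0).
  by left; exact: (regular_generic H Pz).
have [[[x Px] [[y Py] [_ [u Pu]]]]|nc] := pselect ((exists c, in_pt P (w1 - i c)) /\
    (exists c, in_pt P (w2 - i c)) /\ (exists c, in_pt P (z1 - i c)) /\
    (exists c, in_pt P (z2 - i c))).
  have [A1|A1] := eqVneq (A%:R : K) 0; last first.
    by left; apply: (regular_closed_point A0 B0 H w1P Px Py Pu); left.
  have [y0|y0] := eqVneq y 0; last first.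
    by left; apply: (regular_closed_point A0 B0 H w1P Px Py Pu); right; left.
  have [u0|u0] := eqVneq u 0; last first.
    by left; apply: (regular_closed_point A0 B0 H w1P Px Py Pu); right; right.
  right; split=> //.
  - by rewrite (in_pt_congr Py) y0 in_pt_cst.
  - by rewrite (in_pt_congr Pu) u0 in_pt_cst.
  - exists x => //; have := closed_point_rel H Px Py Pu.
    by rewrite y0 mul0r => /esym/eqP; rewrite subr_eq0 => /eqP.
left; have [Pw2|w2P] := boolP (in_pt P w2); first exact: (regular_line A0 B0 H Pf f0).
have [[x Px]|nc1] := pselect (exists c, in_pt P (w1 - i c)); last first.
  exact: (regular_transcendental A0 B0 H Pf f0).
(* Here [w1] is constant modulo [P], so [w2] takes the role of the transcendental coordinate. *)
apply: (regular_transcendental B0 A0 (wpres_sym H) Pf f0) => // -[y Py].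
apply: nc; split; first by exists x.
split; first by exists y.
split; eexists; first exact: (z1_const H w1P Px Py).
exact: (z1_const (wpres_sym H) w2P Py Px).
Qed.

End RegularLocus.

(** * Formal power series *)

Lemma mpoly_rmorph_eq (n : nat) (R S : comNzRingType) (f g : {rmorphism {mpoly R[n]} -> S}) :
  (forall c, f c%:MP = g c%:MP) -> (forall i, f 'X_i = g 'X_i) -> forall p, f p = g p.
Proof.
move=> fgC fgX p; rewrite [p]mpolyE !rmorph_sum; apply: eq_bigr => m _ /=.
rewrite -mul_mpolyC !rmorphM fgC mpolyXE_id !rmorph_prod; congr (_ * _).
by apply: eq_bigr => i _; rewrite !rmorphXn /= fgX.
Qed.

Section PowerSeriesTheory.
Variables (n : nat) (R : comNzRingType).
Implicit Types (f g : fps n R) (p q : {mpoly R[n]}) (m u : 'X_{1..n}).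

Definition ord_ge d f := forall m, (mdeg m < d)%N -> f m = 0.

Lemma ord_geP f g d : (forall m, (mdeg m < d)%N -> f m = g m) <-> ord_ge d (f - g).
Proof.
split=> H m md; first by apply/eqP; rewrite -[_ m]/(f m - g m) subr_eq0 H.
by apply/eqP; rewrite -subr_eq0 -[_ - _]/((f - g) m) H.
Qed.

Lemma ord_geD d f g : ord_ge d f -> ord_ge d g -> ord_ge d (f + g).
Proof. by move=> Hf Hg m md; rewrite fpsDE Hf // Hg // addr0. Qed.

Lemma ord_geM d e f g : ord_ge d f -> ord_ge e g -> ord_ge (d + e) (f * g).
Proof.
move=> Hf Hg m md; rewrite -[LHS]/(fps_mul f g m) /fps_mul big1 // => k /eqP mE.
have kd : (mdeg k.1 + mdeg k.2 < d + e)%N by rewrite -mdegD -mE.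
have [fd|fd] := ltnP (mdeg k.1) d; first by rewrite Hf ?mul0r.
by rewrite [g _]Hg ?mulr0 //; move: kd; apply: contraTT; rewrite -!leqNgt; exact: leq_add.
Qed.

Lemma fps_of_mpoly : exists g : {rmorphism {mpoly R[n]} -> fps n R},
  forall p m, g p m = p@_m.
Proof.
have [|||g gE] := @rmorphism_of {mpoly R[n]} (fps n R) (fun p m => p@_m).
- by move=> p q; apply/funext => m; rewrite mcoeffD fpsDE.
- move=> p q; apply/funext => m; apply/esym.
  exact: (@fps_mulE_aux n R p q (fun m => p@_m) (fun m => q@_m) m).
- by apply: funext => m; rewrite mcoeff1 -[LHS]mul1r.
by exists g => p m; rewrite gE.
Qed.

Lemma fpsMX (g : {rmorphism {mpoly R[n]} -> fps n R}) u f m :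
  (forall p m, g p m = p@_m) ->
  (g 'X_[u] * f) m = if (u <= m)%MM then f (m - u)%MM else 0.
Proof.
move=> gE; pose q := fps_trunc (mdeg m).+1 f.
have -> : (g 'X_[u] * f) m = ('X_[u] * q)@_m.
  by apply: fps_mulE_aux => k km; rewrite ?gE // fps_truncE.
case: ifPn => um; last first.
  rewrite mcoeffM big1 // => k /eqP mE; rewrite mcoeffX.
  case: eqP => [uE|]; last by rewrite mul0r.
  by case/negP: um; rewrite mE uE; apply/mnm_lepP => i; rewrite mnmDE leq_addr.
have := mcoeffMX q u (m - u)%MM; rewrite mulrC addmC submK // => ->.
by rewrite fps_truncE // ltnS; have := mdegD (m - u)%MM u; rewrite submK // => ->; exact: leq_addr.
Qed.

Lemma fps_of_mpolyC (g : {rmorphism {mpoly R[n]} -> fps n R}) c :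
  (forall p m, g p m = p@_m) -> g c%:MP = fpsC c.
Proof.
by move=> gE; apply/funext => m; rewrite gE mcoeffC.
Qed.

Lemma fps_of_mpolyX (g : {rmorphism {mpoly R[n]} -> fps n R}) i :
  (forall p m, g p m = p@_m) -> g 'X_i = fpsX R i.
Proof.
by move=> gE; apply/funext => m; rewrite gE mcoeffX eq_sym.
Qed.

Lemma fpsCM c f m : (@fpsC n R c * f) m = c * f m.
Proof.
have [g gE] := fps_of_mpoly; rewrite -(fps_of_mpolyC _ gE).
rewrite -[LHS]/(fps_mul _ _ m) (@fps_mulE_aux _ _ c%:MP (fps_trunc (mdeg m).+1 f)).
- by rewrite mcoeffCM fps_truncE.
- by move=> k _; rewrite gE.
- by move=> k km; rewrite fps_truncE.
Qed.

Lemma fpsC_rmorphism : exists g : {rmorphism R -> fps n R}, forall c, g c = fpsC c.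
Proof.
have [g gE] := fps_of_mpoly.
exists (g \o @mpolyC n R) => c; exact: fps_of_mpolyC.
Qed.

Lemma fps_coef0_rmorphism : exists g : {rmorphism fps n R -> R}, forall f, g f = f 0%MM.
Proof.
have [|||g gE] := @rmorphism_of (fps n R) R (fun f => f 0%MM) => //.
- exact: fps_mul_coef0.
- by rewrite -[LHS]/(fpsC 1 0%MM) /fpsC eqxx mulr1.
by exists g.
Qed.

Lemma ord_ge1 f : ord_ge 1 f <-> f 0%MM = 0.
Proof.
split=> [|f0 m]; first by apply; rewrite mdeg0.
by rewrite ltnS leqn0 mdeg_eq0 => /eqP ->.
Qed.

Lemma ord_geX d f : ord_ge 1 f -> ord_ge d (f ^+ d).
Proof.
move=> Hf; elim: d => [|d IHd] //; rewrite exprS -add1n; exact: ord_geM.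
Qed.

End PowerSeriesTheory.

(** A geometric series in [e], which has order at least 1. The coefficient of its sum at [m] is read
    off the partial sum of length [(mdeg m).+1], beyond which it no longer changes. *)
Lemma fps_inverse (n : nat) (K : fieldType) (f : fps n K) :
  f 0%MM != 0 -> exists g, g * f = 1.
Proof.
move=> f0; have [C CE] := fpsC_rmorphism n K.
pose e : fps n K := 1 - C (f 0%MM)^-1 * f.
have e0 : ord_ge 1 e.
  apply/ord_ge1; rewrite -[LHS]/((1 : fps n K) 0%MM - (C (f 0%MM)^-1 * f) 0%MM).
  by rewrite CE fpsCM mulVf // -[(1 : fps n K) 0%MM]/(fpsC 1 0%MM) /fpsC eqxx mulr1 subrr.
pose s d : fps n K := \sum_(k < d) e ^+ k.
have sE d : (1 - e) * s d = 1 - e ^+ d.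
  by rewrite -[1 in RHS](expr1n _ d) subrXX; congr (_ * _); apply: eq_bigr => k _; rewrite expr1n mul1r.
pose g : fps n K := fun m => s (mdeg m).+1 m.
have gs d : ord_ge d (g - s d).
  apply/ord_geP => m md; rewrite /g.
  suff : ord_ge (mdeg m).+1 (s (mdeg m).+1 - s d) by move/ord_geP; apply.
  have -> : s d = s (mdeg m).+1 + \sum_((mdeg m).+1 <= k < d) e ^+ k.
    rewrite /s -!(big_mkord xpredT (fun k => e ^+ k)).
    by rewrite -big_cat_nat.
  rewrite opprD addNKr -sumrN big_nat_cond.
  elim/big_ind: _ => [|x y|k /andP[/andP[mk _] _] u um] //; first exact: ord_geD.
  rewrite -[LHS]/(- ((e ^+ k) u)) (ord_geX (d := k) e0) ?oppr0 //; exact: leq_trans mk.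
have ge1 : (1 - e) * g = 1.
  apply/funext => m; apply/eqP; rewrite -subr_eq0 -[_ - _]/(((1 - e) * g - 1) m).
  have -> : (1 - e) * g - 1 = (1 - e) * (g - s (mdeg m).+1) - e ^+ (mdeg m).+1.
    by rewrite mulrBr sE; ring.
  apply/eqP; rewrite -[LHS]/(((1 - e) * (g - s (mdeg m).+1)) m - (e ^+ (mdeg m).+1) m).
  rewrite (ord_geX e0) // (ord_geM (d := 0) (e := (mdeg m).+1)) ?subr0 //; exact: gs.
exists (g * C (f 0%MM)^-1); rewrite -[RHS]ge1 /e; ring.
Qed.

(** * The ring K[[x,y,z]]/(xy + z^(k+1)) *)

Definition mnm3 (a b c : nat) : 'X_{1..3} := [multinom nth 0%N [:: a; b; c] j | j < 3].

Lemma mnm3E a b c (j : 'I_3) : mnm3 a b c j = nth 0%N [:: a; b; c] j.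
Proof. exact: mnmE. Qed.

Lemma mnm3_ex (m : 'X_{1..3}) : exists a b c, m = mnm3 a b c.
Proof.
exists (m (@Ordinal 3 0 isT)), (m (@Ordinal 3 1 isT)), (m (@Ordinal 3 2 isT)).
apply/mnmP => -[[|[|[|j]]] hj] //; rewrite mnm3E /=; congr (m _); exact: val_inj.
Qed.

Lemma mnm3_deg a b c : mdeg (mnm3 a b c) = (a + b + c)%N.
Proof. by rewrite mdegE !big_ord_recl big_ord0 !mnm3E /= addn0 addnA. Qed.

Lemma mnm3_sub a b c d e f : (mnm3 a b c - mnm3 d e f)%MM = mnm3 (a - d) (b - e) (c - f).
Proof. by apply/mnmP => -[[|[|[|j]]] hj] //; rewrite mnmBE !mnm3E. Qed.

Lemma mnm3_le a b c d e f :
  (mnm3 a b c <= mnm3 d e f)%MM = [&& (a <= d)%N, (b <= e)%N & (c <= f)%N].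
Proof.
apply/mnm_lepP/and3P => [le|[ad be cf] [[|[|[|j]]] hj]]; rewrite ?mnm3E //.
by have:= (le (@Ordinal 3 0 isT), le (@Ordinal 3 1 isT), le (@Ordinal 3 2 isT));
  rewrite !mnm3E => -[[]].
Qed.

Section AkTheory.
Variables (K : fieldType) (k : nat).
Local Notation h := (Ak_eq K k).
Local Notation G := (Ak_ring K k).
Local Notation piG := (\pi_{ideal_quot (span_ideal (@Ak_proper K k))}).

Lemma Ak_coef (g : fps 3 K) a b c : (h * g) (mnm3 a b c) =
  (if (0 < a)%N && (0 < b)%N then g (mnm3 a.-1 b.-1 c) else 0)
  + (if (k < c)%N then g (mnm3 a b (c - k.+1)) else 0).
Proof.
have [fr frE] := fps_of_mpoly 3 K.
have -> : h = fr 'X_[mnm3 1 1 0] + fr 'X_[mnm3 0 0 k.+1].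
  rewrite /Ak_eq -!(fps_of_mpolyX _ frE) -rmorphM -rmorphXn /=; congr (fr _ + fr _).
    by rewrite -mpolyXD; congr 'X_[_]; apply/mnmP => -[[|[|[|j]]] hj] //; rewrite mnmDE !mnm1E mnm3E.
  rewrite mpolyXn; congr 'X_[_]; apply/mnmP => -[[|[|[|j]]] hj] //; rewrite mulmnE mnm1E mnm3E //=.
  exact: mul1n.
rewrite mulrDl fpsDE !(fpsMX _ _ _ frE) !mnm3_le !mnm3_sub !subn1 !subn0 !andbT.
by rewrite andbA.
Qed.

(* The quotient of the formal division by [xy + z^(k+1)]: the congruence
   [z^(k+1) = - xy] rewrites the monomial [x^a y^b z^(c + (k+1)s)] as
   [(-1)^s x^(a+s) y^(b+s) z^c]. *)
Definition Ak_div (f : fps 3 K) : fps 3 K := fun m =>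
  \sum_(s < (minn (m (@Ordinal 3 0 isT)) (m (@Ordinal 3 1 isT))).+1)
    (-1) ^+ s * f (mnm3 (m (@Ordinal 3 0 isT) - s) (m (@Ordinal 3 1 isT) - s)
                     (m (@Ordinal 3 2 isT) + k.+1 * s.+1)).

Lemma Ak_divE f a b c : Ak_div f (mnm3 a b c) =
  \sum_(s < (minn a b).+1) (-1) ^+ s * f (mnm3 (a - s) (b - s) (c + k.+1 * s.+1)).
Proof. by rewrite /Ak_div !mnm3E. Qed.

Lemma Ak_divD f g : Ak_div (f + g) = Ak_div f + Ak_div g.
Proof.
apply: funext => m; rewrite fpsDE /Ak_div -big_split /=.
by apply: eq_bigr => s _; rewrite fpsDE mulrDr.
Qed.

(** The sum telescopes: index [s] contributes [t s - t s.+1], and the last index has no second part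
    because the exponent of x or y has reached 0. *)
Lemma Ak_divM g : Ak_div (h * g) = g.
Proof.
apply: funext => m; have [a [b [c ->]]] := mnm3_ex m.
rewrite Ak_divE; pose M := minn a b.
pose t s := (-1) ^+ s * g (mnm3 (a - s) (b - s) (c + k.+1 * s)).
have E s : (s <= M)%N -> (-1) ^+ s * (h * g) (mnm3 (a - s) (b - s) (c + k.+1 * s.+1))
    = t s - (if (s < M)%N then t s.+1 else 0).
  move=> sM; rewrite Ak_coef !subn_gt0 -leq_min -/M mulrDr addrC; congr (_ + _).
    rewrite mulnS addnCA ltn_addr ?ltnS // addnC addnK //.
  case: ifP => _; last by rewrite mulr0 oppr0.
  by rewrite /t exprS mulN1r mulNr opprK -!subnS.
transitivity (\sum_(s < M.+1) (t s - (if (s < M)%N then t s.+1 else 0))).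
  by apply: eq_bigr => s _; rewrite E // -ltnS.
rewrite sumrB big_ord_recl [X in _ - X]big_ord_recr /= ltnn addr0.
have -> : \sum_(s < M) (if (s < M)%N then t s.+1 else 0) = \sum_(s < M) t s.+1.
  by apply: eq_bigr => s _; rewrite ltn_ord.
by rewrite addrK /t expr0 mul1r !subn0 muln0 addn0.
Qed.

(** Continuity of the division: in degrees below [d] the summation index satisfies [s < d], which
    bounds the degrees of the coefficients consulted. *)
Lemma Ak_div_ord d f : ord_ge (d + k.+1 * d) f -> ord_ge d (Ak_div f).
Proof.
move=> Hf m; have [a [b [c ->]]] := mnm3_ex m.
rewrite mnm3_deg Ak_divE => abc; apply: big1 => -[s /= sM] _.
rewrite Hf ?mulr0 // mnm3_deg addnA.
rewrite ltnS leq_min in sM; case/andP: sM => sa sb.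
have le1 : (a - s + (b - s) + c <= a + b + c)%N.
  by rewrite leq_add2r leq_add ?leq_subr.
rewrite -addSn leq_add ?(leq_ltn_trans le1) // leq_mul2l /=.
apply: leq_ltn_trans abc; apply: leq_trans sa _; by rewrite -addnA leq_addr.
Qed.

(** Division is additive and exact on multiples of [h], so the remainder of [f] is that of [f'],
    whose order is arbitrarily large. *)
Lemma Ak_ideal_closed f :
  (forall d, exists g f', f = h * g + f' /\ ord_ge d f') -> f = h * Ak_div f.
Proof.
move=> Hf; apply: funext => m; set d := (mdeg m).+1.
have [g [f' [fE Of']]] := Hf (d + k.+1 * d)%N.
apply/eqP; rewrite -subr_eq0 -[_ - _]/((f - h * Ak_div f) m).
have -> : f - h * Ak_div f = f' - h * Ak_div f'.
  by rewrite fE Ak_divD Ak_divM; ring.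
apply/eqP; rewrite -[LHS]/(f' m - (h * Ak_div f') m).
have h0 : ord_ge 0 h by [].
rewrite (ord_geM h0 (Ak_div_ord Of') (ltnSn _)) subr0.
by apply: Of'; rewrite -/d; exact: leq_addr.
Qed.

Lemma Ak_pi0P f : piG f = 0 <-> exists g, f = h * g.
Proof.
rewrite quot_pi0P span_idealE; split=> [|[g ->]]; last first.
  by apply: ideal_genMr; exact: mem_ideal_gen.
apply: (@ideal_gen_min _ _ [set f | exists g, f = h * g]) => /=.
- by exists 0; rewrite mulr0.
- by move=> x y [u ->] [v ->]; exists (u + v); rewrite mulrDr.
- by move=> x y [u ->]; exists (x * u); rewrite mulrCA.
- by move=> _ ->; exists 1; rewrite mulr1.
Qed.

Lemma Ak_coef0 : h 0%MM = 0.
Proof.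
rewrite (_ : 0%MM = mnm3 0 0 0); last by apply/mnmP => -[[|[|[|j]]] hj] //; rewrite mnm0E mnm3E.
by rewrite -[h]mulr1 Ak_coef addr0.
Qed.

Lemma Ak_ev0 : exists ev0 : {rmorphism G -> K}, forall f, ev0 (piG f) = f 0%MM.
Proof.
have [e eE] := fps_coef0_rmorphism 3 K.
have [|g gE] := @quot_lift _ (span_ideal (@Ak_proper K k)) _ e; last by exists g => f; rewrite gE eE.
by move=> f /quot_pi0P/Ak_pi0P[g ->]; rewrite rmorphM !eE Ak_coef0 mul0r.
Qed.

Lemma Ak_unit f : f 0%MM != 0 -> exists r, r * piG f = 1.
Proof.
move=> /fps_inverse[g gf]; exists (piG g).
by rewrite -rmorphM gf rmorph1.
Qed.

(** Leibniz rule at the origin: the product of the parts without constant term starts in degree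
    2. *)
Lemma fps_mul_coef1 (f g : fps 3 K) j :
  (f * g) U_(j)%MM = f 0%MM * g U_(j)%MM + g 0%MM * f U_(j)%MM.
Proof.
have [C CE] := fpsC_rmorphism 3 K.
have ord1 (u : fps 3 K) : ord_ge 1 (u - C (u 0%MM)).
  apply/ord_ge1; rewrite -[LHS]/(u 0%MM - C (u 0%MM) 0%MM) CE /fpsC eqxx mulr1.
  exact: subrr.
have CU c : C c U_(j)%MM = 0.
  by rewrite CE /fpsC -mdeg_eq0 mdeg1 mulr0.
have -> : f * g = C (f 0%MM) * g + C (g 0%MM) * (f - C (f 0%MM))
    + (f - C (f 0%MM)) * (g - C (g 0%MM)) by ring.
have deg2 : (mdeg U_(j)%MM < 1 + 1)%N by rewrite mdeg1.
rewrite fpsDE (ord_geM (ord1 f) (ord1 g) deg2) addr0 fpsDE !CE !fpsCM.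
congr (_ + _ * _); rewrite -[LHS]/(f U_(j)%MM - fpsC (f 0%MM) U_(j)%MM) -CE CU.
exact: subr0.
Qed.

(** For [k > 0] the equation has no terms of degree below 2, so linear coefficients are well defined
    on the quotient. [D] collects three derivations at the origin and measures the cotangent
    space. *)
Lemma Ak_linear_part : (0 < k)%N -> exists (ev0 : {rmorphism G -> K}) (D : G -> 'rV[K]_3),
  [/\ forall f, ev0 (piG f) = f 0%MM, forall f, D (piG f) = \row_j f U_(j)%MM,
      forall r s, D (r + s) = D r + D s &
      forall r s, D (r * s) = ev0 r *: D s + ev0 s *: D r].
Proof.
move=> k0; have [ev0 ev0E] := Ak_ev0.
pose D (r : G) : 'rV[K]_3 := \row_j (repr r : fps 3 K) U_(j)%MM.
have DE f : D (piG f) = \row_j f U_(j)%MM.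
  apply/rowP => j; rewrite !mxE; apply/eqP; rewrite -subr_eq0; apply/eqP.
  rewrite -[LHS]/((repr (piG f) - f) U_(j)%MM).
  have [|g ->] := (@Ak_pi0P (repr (piG f) - f)).1.
    by apply/quot_pi0P/quot_piP; exact: reprK.
  rewrite fps_mul_coef1 Ak_coef0 mul0r add0r.
  suff -> : h U_(j)%MM = 0 by rewrite mulr0.
  have [a [b [c jE]]] := mnm3_ex U_(j)%MM.
  have : (a + b + c = 1)%N by rewrite -mnm3_deg -jE mdeg1.
  rewrite jE -[h]mulr1 Ak_coef; move: a b c {jE} => [|[|a]] [|[|b]] [|[|c]] //= _.
    by case: (k) k0 => [//|k'] _; rewrite addr0.
  by rewrite addr0.
  by rewrite addr0.
have piE (r : G) : r = piG (repr r) by exact: esym (reprK _).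
exists ev0, D; split=> // r s; rewrite (piE r) (piE s).
  by rewrite -rmorphD !DE; apply/rowP => j; rewrite !mxE.
by rewrite -rmorphM !DE !ev0E; apply/rowP => j; rewrite !mxE fps_mul_coef1.
Qed.

End AkTheory.

(** * Completion of a local ring *)

Lemma mpoly_ev (n : nat) (R S : comNzRingType) (f : {rmorphism R -> S}) (x : 'I_n -> S) :
  exists ev : {rmorphism {mpoly R[n]} -> S},
    (forall c, ev c%:MP = f c) /\ (forall t, ev 'X_t = x t).
Proof.
exists (mmap f x); split=> [c|t]; first exact: mmapC.
by rewrite [LHS]mmapX mmap1U.
Qed.

Section AdicPowers.
Variables (A : comNzRingType) (I : idealr A).
Local Notation Ipow := (Completion.Ipow I).

Lemma Ipow_mull n a b : Ipow n b -> Ipow n (a * b).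
Proof. exact: ideal_genM. Qed.

Lemma Ipow_0 a : Ipow 0 a.
Proof.
rewrite -[a]mulr1; apply: ideal_genM; apply: mem_ideal_gen.
by exists (fun _ : 'I_0 => 0) => [[]|] //; rewrite big_ord0.
Qed.

Lemma Ipow_mul n a b : (I : A -> bool) a -> Ipow n b -> Ipow n.+1 (a * b).
Proof.
move=> Ia; apply: (@ideal_gen_min _ _ [set b | Ipow n.+1 (a * b)]) => /=.
- by rewrite mulr0; exact: ideal_gen0.
- by move=> x y; rewrite mulrDr; exact: ideal_genD.
- by move=> x y; rewrite mulrCA; exact: ideal_genM.
- move=> _ [t It <-] /=; apply: mem_ideal_gen.
  exists (fun s => if unlift ord0 s is Some s' then t s' else a).
    by move=> s /=; case: unliftP => [s'|] _ //; exact: It.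
  by rewrite big_ord_recl unlift_none; congr (_ * _); apply: eq_bigr => s _; rewrite liftK.
Qed.

(** Replaces the (n+1)-fold products in [ideal_pow] by products of a member of I and a member of
    I^n, for inductions on n. *)
Lemma Ipow_ind n (J : set A) : J 0 -> (forall x y, J x -> J y -> J (x + y)) ->
  (forall x y, J y -> J (x * y)) ->
  (forall a b, (I : A -> bool) a -> Ipow n b -> J (a * b)) -> Ipow n.+1 `<=` J.
Proof.
move=> J0 JD JM JI; apply: ideal_gen_min => // _ [t It <-].
rewrite big_ord_recl; apply: JI; first exact: It.
by apply: mem_ideal_gen; exists (fun s => t (lift ord0 s)) => // s; exact: It.
Qed.

Lemma Ipow_leq m n : (m <= n)%N -> Ipow n `<=` Ipow m.
Proof.
elim: n => [|n IHn]; first by rewrite leqn0 => /eqP ->.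
rewrite leq_eqVlt => /predU1P[-> //|mn]; apply: subset_trans (IHn mn).
apply: Ipow_ind; [exact: ideal_gen0|exact: ideal_genD|exact: ideal_genM|].
by move=> a b _; exact: ideal_genM.
Qed.

Lemma Ipow_prod (T : Type) (r : seq T) (x : T -> A) (e : T -> nat) :
  (forall t, (I : A -> bool) (x t)) ->
  Ipow (\sum_(t <- r) e t) (\prod_(t <- r) x t ^+ e t).
Proof.
move=> Ix; elim: r => [|t r IHr]; first by rewrite big_nil; exact: Ipow_0.
rewrite !big_cons; elim: (e t) => [|k IHk]; first by rewrite expr0 mul1r.
by rewrite exprS -mulrA addSn; exact: Ipow_mul.
Qed.

End AdicPowers.

Section Completeness.
Variables (A : comNzRingType) (I : idealr A).
Local Notation Ipow := (Completion.Ipow I).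
Local Notation C := (Completion.type I).
Local Notation piC := (\pi_{ideal_quot (Completion.null_ideal I)}).

Lemma completion_piP (u v : Completion.cseq I) : piC u = piC v <->
  forall n, exists N, forall i, (N <= i)%N -> Ipow n (val u i - val v i).
Proof.
rewrite quot_piP; split=> [/asboolP H n|H].
  by have [N HN] := H n; exists N => i /HN; rewrite rmorphB.
by apply/asboolP => n; have [N HN] := H n; exists N => i /HN; rewrite rmorphB.
Qed.

(** A diagonal criterion: I^i is contained in I^n for i >= n. *)
Lemma completion_eq (u v : Completion.cseq I) :
  (forall n, Ipow n (val u n - val v n)) -> piC u = piC v.
Proof.
move=> uv; apply/completion_piP => n; exists n => i ni.
exact: (Ipow_leq ni (uv i)).
Qed.

Lemma completion_from_rmorphism :
  exists g : {rmorphism A -> C}, forall a, g a = Completion.from I a.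
Proof.
apply: rmorphism_of.
- move=> x y; rewrite /Completion.from -rmorphD; apply: completion_eq => n.
  by rewrite rmorphD /= subrr; exact: ideal_gen0.
- move=> x y; rewrite /Completion.from -rmorphM; apply: completion_eq => n.
  by rewrite rmorphM /= subrr; exact: ideal_gen0.
- rewrite /Completion.from -(rmorph1 piC); apply: completion_eq => n.
  by rewrite rmorph1 /= subrr; exact: ideal_gen0.
Qed.

End Completeness.

Section CompletionAk.
Variables (K : fieldType) (k : nat) (L : comNzRingType) (I : idealr L).
Variables (j : {rmorphism K -> L}) (x : 'I_3 -> L) (g : {rmorphism L -> Ak_ring K k}).
Local Notation h := (Ak_eq K k).
Local Notation piG := (\pi_{ideal_quot (span_ideal (@Ak_proper K k))}).
Local Notation Ipow := (Completion.Ipow I).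
Local Notation piC := (\pi_{ideal_quot (Completion.null_ideal I)}).
Hypotheses (xI : forall t, (I : L -> bool) (x t))
  (Igen : forall a, (I : L -> bool) a -> ideal_gen (range x) a)
  (res : forall a, exists c, (I : L -> bool) (a - j c))
  (rel : x (@Ordinal 3 0 isT) * x (@Ordinal 3 1 isT) + x (@Ordinal 3 2 isT) ^+ k.+1 = 0)
  (gj : forall c, g (j c) = Ak_cst k c) (gx : forall t, g (x t) = piG (fpsX K t)).

Variable ev : {rmorphism {mpoly K[3]} -> L}.
Hypotheses (evC : forall c, ev c%:MP = j c) (evX : forall t, ev 'X_t = x t).

Let ev_Ipow n (p : {mpoly K[3]}) :
  (forall m, (mdeg m < n)%N -> p@_m = 0) -> Ipow n (ev p).
Proof.
move=> p0; rewrite [p]mpolyE rmorph_sum big_seq; elim/big_ind: _ => [|a b|m pm].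
- exact: ideal_gen0.
- exact: ideal_genD.
rewrite -mul_mpolyC rmorphM; apply: Ipow_mull.
have nm : (n <= mdeg m)%N.
  by rewrite leqNgt; apply/negP => /p0 /eqP; apply/negP; rewrite -mcoeff_msupp.
apply: (Ipow_leq nm); rewrite mpolyXE_id rmorph_prod mdegE.
rewrite (eq_bigr (fun t => x t ^+ m t)) => [|t _]; last by rewrite rmorphXn /= evX.
exact: Ipow_prod.
Qed.

Let trunc_sub (n : nat) (f : fps 3 K) (p : {mpoly K[3]}) :
  (forall m, (mdeg m < n)%N -> p@_m = f m) -> Ipow n (ev (fps_trunc n f) - ev p).
Proof.
by move=> pf; rewrite -rmorphB; apply: ev_Ipow => m mn; rewrite mcoeffB fps_truncE // pf ?subrr.
Qed.

Let trunc_cauchy f : Completion.cauchy I (fun n => ev (fps_trunc n f)).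
Proof.
apply/asboolP => n; exists n => a b na nb; rewrite -rmorphB; apply: ev_Ipow => m mn.
by rewrite mcoeffB !fps_truncE ?subrr // (leq_trans mn).
Qed.

Let Phi (f : fps 3 K) : Completion.type I :=
  piC (exist (fun u => Completion.cauchy I u) _ (trunc_cauchy f)).

Let Phi_rmorphism : exists ph : {rmorphism fps 3 K -> Completion.type I},
  forall f, ph f = Phi f.
Proof.
apply: rmorphism_of.
- move=> f f'; rewrite /Phi -rmorphD; apply: completion_eq => n.
  rewrite rmorphD -[X in Ipow _ X]/(ev (fps_trunc n (f + f')) - (ev (fps_trunc n f) + ev (fps_trunc n f'))).
  by rewrite -rmorphD; apply: trunc_sub => m mn; rewrite mcoeffD !fps_truncE.
- move=> f f'; rewrite /Phi -rmorphM; apply: completion_eq => n.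
  rewrite rmorphM -[X in Ipow _ X]/(ev (fps_trunc n (f * f')) - (ev (fps_trunc n f) * ev (fps_trunc n f'))).
  rewrite -rmorphM; apply: trunc_sub => m mn; apply/esym.
  by apply: fps_mulE.
- rewrite /Phi -(rmorph1 piC); apply: completion_eq => n.
  rewrite rmorph1 -[X in Ipow _ X]/(ev (fps_trunc n 1) - 1) -(rmorph1 ev).
  by apply: trunc_sub => m mn; rewrite mcoeff1 -[LHS]mul1r.
Qed.

Let Phi_const c : Phi (fpsC c) = Completion.from I (j c).
Proof.
apply: completion_eq => n /=; rewrite -evC.
by apply: trunc_sub => m mn; rewrite mcoeffC.
Qed.

Let Phi_X t : Phi (fpsX K t) = Completion.from I (x t).
Proof.
apply: completion_eq => n /=; rewrite -evX.
by apply: trunc_sub => m mn; rewrite mcoeffX eq_sym.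
Qed.

(** Factors from I are combinations of the [x t], and all remaining coefficients are constants
    modulo I. *)
Let approx n a : Ipow n a -> exists p : {mpoly K[3]},
  (forall m, (mdeg m < n)%N -> p@_m = 0) /\ Ipow n.+1 (a - ev p).
Proof.
elim: n a => [|n IHn] a.
  move=> _; have [c Ic] := res a; exists c%:MP; split=> //.
  by rewrite evC -[_ - _]mulr1; apply: Ipow_mul => //; exact: Ipow_0.
pose J a := exists p : {mpoly K[3]}, (forall m, (mdeg m < n.+1)%N -> p@_m = 0) /\ Ipow n.+2 (a - ev p).
have J0 : J 0.
  by exists 0; split=> [m _|]; rewrite ?mcoeff0 // rmorph0 subrr; exact: ideal_gen0.
have JD u v : J u -> J v -> J (u + v).
  move=> [p [p0 pI]] [q [q0 qI]]; exists (p + q); split=> [m mn|].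
    by rewrite mcoeffD p0 // q0 // addr0.
  by rewrite rmorphD opprD addrACA; exact: ideal_genD.
have JM u v : J v -> J (u * v).
  move=> [p [p0 pI]]; have [c Ic] := res u; exists (c%:MP * p); split=> [m mn|].
    by rewrite mcoeffCM p0 // mulr0.
  have -> : u * v - ev (c%:MP * p) = u * (v - ev p) + (u - j c) * ev p.
    by rewrite rmorphM evC; ring.
  apply: ideal_genD; first exact: Ipow_mull.
  by apply: Ipow_mul => //; exact: ev_Ipow.
apply: (Ipow_ind J0 JD JM) => {}a b Ia Ib.
apply: (@ideal_gen_min _ _ [set a | J (a * b)] _ _ _ _ _ (Igen Ia)) => /=.
- by rewrite mul0r.
- by move=> u v; rewrite mulrDl; exact: JD.
- by move=> u v; rewrite -mulrA; exact: JM.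
- move=> _ [t _ <-] /=; have [p [p0 pI]] := IHn b Ib; exists ('X_t * p); split=> [m mn|].
    rewrite mcoeffM big1 // => -[u v] /= /eqP mE; rewrite mcoeffX.
    case: eqP => [uE|]; last by rewrite mul0r.
    have := congr1 mdeg mE; rewrite mdegD -uE mdeg1 => dE.
    by rewrite dE in mn; rewrite p0 ?mulr0.
  by rewrite rmorphM evX -mulrBr; exact: Ipow_mul.
Qed.

Let Phi_surj y : exists f, Phi f = y.
Proof.
elim/quotW: y => u; have /asboolP uC := valP u.
have {uC} /choice[N uN] n : exists N, forall a b, (N <= a)%N -> (N <= b)%N ->
    Ipow n (val u a - val u b) by exact: uC.
(* A subsequence within I^n of the tail at step [n]: the partial sums of [N] are nondecreasing and
   dominate [N n]. *)
pose v n := val u (\sum_(s < n.+1) N s)%N.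
have vN n a : (N n <= a)%N -> Ipow n (val u a - v n).
  by move=> na; apply: uN => //; rewrite big_ord_recr leq_addl.
have vS n : Ipow n (v n.+1 - v n).
  by apply: vN; rewrite big_ord_recr /= big_ord_recr /= -addnA addnCA leq_addr.
have /choice[r rP] (na : nat * L) : exists p : {mpoly K[3]}, Ipow na.1 na.2 ->
    (forall m, (mdeg m < na.1)%N -> p@_m = 0) /\ Ipow na.1.+1 (na.2 - ev p).
  have [H|H] := pselect (Ipow na.1 na.2); last by exists 0.
  by have [p pP] := approx H; exists p.
(* Successive approximation: [ev (p n)] agrees with [v n] modulo I^n, and the next correction has no
   terms of degree below [n], so each coefficient stabilizes. *)
pose p := fix p n := if n is n'.+1 then p n' + r (n', v n - ev (p n')) else 0.
have pv n : Ipow n (v n - ev (p n)).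
  elim: n => [|n IHn]; first exact: Ipow_0.
  have H : Ipow n (v n.+1 - ev (p n)).
    by rewrite -(subrK (v n) (v n.+1)) -addrA; apply: ideal_genD; [exact: vS|exact: IHn].
  by have [_] := rP (n, v n.+1 - ev (p n)) H; rewrite /= rmorphD opprD addrA.
have pS n m : (mdeg m < n)%N -> (p n.+1)@_m = (p n)@_m.
  move=> mn; have H : Ipow n (v n.+1 - ev (p n)).
    by rewrite -(subrK (v n) (v n.+1)) -addrA; apply: ideal_genD; [exact: vS|exact: pv].
  by have [H0 _] := rP (n, v n.+1 - ev (p n)) H; rewrite /= mcoeffD H0 // addr0.
pose f : fps 3 K := fun m => (p (mdeg m).+1)@_m.
have pf n m : (mdeg m < n)%N -> (p n)@_m = f m.
  elim: n => // n IHn; rewrite ltnS leq_eqVlt => /predU1P[<- //|mn].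
  by rewrite pS // IHn.
exists f; apply/completion_piP => n; exists (maxn (N n) n) => a.
rewrite geq_max => /andP[Na na] /=.
have -> : ev (fps_trunc a f) - val u a = (ev (fps_trunc a f) - ev (p n))
  - (v n - ev (p n)) - (val u a - v n) by ring.
apply: ideal_genB; last exact: vN.
apply: ideal_genB; last exact: pv.
rewrite -rmorphB; apply: ev_Ipow => m mn.
by rewrite mcoeffB fps_truncE ?(leq_trans mn) // pf ?subrr.
Qed.

(** Continuity of [g]: the generators [x t] of I go to the classes of the variables. *)
Let g_Ipow n a : Ipow n a -> exists f, g a = piG f /\ ord_ge n f.
Proof.
elim: n a => [|n IHn] a.
  by move=> _; exists (repr (g a)); split=> //; exact: esym (reprK _).
pose J a := exists f, g a = piG f /\ ord_ge n.+1 f.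
have J0 : J 0 by exists 0; rewrite !rmorph0.
have JD u v : J u -> J v -> J (u + v).
  move=> [p [p0 pI]] [q [q0 qI]]; exists (p + q); split; last exact: ord_geD.
  by rewrite !rmorphD p0 q0.
have JM u v : J v -> J (u * v).
  move=> [p [p0 pI]]; exists ((repr (g u) : fps 3 K) * p); split.
    rewrite rmorphM p0 [RHS]rmorphM; congr (_ * _); exact: esym (reprK _).
  by apply: (ord_geM (d := 0)).
apply: (Ipow_ind J0 JD JM) => {}a b Ia Ib.
apply: (@ideal_gen_min _ _ [set a | J (a * b)] _ _ _ _ _ (Igen Ia)) => /=.
- by rewrite mul0r.
- by move=> u v; rewrite mulrDl; exact: JD.
- by move=> u v; rewrite -mulrA; exact: JM.
- move=> _ [t _ <-] /=; have [f [fE fO]] := IHn b Ib; exists (fpsX K t * f); split.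
    by rewrite !rmorphM gx fE.
  apply: (ord_geM (d := 1)) => //; apply/ord_ge1.
  by rewrite /fpsX eq_sym mnm1_eq0.
Qed.

(** If the sequence of truncations is null, then the truncation in degrees below [d] evaluates into
    I^d; applying [g] shows that [f] has order at least [d] modulo the equation. This holds for
    every [d], and the ideal is closed. *)
Let Phi_ker f : Phi f = 0 -> piG f = 0.
Proof.
rewrite -(rmorph0 piC) => /completion_piP H; apply/Ak_pi0P; exists (Ak_div k f).
have [fr frE] := fps_of_mpoly 3 K.
apply: Ak_ideal_closed => d; have [N HN] := H d.
have : Ipow d (ev (fps_trunc d f)).
  have := HN (maxn N d) (leq_maxl _ _); rewrite rmorph0 subr0 /= => H1.
  rewrite -(subrK (ev (fps_trunc (maxn N d) f)) (ev (fps_trunc d f))).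
  apply: ideal_genD => //; apply: trunc_sub => m mn.
  by rewrite fps_truncE // (leq_trans mn) // leq_maxr.
move=> /g_Ipow[f' [f'E f'O]].
have gE : g (ev (fps_trunc d f)) = piG (fr (fps_trunc d f)).
  apply: (@mpoly_rmorph_eq _ _ _ (g \o ev) (piG \o fr)) => [c|t] /=.
    by rewrite evC gj (fps_of_mpolyC _ frE).
  by rewrite evX gx (fps_of_mpolyX _ frE).
have /Ak_pi0P[u uE] : piG (fr (fps_trunc d f) - f') = 0.
  apply/quot_pi0P/quot_piP; rewrite -f'E; exact: esym gE.
exists u, (f' + (f - fr (fps_trunc d f))); split; first by rewrite -uE; ring.
apply: ord_geD => //; apply: (ord_geP f (fr (fps_trunc d f)) d).1 => m md.
by rewrite frE fps_truncE.
Qed.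

Lemma completion_Ak_aux :
  alg_isomorphic (fun c => Completion.from I (j c)) (@Ak_cst K k).
Proof.
have [ph phE] := Phi_rmorphism; have [from fromE] := completion_from_rmorphism I.
have [|psi psiE] := @quot_lift _ (span_ideal (@Ak_proper K k)) _ ph.
  move=> f /quot_pi0P/Ak_pi0P[u ->]; rewrite rmorphM.
  suff -> : ph h = 0 by rewrite mul0r.
  rewrite rmorphD rmorphM rmorphXn /= !phE !Phi_X -!fromE.
  by rewrite -rmorphM -rmorphXn -rmorphD rel rmorph0.
have psi_inj : injective psi.
  apply: raddf_inj => r r0; have rE : r = piG (repr r) := esym (reprK _).
  rewrite rE; apply: Phi_ker; rewrite -phE -psiE -[RHS]r0 {2}rE.
  by [].
have /choice[s sE] y : exists r, psi r = y.
  by have [f fE] := Phi_surj y; exists (piG f); rewrite psiE phE.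
have [|f [psif fpsi]] := @rmorph_inv _ _ psi.
  by exists s => // r; apply: psi_inj; rewrite sE.
exists f; split; first by exists psi.
move=> c; apply: (can_inj psif); rewrite fpsi -Phi_const -phE -psiE.
by [].
Qed.

End CompletionAk.

Lemma completion_Ak (K : fieldType) (k : nat) (L : comNzRingType) (I : idealr L)
    (j : {rmorphism K -> L}) (x : 'I_3 -> L) (g : {rmorphism L -> Ak_ring K k}) :
  (forall t, (I : L -> bool) (x t)) ->
  (forall a, (I : L -> bool) a -> ideal_gen (range x) a) ->
  (forall a, exists c, (I : L -> bool) (a - j c)) ->
  x (@Ordinal 3 0 isT) * x (@Ordinal 3 1 isT) + x (@Ordinal 3 2 isT) ^+ k.+1 = 0 ->
  (forall c, g (j c) = Ak_cst k c) ->
  (forall t, g (x t) = \pi_{ideal_quot (span_ideal (@Ak_proper K k))} (fpsX K t)) ->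
  alg_isomorphic (fun c => Completion.from I (j c)) (@Ak_cst K k).
Proof.
move=> xI Igen res rel gj gx; have [ev [evC evX]] := mpoly_ev j x.
by apply: (@completion_Ak_aux K k L I j x g xI Igen res rel gj gx ev).
Qed.

(** * The singular points *)

Lemma expr_pchar_pow (R : comNzRingType) (p m : nat) (s : R) (n : nat) :
  p \in [pchar R] -> s ^+ (n * p ^ m) - 1 = (s ^+ n - 1) ^+ (p ^ m).
Proof.
move=> pR; rewrite exprM -{1}(subrK 1 (s ^+ n)) exprDn_pchar ?expr1n ?addrK //.
by rewrite pnatX (eq_pnat _ (pcharf_eq pR)) pnat_id ?(pcharf_prime pR).
Qed.

Section SingularPoint.
Variables (K : closedFieldType) (F : comNzRingType) (i : {rmorphism K -> F}).
Variables (w1 w2 z1 z2 : F) (B p m al : nat).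
Local Notation A := (al * p ^ m)%N.
Local Notation q := (p ^ m)%N.
Local Notation k := (p ^ m).-1.
Hypotheses (A0 : (0 < A)%N) (B0 : (0 < B)%N) (H : wpres i w1 w2 z1 z2 A B).
Hypotheses (pK : p \in [pchar K]) (al0 : al%:R != 0 :> K) (m0 : (0 < m)%N).
Variables (P : Spec F) (z : K).
Hypotheses (Pw1 : in_pt P (w1 - i z)) (Pw2 : in_pt P w2) (Pz2 : in_pt P z2).
Hypothesis (zA : z ^+ A = 1).
Local Notation L := (localize P).
Local Notation G := (Ak_ring K k).
Local Notation piG := (\pi_{ideal_quot (span_ideal (@Ak_proper K k))}).

Let q1 : (1 < q)%N.
Proof.
by rewrite -(expn0 p) ltn_exp2l // (prime_gt1 (pcharf_prime pK)).
Qed.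

Let qE : k.+1 = q. Proof. by rewrite prednK // ltnW. Qed.

Let zal : z ^+ al = 1.
Proof.
apply/eqP; rewrite -subr_eq0; have := expr_pchar_pow m z al pK.
by rewrite zA subrr => /esym/eqP; rewrite expf_eq0 => /andP[].
Qed.

Let z0 : z != 0.
Proof.
apply: contraTneq A0 => z0; have := zA; rewrite z0 expr0n.
by case: (_ == 0)%N / eqP => [->//|_] /esym/eqP; rewrite oner_eq0.
Qed.

(* [u] is the cofactor of 'X - z in 'X^al - 1; Frobenius gives the power q. *)
Lemma root_cofactor : exists u : {poly K}, u.[z] != 0 /\
  forall (R : comNzRingType) (j : {rmorphism K -> R}) s,
    s ^+ A - 1 = (s - j z) ^+ q * hev j s u ^+ q.
Proof.
pose u : {poly K} := \sum_(t < al) 'X^(al.-1 - t) * (z ^+ t)%:P; exists u; split.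
  rewrite horner_sum (eq_bigr (fun=> z ^+ al.-1)); last first.
    move=> [t tal] _; rewrite hornerM hornerXn hornerC -exprD subnK //=.
    by rewrite -ltnS prednK // (leq_ltn_trans _ tal).
  by rewrite sumr_const card_ord -mulr_natl mulf_neq0 // expf_neq0.
move=> R j s; rewrite -exprMn.
have -> : (s - j z) * hev j s u = s ^+ al - 1.
  rewrite -[1 in RHS](rmorph1 j) -zal rmorphXn subrXX; congr (_ * _).
  by rewrite rmorph_sum; apply: eq_bigr => t _; rewrite rmorphM rmorphXn hevC /= hevX rmorphXn.
by apply: expr_pchar_pow; apply: rmorph_pchar pK.
Qed.

Let w1P : ~~ in_pt P w1.
Proof. by rewrite (in_pt_congr Pw1) in_pt_cst. Qed.

(** [g0] parametrizes the formal neighbourhood: [w1] goes to [jG z + Z], [z2] to [Y], and [w2] to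
    [X] times the unit that turns the second relation into [X * Y = - Z ^+ q]. The image of [z1] is
    then forced, since that of [w1] is invertible. *)
Lemma singular_local_map : exists (g : {rmorphism L -> G}) (x : 'I_3 -> L),
  [/\ forall c, g (loc_map P (i c)) = Ak_cst k c,
      forall t, g (x t) = piG (fpsX K t),
      forall t, nonunit (x t),
      forall a : L, nonunit a -> ideal_gen (range x) a &
      x (@Ordinal 3 0 isT) * x (@Ordinal 3 1 isT) + x (@Ordinal 3 2 isT) ^+ k.+1 = 0].
Proof.
have [u [uz uE]] := root_cofactor.
have [C CE] := fpsC_rmorphism 3 K.
pose jG := piG \o C : {rmorphism K -> G}.
have [ev0 ev0E] := @Ak_ev0 K k.
have ev0j c : ev0 (jG c) = c by rewrite ev0E CE /fpsC eqxx mulr1.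
pose X : G := piG (fpsX K (@Ordinal 3 0 isT)); pose Y : G := piG (fpsX K (@Ordinal 3 1 isT)).
pose Z : G := piG (fpsX K (@Ordinal 3 2 isT)); pose s : G := jG z + Z.
have ev0X t : ev0 (piG (fpsX K t)) = 0 by rewrite ev0E /fpsX eq_sym mnm1_eq0.
have XYZ : X * Y = - Z ^+ q.
  have -> : Z ^+ q = Z ^+ k.+1 by congr (_ ^+ _); rewrite qE.
  apply/eqP; rewrite -addr_eq0; apply/eqP.
  rewrite /X /Y /Z -rmorphM -rmorphXn -rmorphD; apply/Ak_pi0P; exists 1.
  by rewrite mulr1.
have unitG (r : G) : ev0 r != 0 -> exists r', r' * r = 1.
  have rE : r = piG (repr r) := esym (reprK _).
  by rewrite rE ev0E => /Ak_unit; apply.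
have ev0s : ev0 s = z by rewrite rmorphD ev0j ev0X addr0.
have [s' ss'] : exists s', s' * s = 1 by apply: unitG; rewrite ev0s.
pose W2 := X * hev jG s u ^+ q.
have [||g0 [g0i g01 g02 g03 g04]] := wpres_univ H jG
    (u1 := s) (u2 := W2) (v1 := s' * (1 - W2 ^+ B)) (v2 := Y).
- by rewrite mulrA (mulrC s) ss' mul1r.
- rewrite /W2 mulrAC XYZ -[RHS]opprB (uE _ jG) mulNr; congr (- (_ ^+ _ * _)).
  by rewrite /s addrC addKr.
have ev0W : ev0 W2 = 0 by rewrite rmorphM ev0X mul0r.
(* The constant term of [g0 f] is the value of [f] at the point, so elements outside [P] go to units
   and [g0] extends to the local ring. *)
have resP f : in_pt P (f - i (ev0 (g0 f))).
  elim/(wpres_ind H): f => [c|||||f f' Pf Pg|f f' Pf Pg].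
  - by rewrite g0i ev0j subrr in_pt0.
  - by rewrite g01 ev0s.
  - by rewrite g02 ev0W rmorph0 subr0.
  - rewrite g03 rmorphM rmorphB rmorph1 rmorphXn /= ev0W.
    have -> : ev0 s' = z^-1.
      by apply: (mulIf z0); rewrite mulVf // -[in LHS]ev0s -rmorphM ss' rmorph1.
    rewrite mulrC; apply: (z1_const H w1P Pw1).
    by rewrite rmorph0 subr0.
  - by rewrite g04 ev0X rmorph0 subr0.
  - by rewrite !rmorphD opprD addrACA in_ptD.
  - rewrite !rmorphM.
    have -> : f * f' - i (ev0 (g0 f)) * i (ev0 (g0 f'))
        = f' * (f - i (ev0 (g0 f))) + i (ev0 (g0 f)) * (f' - i (ev0 (g0 f'))) by ring.
    by rewrite in_ptD ?in_ptMl.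
have ev0P f : in_pt P f = (ev0 (g0 f) == 0).
  by rewrite (in_pt_congr (resP f)) in_pt_cst.
have [|g gE] := @loc_lift _ P _ g0.
  by move=> f; rewrite ev0P => /unitG.
have [loc locE] := loc_map_rmorphism P.
pose U := hev i w1 u.
have g0U : g0 U = hev jG s u by rewrite -g01; exact: hev_comp.
have UP : ~~ in_pt P U.
  rewrite ev0P g0U (hev_comp (h := idfun)) // ev0s.
  suff -> : hev idfun z u = u.[z] by [].
  by apply/esym; apply: (hev_uniq (g := horner_eval z)) => [c|] /=;
    rewrite /horner_eval ?hornerC ?hornerX.
have [t tU] := loc_unit UP; rewrite -locE in tU.
pose x (l : 'I_3) : L := nth 0 [:: loc w2 * t ^+ q; loc z2; loc (w1 - i z)] l.
have x0E : loc w2 = loc U ^+ q * (loc w2 * t ^+ q).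
  by rewrite mulrCA -exprMn (mulrC (loc U)) tU expr1n mulr1.
exists g, x; split.
- by move=> c; rewrite gE g0i /= CE.
- have gtU : g t * hev jG s u = 1 by rewrite -g0U -gE -locE -rmorphM tU rmorph1.
  move=> [[|[|[|l]]] hl] //; rewrite /x /=.
  + rewrite rmorphM rmorphXn locE gE g02 /W2 /= -mulrA -exprMn (mulrC _ (g t)) gtU expr1n mulr1.
    by congr (piG (fpsX K _)); exact: val_inj.
  + by rewrite locE gE g04; congr (piG (fpsX K _)); exact: val_inj.
  + rewrite locE gE rmorphB g01 g0i /s addrC addKr.
    by congr (piG (fpsX K _)); exact: val_inj.
- have [_ _ NM] := Localization.nonunit_idealr P.
  move=> [[|[|[|l]]] hl] //; rewrite /x /= ?locE ?nonunit_loc //.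
  rewrite mulrC -[_ * _]addr0; apply: NM; first by rewrite [_ \in _]nonunit_loc.
  by have [] := Localization.nonunit_idealr P.
- have gens := @loc_nonunit_gen _ P [:: w1 - i z; w2 - i 0; z2 - i 0].
  move=> a Na; have : [set l : L | nonunit l] a by [].
  rewrite gens; last first.
  + move=> f Pf; have [||n wf] := closed_point_gen H Pw1 (y := 0) (u := 0) _ _ Pf.
    * by rewrite rmorph0 subr0.
    * by rewrite rmorph0 subr0.
    * by exists (w1 ^+ n); rewrite ?in_ptX ?(negPf w1P) ?andbF.
  + by move=> f; rewrite !inE rmorph0 !subr0 => /or3P[] /eqP ->.
  apply: sub_ideal_gen => y /=; rewrite !inE rmorph0 !subr0 -!locE => /or3P[] /eqP ->.
  + by apply: mem_ideal_gen; exists (@Ordinal 3 2 isT).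
  + by rewrite x0E; apply/ideal_genM/mem_ideal_gen; exists (@Ordinal 3 0 isT).
  + by apply: mem_ideal_gen; exists (@Ordinal 3 1 isT).
- rewrite /x /= qE mulrAC -rmorphM (wpres_rel2 H) -opprB (uE _ i) -/U rmorphN.
  rewrite mulNr rmorphM !rmorphXn /= -mulrA -exprMn (mulrC _ t) tU expr1n mulr1.
  by rewrite addNr.
Qed.

Lemma singular_completion : alg_isomorphic
  (fun c => Completion.from (Localization.maxideal P) (loc_map P (i c))) (@Ak_cst K k).
Proof.
have [g [x [gi gx xI Igen rel]]] := singular_local_map.
have [loc locE] := loc_map_rmorphism P.
have -> : (fun c => Completion.from (Localization.maxideal P) (loc_map P (i c)))
  = (fun c => Completion.from (Localization.maxideal P) ((loc \o i) c)).
  by apply: funext => c /=; rewrite locE.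
apply: (@completion_Ak _ _ _ _ (loc \o i) x g) => //; last first.
  by move=> c /=; rewrite locE gi.
have [ev0 ev0E] := @Ak_ev0 K k.
(* The residue of [a] is read off its image: the difference goes to 0 under [ev0 \o g], so it cannot
   be a unit. *)
move=> a; exists (ev0 (g a)); rewrite -[X in is_true X]/(nonunit (a - (loc \o i) (ev0 (g a)))).
apply/asboolP => -[b ab]; have := congr1 (ev0 \o g) ab.
rewrite /= !rmorphM !rmorphB /= locE gi ev0E /fpsC eqxx mulr1 subrr mulr0 !rmorph1.
by move/eqP; rewrite eq_sym oner_eq0.
Qed.

(** By the Leibniz rule, [D \o g] maps the maximal ideal into the span of the images of its [d]
    generators. The three [x t] go to the unit vectors, so 3 <= d, while chains of primes have
    length at most 2. *)
Lemma singular_not_regular : ~ regular_local_ring L.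
Proof.
move=> [_ _ [d [[dch _] [gs gsE]]]].
have d2 : (d <= 2)%N.
  rewrite leqNgt; apply/negP => d3; move/loc_prime_chain: dch => dch.
  exact: (no_chain3 A0 B0 H (chain_below_le d3 dch)).
have [g [x [gi gx xI Igen rel]]] := singular_local_map.
have k0 : (0 < k)%N by rewrite -ltnS qE.
have [ev0 [D [ev0E DE DD DM]]] := Ak_linear_part K k0.
have nonu a : nonunit a -> ev0 (g a) = 0.
  move=> /Igen; apply: (@ideal_gen_ker _ _ (ev0 \o g)) => _ [t _ <-] /=.
  by rewrite gx ev0E /fpsX eq_sym mnm1_eq0.
pose M := \matrix_(l < d) D (g (tnth gs l)).
have DM' a : nonunit a -> (D (g a) <= M)%MS.
  move=> Na; have : [set l : L | nonunit l] a by []; rewrite gsE.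
  suff H' : ideal_gen [set` gs] `<=` [set a | ev0 (g a) = 0 /\ (D (g a) <= M)%MS].
    by move=> /H'[].
  apply: ideal_gen_min => /=.
  - have D0 : D 0 = 0 by apply: (addrI (D 0)); rewrite -DD !addr0.
    by rewrite !rmorph0 D0 sub0mx.
  - move=> b c [b0 bM] [c0 cM]; rewrite !rmorphD b0 c0 addr0 DD; split=> //.
    exact: addmx_sub.
  - move=> b c [c0 cM]; rewrite !rmorphM c0 mulr0 DM c0 scale0r addr0; split=> //.
    exact: scalemx_sub.
  - move=> b /= bgs; split.
      apply: nonu; suff : [set l : L | nonunit l] b by [].
      by rewrite gsE; exact: mem_ideal_gen.
    have /tnthP[l ->] : b \in gs by [].
    by rewrite (_ : D _ = row l M) ?row_sub // rowK.
have : (1%:M <= M)%MS.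
  apply/row_subP => t; rewrite row1; have := DM' _ (xI t); rewrite gx DE.
  congr (_ <= _)%MS; apply/rowP => l; rewrite !mxE /fpsX eqxx /=.
  congr (_%:R); congr nat_of_bool; apply/eqP/eqP => [/mnmP/(_ l)|->//].
  by rewrite !mnm1E eqxx; case: eqP.
move=> /mxrankS; rewrite mxrank1 => /leq_trans/(_ (rank_leq_row _)).
by rewrite leqNgt (leq_ltn_trans d2).
Qed.

End SingularPoint.

(** * Rescaling of presentations *)

(* [wpres] with arbitrary coefficients x1 y1 = t1 + r1 x2^B, x2 y2 = t2 + r2 x1^A, over
   any base ring. *)
Record gpres (R F : comNzRingType) (i : {rmorphism R -> F}) (x1 x2 y1 y2 : F)
    (t1 r1 t2 r2 : R) (A B : nat) : Prop := GPres {
  gpres_rel1 : x1 * y1 = i t1 + i r1 * x2 ^+ B;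
  gpres_rel2 : x2 * y2 = i t2 + i r2 * x1 ^+ A;
  gpres_ind : forall G : F -> Prop, (forall c, G (i c)) ->
    G x1 -> G x2 -> G y1 -> G y2 -> (forall x y, G x -> G y -> G (x + y)) ->
    (forall x y, G x -> G y -> G (x * y)) -> forall x, G x;
  gpres_univ : forall (S : comNzRingType) (j : {rmorphism R -> S}) (u1 u2 v1 v2 : S),
    u1 * v1 = j t1 + j r1 * u2 ^+ B -> u2 * v2 = j t2 + j r2 * u1 ^+ A ->
    exists g : {rmorphism F -> S}, [/\ forall c, g (i c) = j c,
      g x1 = u1, g x2 = u2, g y1 = v1 & g y2 = v2] }.

Lemma gpres_wpres (K F : comNzRingType) (i : {rmorphism K -> F}) w1 w2 z1 z2 A B :
  gpres i w1 w2 z1 z2 1 (-1) 1 (-1) A B -> wpres i w1 w2 z1 z2 A B.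
Proof.
move=> [rel1 rel2 ind univ]; split=> //.
- by rewrite rel1 rmorphN rmorph1 mulN1r.
- by rewrite rel2 rmorphN rmorph1 mulN1r.
- move=> S j u1 u2 v1 v2 uv1 uv2; apply: univ.
  + by rewrite uv1 rmorphN rmorph1 mulN1r.
  + by rewrite uv2 rmorphN rmorph1 mulN1r.
Qed.

Lemma gpres_iso (R F F' : comNzRingType) (i : {rmorphism R -> F}) (i' : {rmorphism R -> F'})
    x1 x2 y1 y2 x1' x2' y1' y2' t1 r1 t2 r2 A B :
  gpres i x1 x2 y1 y2 t1 r1 t2 r2 A B -> gpres i' x1' x2' y1' y2' t1 r1 t2 r2 A B ->
  exists f : {rmorphism F -> F'}, [/\ alg_isom i i' f,
    f x1 = x1', f x2 = x2', f y1 = y1' & f y2 = y2'].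
Proof.
move=> H H'.
have [f [fi f1 f2 f3 f4]] := gpres_univ H (gpres_rel1 H') (gpres_rel2 H').
have [g [gi g1 g2 g3 g4]] := gpres_univ H' (gpres_rel1 H) (gpres_rel2 H).
exists f; split=> //; split=> //; exists g => x.
  elim/(gpres_ind H): x => [c|||||x y Hx Hy|x y Hx Hy]; rewrite ?fi ?f1 ?f2 ?f3 ?f4 //.
    by rewrite !rmorphD Hx Hy.
  by rewrite !rmorphM Hx Hy.
elim/(gpres_ind H'): x => [c|||||x y Hx Hy|x y Hx Hy]; rewrite ?gi ?g1 ?g2 ?g3 ?g4 //.
  by rewrite !rmorphD Hx Hy.
by rewrite !rmorphM Hx Hy.
Qed.

(** The scalars are units with given inverses, so generation and the universal property transfer by
    dividing the generators or their images. *)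
Lemma gpres_rescale (R F : comNzRingType) (i : {rmorphism R -> F}) x1 x2 y1 y2
    t1 r1 t2 r2 t1' r1' t2' r2' (l1 l2 m1 m2 l1' l2' m1' m2' : R) A B :
  l1' * l1 = 1 -> l2' * l2 = 1 -> m1' * m1 = 1 -> m2' * m2 = 1 ->
  l1 * m1 * t1 = t1' -> l1 * m1 * r1 = r1' * l2 ^+ B ->
  l2 * m2 * t2 = t2' -> l2 * m2 * r2 = r2' * l1 ^+ A ->
  gpres i x1 x2 y1 y2 t1 r1 t2 r2 A B ->
  gpres i (i l1 * x1) (i l2 * x2) (i m1 * y1) (i m2 * y2) t1' r1' t2' r2' A B.
Proof.
move=> L1 L2 M1 M2 T1 E1 T2 E2 [rel1 rel2 ind univ].
have inv (S : comNzRingType) (j : {rmorphism R -> S}) (l l' : R) : l' * l = 1 -> j l' * j l = 1.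
  by move=> ll; rewrite -rmorphM ll rmorph1.
split.
- by rewrite mulrACA -rmorphM rel1 mulrDr exprMn !mulrA -!rmorphM -rmorphXn -rmorphM T1 E1.
- by rewrite mulrACA -rmorphM rel2 mulrDr exprMn !mulrA -!rmorphM -rmorphXn -rmorphM T2 E2.
- move=> G GC G1 G2 G3 G4 GD GM.
  have Gl l l' x : l' * l = 1 -> G (i l * x) -> G x.
    by move=> ll /(GM _ _ (GC l')); rewrite mulrA inv // mul1r.
  by apply: ind => //; [exact: Gl L1 G1|exact: Gl L2 G2|exact: Gl M1 G3|exact: Gl M2 G4].
- move=> S j u1 u2 v1 v2 uv1 uv2.
  have rel (l l' m m' n n' t t' r r' : R) (u v w : S) e : l' * l = 1 -> m' * m = 1 ->
      n' * n = 1 -> l * m * t = t' -> l * m * r = r' * n ^+ e ->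
      u * v = j t' + j r' * w ^+ e ->
      (j l' * u) * (j m' * v) = j t + j r * (j n' * w) ^+ e.
    move=> ll mm nn <- Er uv; rewrite mulrACA uv.
    have -> : r' = l * m * r * n' ^+ e by rewrite Er -mulrA -exprMn (mulrC n) nn expr1n mulr1.
    rewrite !rmorphM !rmorphXn exprMn.
    have -> : j l' * j m' * (j l * j m * j t + j l * j m * j r * j n' ^+ e * w ^+ e)
      = (j l' * j l) * (j m' * j m) * (j t + j r * (j n' ^+ e * w ^+ e)).
      by move: (_ ^+ e) (_ ^+ e) => a b; ring.
    by rewrite !inv // !mul1r.
  have [g [gi g1 g2 g3 g4]] := univ S j _ _ _ _
    (rel _ _ _ _ _ _ _ _ _ _ _ _ _ _ L1 M1 L2 T1 E1 uv1)
    (rel _ _ _ _ _ _ _ _ _ _ _ _ _ _ L2 M2 L1 T2 E2 uv2).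
  exists g; split=> //; rewrite rmorphM gi ?g1 ?g2 ?g3 ?g4 mulrA.
  + by rewrite (mulrC (j l1)) inv ?mul1r.
  + by rewrite (mulrC (j l2)) inv ?mul1r.
  + by rewrite (mulrC (j m1)) inv ?mul1r.
  + by rewrite (mulrC (j m2)) inv ?mul1r.
Qed.

Lemma mpoly_gen_ind (n : nat) (R : comNzRingType) (G : {mpoly R[n]} -> Prop) :
  (forall c, G c%:MP) -> (forall t, G 'X_t) -> (forall p q, G p -> G q -> G (p + q)) ->
  (forall p q, G p -> G q -> G (p * q)) -> forall p, G p.
Proof.
move=> GC GX GD GM p; rewrite [p]mpolyE; elim/big_ind: _ => [|u v|m _]; last 1 first.
- rewrite -mul_mpolyC; apply: (GM) => //; rewrite mpolyXE_id.
  elim/big_ind: _ => [|u v|t _]; [by rewrite -mpolyC1|exact: GM|].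
  by elim: (m t) => [|e IHe]; rewrite ?expr0 ?exprS -?mpolyC1 //; exact: GM.
- by have := GC 0; rewrite mpolyC0.
- exact: GD.
Qed.

Lemma pt4_ind (T : Type) (G : T -> Prop) (f : 'I_4 -> T) :
  G (f (@Ordinal 4 0 isT)) -> G (f (@Ordinal 4 1 isT)) ->
  G (f (@Ordinal 4 2 isT)) -> G (f (@Ordinal 4 3 isT)) -> forall t, G (f t).
Proof.
move=> G0 G1 G2 G3 [[|[|[|[|t]]]] ht] //.
- by rewrite (_ : Ordinal ht = @Ordinal 4 0 isT) //; exact: val_inj.
- by rewrite (_ : Ordinal ht = @Ordinal 4 1 isT) //; exact: val_inj.
- by rewrite (_ : Ordinal ht = @Ordinal 4 2 isT) //; exact: val_inj.
- by rewrite (_ : Ordinal ht = @Ordinal 4 3 isT) //; exact: val_inj.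
Qed.

(** The relations enter through the equations [E1] and [E2], so that one proof serves [cluster] and
    [wcluster], whose signs differ. *)
Lemma gpres_quot (R : comNzRingType) (g1 g2 : {mpoly R[4]}) (N : ~ ideal_gen [set g1; g2] 1)
    (t1 r1 t2 r2 : R) (A B : nat) :
  g1 = X4_0 * X4_2 - t1%:MP - r1%:MP * X4_1 ^+ B ->
  g2 = X4_1 * X4_3 - t2%:MP - r2%:MP * X4_0 ^+ A ->
  exists i : {rmorphism R -> {ideal_quot (span_ideal N)}},
    (forall c, i c = \pi_{ideal_quot (span_ideal N)} c%:MP) /\
    gpres i (\pi_{ideal_quot (span_ideal N)} X4_0) (\pi_{ideal_quot (span_ideal N)} X4_1)
      (\pi_{ideal_quot (span_ideal N)} X4_2) (\pi_{ideal_quot (span_ideal N)} X4_3)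
      t1 r1 t2 r2 A B.
Proof.
move=> E1 E2; set pi := \pi_{ideal_quot (span_ideal N)}.
have P1 : pi (X4_0 * X4_2 - t1%:MP - r1%:MP * X4_1 ^+ B) = 0.
  by apply/quot_pi0P/span_idealE/mem_ideal_gen; left; exact: esym E1.
have P2 : pi (X4_1 * X4_3 - t2%:MP - r2%:MP * X4_0 ^+ A) = 0.
  by apply/quot_pi0P/span_idealE/mem_ideal_gen; right; exact: esym E2.
pose i : {rmorphism R -> {ideal_quot (span_ideal N)}} := pi \o @mpolyC 4 R.
exists i; split=> //; split.
- apply/eqP; rewrite -subr_eq0 opprD addrA -P1.
  by rewrite /i /pi /= !rmorphB !rmorphM rmorphXn.
- apply/eqP; rewrite -subr_eq0 opprD addrA -P2.
  by rewrite /i /pi /= !rmorphB !rmorphM rmorphXn.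
- move=> G GC G1 G2 G3 G4 GD GM; elim/quotW=> p; apply: (mpoly_gen_ind (G := fun p => G (pi p))) p.
  + exact: GC.
  + exact: (pt4_ind (G := fun p => G (pi p))).
  + by move=> p q Gp Gq; rewrite /pi rmorphD; exact: GD.
  + by move=> p q Gp Gq; rewrite /pi rmorphM; exact: GM.
- move=> S j u1 u2 v1 v2 uv1 uv2.
  have [ev [evC evX]] := mpoly_ev j (pt4 u1 u2 v1 v2).
  have [|f fE] := @quot_lift _ (span_ideal N) _ ev.
    move=> p /span_idealE; apply: ideal_gen_ker => _ [] ->.
      by rewrite E1 !rmorphB !rmorphM rmorphXn /= !evC !evX /pt4 /= uv1; ring.
    by rewrite E2 !rmorphB !rmorphM rmorphXn /= !evC !evX /pt4 /= uv2; ring.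
  exists f; split; first by move=> c; rewrite /i /= fE evC.
  + by rewrite fE evX.
  + by rewrite fE evX.
  + by rewrite fE evX.
  + by rewrite fE evX.
Qed.

(** * The fibers of the family *)

Lemma cluster_gpres (R : comNzRingType) (t1 t2 : R) (a b : int) :
  exists i : {rmorphism R -> cluster t1 t2 a b}, (forall c, i c = cluster_cst t1 t2 a b c) /\
    gpres i (cluster_pi t1 t2 a b X4_0) (cluster_pi t1 t2 a b X4_1)
      (cluster_pi t1 t2 a b X4_2) (cluster_pi t1 t2 a b X4_3) t1 1 t2 1 `|a|%N `|b|%N.
Proof. by apply: gpres_quot; rewrite mpolyC1 mul1r. Qed.

Lemma wcluster_gpres (K : comNzRingType) (a b : int) :
  exists i : {rmorphism K -> wcluster K a b}, (forall c, i c = wcluster_cst a b c) /\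
    gpres i (wcluster_pi a b X4_0) (wcluster_pi a b X4_1)
      (wcluster_pi a b X4_2) (wcluster_pi a b X4_3) 1 (-1) 1 (-1) `|a|%N `|b|%N.
Proof. by apply: gpres_quot; rewrite mpolyCN mpolyC1 mulN1r opprK. Qed.

Section LaurentRing.
Variable K : fieldType.

Lemma laurent_cst_rmorphism :
  exists i : {rmorphism K -> laurent K}, forall c, i c = laurent_cst c.
Proof.
by exists (\pi_{ideal_quot (span_ideal (@laurent_proper K))} \o @mpolyC 4 K).
Qed.

Lemma laurent_rel1 : laurent_c1 K * laurent_pi X4_2 = 1.
Proof.
apply/eqP; rewrite -subr_eq0 /laurent_c1 /laurent_pi -rmorphM -(rmorph1 \pi_{ideal_quot _}) -rmorphB.
by apply/eqP/quot_pi0P/span_idealE/mem_ideal_gen; left.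
Qed.

Lemma laurent_rel2 : laurent_c2 K * laurent_pi X4_3 = 1.
Proof.
apply/eqP; rewrite -subr_eq0 /laurent_c2 /laurent_pi -rmorphM -(rmorph1 \pi_{ideal_quot _}) -rmorphB.
by apply/eqP/quot_pi0P/span_idealE/mem_ideal_gen; right.
Qed.

Lemma laurent_ind (G : laurent K -> Prop) : (forall c, G (laurent_cst c)) ->
  G (laurent_c1 K) -> G (laurent_c2 K) -> G (laurent_pi X4_2) -> G (laurent_pi X4_3) ->
  (forall x y, G x -> G y -> G (x + y)) -> (forall x y, G x -> G y -> G (x * y)) ->
  forall x, G x.
Proof.
move=> GC G1 G2 G3 G4 GD GM; elim/quotW=> p.
apply: (mpoly_gen_ind (G := fun p => G (laurent_pi p))) p => //.
- exact: (pt4_ind (G := fun p => G (laurent_pi p))).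
- by move=> p q Gp Gq; rewrite /laurent_pi rmorphD; exact: GD.
- by move=> p q Gp Gq; rewrite /laurent_pi rmorphM; exact: GM.
Qed.

Lemma laurent_univ (S : comNzRingType) (j : {rmorphism K -> S}) (u1 u2 v1 v2 : S) :
  u1 * v1 = 1 -> u2 * v2 = 1 ->
  exists g : {rmorphism laurent K -> S}, [/\ forall c, g (laurent_cst c) = j c,
    g (laurent_c1 K) = u1, g (laurent_c2 K) = u2, g (laurent_pi X4_2) = v1 &
    g (laurent_pi X4_3) = v2].
Proof.
move=> uv1 uv2; have [ev [evC evX]] := mpoly_ev j (pt4 u1 u2 v1 v2).
have [|f fE] := @quot_lift _ (span_ideal (@laurent_proper K)) _ ev.
  move=> p /span_idealE; apply: ideal_gen_ker => _ [] ->;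
    by rewrite rmorphB rmorphM rmorph1 !evX /pt4 /= ?uv1 ?uv2 subrr.
exists f; split; first by move=> c; rewrite fE evC.
- by rewrite fE evX.
- by rewrite fE evX.
- by rewrite fE evX.
- by rewrite fE evX.
Qed.

End LaurentRing.

(** [X] plays the role of the base change of [F] from R to K, expressed without tensor products: by
    the last hypothesis each K-algebra [S] becomes an R-algebra through some [e] such that morphisms
    over [e] factor through [pf]. *)
Lemma gpres_base_change (R K F X : comNzRingType) (ir : {rmorphism R -> F}) x1 x2 y1 y2
    (t1 t2 : R) A B (pf : {rmorphism F -> X}) (i : {rmorphism K -> X}) (e1 e2 : K) :
  gpres ir x1 x2 y1 y2 t1 1 t2 1 A B ->
  (forall y, exists x, pf x = y) -> (forall c, exists k, pf (ir c) = i k) ->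
  pf (ir t1) = i e1 -> pf (ir t2) = i e2 ->
  (forall (S : comNzRingType) (j : {rmorphism K -> S}), exists e : {rmorphism R -> S},
    [/\ e t1 = j e1, e t2 = j e2 & forall f : {rmorphism F -> S},
      (forall c, f (ir c) = e c) -> exists g : {rmorphism X -> S},
        (forall x, g (pf x) = f x) /\ (forall k, g (i k) = j k)]) ->
  gpres i (pf x1) (pf x2) (pf y1) (pf y2) e1 1 e2 1 A B.
Proof.
move=> H pfs pfc T1 T2 lift; split.
- by rewrite -rmorphM (gpres_rel1 H) rmorphD rmorphM rmorphXn T1 !rmorph1.
- by rewrite -rmorphM (gpres_rel2 H) rmorphD rmorphM rmorphXn T2 !rmorph1.
- move=> G GC G1 G2 G3 G4 GD GM y; have [x <-] := pfs y.
  elim/(gpres_ind H): x => [c|||||u v Hu Hv|u v Hu Hv] //.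
  + by have [k ->] := pfc c.
  + by rewrite rmorphD; exact: GD.
  + by rewrite rmorphM; exact: GM.
- move=> S j u1 u2 v1 v2; rewrite !rmorph1 !mul1r => uv1 uv2.
  have [e [E1 E2 L]] := lift S j.
  have [||f [fi f1 f2 f3 f4]] := gpres_univ H (j := e) (u1 := u1) (u2 := u2)
    (v1 := v1) (v2 := v2); rewrite ?rmorph1 ?mul1r ?E1 ?E2 //.
  by have [g [gE gi]] := L f fi; exists g; rewrite !gE.
Qed.

Section FiberPresentation.
Variables (K : closedFieldType) (a b : int) (eta : Spec (laurent K)) (eta1 eta2 : K).
Hypothesis heta : closed_point_at eta eta1 eta2.

Lemma closed_point_neq0 : eta1 != 0 /\ eta2 != 0.
Proof.
have [_ e1 e2] := heta; have [i iE] := laurent_cst_rmorphism K.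
split; apply/eqP => E.
  move: e1; rewrite E -iE rmorph0 subr0.
  by rewrite (@in_pt_unit _ _ _ (laurent_pi X4_2)) // mulrC laurent_rel1.
move: e2; rewrite E -iE rmorph0 subr0.
by rewrite (@in_pt_unit _ _ _ (laurent_pi X4_3)) // mulrC laurent_rel2.
Qed.

Let in_eta c (l : laurent K) d (x : K) : c * l = 1 -> x != 0 ->
  in_pt eta (c - laurent_cst x) -> l = d -> in_pt eta (d - laurent_cst x^-1).
Proof.
move=> cl x0 Hc <-; have [i iE] := laurent_cst_rmorphism K; rewrite -iE.
have -> : l - i x^-1 = - (l * i x^-1) * (c - i x).
  have xx : i x^-1 * i x = 1 by rewrite -rmorphM mulVf // rmorph1.
  transitivity (l * (i x^-1 * i x) - c * l * i x^-1); last by ring.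
  by rewrite xx cl mulr1 mul1r.
by rewrite in_ptMl // iE.
Qed.

(** One constant serves both the congruence modulo [eta] and the value under [e]. This is applied to
    the structure map of the fiber and to evaluations in an arbitrary [S]. *)
Lemma laurent_mod_eta (S : comNzRingType) (j : {rmorphism K -> S})
    (e : {rmorphism laurent K -> S}) : (forall c, e (laurent_cst c) = j c) ->
  e (laurent_c1 K) = j eta1 -> e (laurent_c2 K) = j eta2 ->
  forall c, exists k, e c = j k /\ in_pt eta (c - laurent_cst k).
Proof.
move=> ej e1 e2; have [_ h1 h2] := heta; have [n1 n2] := closed_point_neq0.
have [i iE] := laurent_cst_rmorphism K.
have je (x : K) c l : c * l = 1 -> x != 0 -> e c = j x -> e l = j x^-1.
  move=> cl x0 ec; rewrite -[e l]mul1r -(rmorph1 j) -(mulVf x0) rmorphM -ec -mulrA.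
  by rewrite -rmorphM cl rmorph1 mulr1.
apply: laurent_ind => [c|||||x y [k [xk kP]] [l [yl lP]]|x y [k [xk kP]] [l [yl lP]]].
- by exists c; rewrite ej subrr in_pt0.
- by exists eta1.
- by exists eta2.
- exists eta1^-1; split; first exact: je (laurent_rel1 K) n1 e1.
  exact: in_eta (laurent_rel1 K) n1 h1 erefl.
- exists eta2^-1; split; first exact: je (laurent_rel2 K) n2 e2.
  exact: in_eta (laurent_rel2 K) n2 h2 erefl.
- exists (k + l); rewrite !rmorphD xk yl; split=> //.
  by rewrite -!iE rmorphD opprD addrACA in_ptD // iE.
- exists (k * l); rewrite !rmorphM xk yl; split=> //.
  rewrite -!iE rmorphM in kP lP *.
  have -> : x * y - i k * i l = y * (x - i k) + i k * (y - i l) by ring.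
  by rewrite in_ptD ?in_ptMl.
Qed.

Lemma in_eta_const (k : K) : in_pt eta (laurent_cst k) -> k = 0.
Proof.
have [i iE] := laurent_cst_rmorphism K; rewrite -iE => H; apply/eqP; apply: contraTT H => k0.
by rewrite (@in_pt_unit _ _ _ (i k^-1)) // -rmorphM mulVf // rmorph1.
Qed.

Lemma Xfib_gpres : exists i : {rmorphism K -> Xfib a b eta},
  (forall c, i c = Xfib_cst a b eta c) /\
  gpres i (Xfib_pi a b eta X4_0) (Xfib_pi a b eta X4_1)
    (Xfib_pi a b eta X4_2) (Xfib_pi a b eta X4_3) eta1 1 eta2 1 `|a|%N `|b|%N.
Proof.
pose c1 := laurent_c1 K; pose c2 := laurent_c2 K.
have [il ilE] := laurent_cst_rmorphism K.
have [icl [iclE icl_pres]] := cluster_gpres c1 c2 a b.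
pose J := span_ideal (@fiber_proper _ c1 c2 a b eta).
have [pf pfE] : exists pf : {rmorphism cluster c1 c2 a b -> Xfib a b eta},
    forall x, pf x = fiber_pi eta x by exists \pi_{ideal_quot J}.
have pf0 c : in_pt eta c -> pf (icl c) = 0.
  by move=> ec; rewrite pfE iclE; apply/quot_pi0P/span_idealE/mem_ideal_gen; exists c.
have pf_surj y : exists x, pf x = y by elim/quotW: y => x; exists x; exact: pfE.
have pf_lift (S : comNzRingType) (f : {rmorphism cluster c1 c2 a b -> S}) :
    (forall c, in_pt eta c -> f (icl c) = 0) ->
    exists g : {rmorphism Xfib a b eta -> S}, forall x, g (pf x) = f x.
  move=> f0; have [|g gE] := @quot_lift _ J _ f.
    by move=> x /span_idealE; apply: ideal_gen_ker => _ [c ec <-]; rewrite -iclE f0.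
  by exists g => x; rewrite pfE; exact: gE.
have iE c : (pf \o icl \o il) c = Xfib_cst a b eta c.
  by rewrite /= pfE iclE ilE.
have piE f : Xfib_pi a b eta f = pf (cluster_pi c1 c2 a b f) by rewrite pfE.
rewrite !piE.
have pfc c k : in_pt eta (c - il k) -> pf (icl c) = pf (icl (il k)).
  by move=> /pf0; rewrite !rmorphB => /eqP; rewrite subr_eq0 => /eqP.
have [_ h1 h2] := heta; rewrite -ilE in h1; rewrite -ilE in h2.
exists (pf \o icl \o il); split=> //; apply: gpres_base_change icl_pres _ _ _ _ _ => //.
- have mod_c := @laurent_mod_eta _ (pf \o icl \o il) (pf \o icl).
  move=> c; have [||| k [E _]] := mod_c _ _ _ c => [d|||] /=.
  + by rewrite ilE.
  + exact: pfc h1.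
  + exact: pfc h2.
  + by exists k; exact: E.
- exact: pfc h1.
- exact: pfc h2.
- move=> S j; have [n1 n2] := closed_point_neq0.
  have inv (x : K) : x != 0 -> j x * j x^-1 = 1.
    by move=> x0; rewrite -rmorphM divff // rmorph1.
  have [e [ej e1 e2 _ _]] := laurent_univ j (inv _ n1) (inv _ n2).
  exists e; split=> // f fi; have [|g gE] := pf_lift S f.
    move=> c ec; rewrite fi; have [k [-> ck]] := laurent_mod_eta ej e1 e2 c.
    suff -> : k = 0 by rewrite rmorph0.
    by apply: in_eta_const; rewrite -(in_pt_congr ck).
  by exists g; split=> // k; rewrite /= gE fi ilE ej.
Qed.

End FiberPresentation.

(** * The singular locus *)

Section Characteristic.
Variable K : fieldType.

Lemma natr_eq0_pchar (p n : nat) : is_characteristic K p -> (0 < n)%N ->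
  n%:R = 0 :> K -> p \in [pchar K].
Proof.
move=> hp n0 nK; have [q qK] := natf0_pchar n0 (introT eqP nK).
by move: hp; rewrite /is_characteristic; case: eqP => // _ /(_ q); rewrite qK.
Qed.

(** The part of [n] prime to [p] is itself such a divisor, and every other one divides it by
    Gauss. *)
Lemma max_divisor_nmodE (p n : nat) : prime p -> (0 < n)%N ->
  max_divisor_nmod p n = (n`_p^')%N.
Proof.
move=> pp n0; apply/eqP; rewrite eqn_leq; apply/andP; split.
  rewrite /max_divisor_nmod big_seq_cond; elim/big_ind: _ => [//|x y|d].
    by rewrite geq_max => -> ->.
  rewrite -dvdn_divisors // mod0n => /andP[dn pd].
  apply: dvdn_leq; first exact: part_gt0.
  rewrite -[n](@partnC p) // in dn; rewrite -(@Gauss_dvdr _ (n`_p)%N) //.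
  by rewrite p_part coprimeXr // coprime_sym prime_coprime.
rewrite /max_divisor_nmod (big_rem (n`_p^')%N) /=; last by rewrite -dvdn_divisors ?dvdn_part.
have -> : ((n`_p^')%N != 0 %[mod p])%N.
  rewrite mod0n; have : (p^'.-nat n`_p^')%N by exact: part_pnat.
  by rewrite p'natE.
exact: leq_maxl.
Qed.

Lemma max_divisor_nmod_decomp (p n : nat) : p \in [pchar K] -> (0 < n)%N -> n%:R = 0 :> K ->
  exists m, [/\ (0 < m)%N, n = (max_divisor_nmod p n * p ^ m)%N &
    (max_divisor_nmod p n)%:R != 0 :> K].
Proof.
move=> pK n0 nK; have pp := pcharf_prime pK; exists (logn p n); split.
- by rewrite logn_gt0 mem_primes pp n0 (dvdn_pcharf pK) nK eqxx.
- by rewrite max_divisor_nmodE // mulnC -p_part partnC.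
- rewrite max_divisor_nmodE // -(dvdn_pcharf pK).
  have : (p^'.-nat n`_p^')%N by exact: part_pnat.
  by rewrite p'natE.
Qed.

Lemma absz_natr_eq0 (a : int) : (a%:~R == 0 :> K) = (`|a|%N%:R == 0 :> K).
Proof. by case: a => n //=; rewrite NegzE mulrNz oppr_eq0. Qed.

Lemma char_ndvd (p : nat) (a : int) : is_characteristic K p ->
  (a != 0 %[mod p])%Z -> (`|a|%N%:R != 0 :> K).
Proof.
move=> hp; apply: contraNneq => aK.
have [->//|a0] := eqVneq a 0.
have pK : p \in [pchar K] by apply: natr_eq0_pchar hp _ aK; rewrite absz_gt0.
rewrite mod0z; apply/eqP/dvdz_mod0P.
by rewrite dvdzE /= (dvdn_pcharf pK) aK.
Qed.

End Characteristic.

Lemma Vset5 (F : comNzRingType) (e1 e2 e3 e4 e5 : F) P :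
  Vset [set e1; e2; e3; e4; e5] P <->
  [/\ in_pt P e1, in_pt P e2, in_pt P e3, in_pt P e4 & in_pt P e5].
Proof.
split=> [V|[P1 P2 P3 P4 P5] f]; last by move=> [[[[]|]|]|] ->.
by split; apply: V; [do 4!left|do 3!left; right|do 2!left; right|left; right|right].
Qed.

Section SingularLocus.
Variables (K : closedFieldType).

(** [Y_a] in normalized coordinates; exchanging the indices gives [Y_b]. The generator [a] becomes a
    condition in K, where an integer is 0 or a unit, and the equation for [z1] follows from the
    first relation. *)
Definition wsing (F : comNzRingType) (w1 w2 z2 : F) (A : nat) : set (Spec F) :=
  [set P | [/\ A%:R = 0 :> K, in_pt P (w1 ^+ A - 1), in_pt P w2 & in_pt P z2]].

Section Presented.
Variables (F : comNzRingType) (i : {rmorphism K -> F}) (w1 w2 z1 z2 : F) (A B : nat).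
Hypotheses (A0 : (0 < A)%N) (B0 : (0 < B)%N) (H : wpres i w1 w2 z1 z2 A B).

Lemma wsing_root P : wsing w1 w2 z2 A P -> exists2 z, z ^+ A = 1 & in_pt P (w1 - i z).
Proof.
move=> [_ PA _ _].
have [z Pz] : exists z, in_pt P (w1 - i z).
  apply: (@in_pt_poly_root _ _ i P w1 ('X^A - 1)).
    by rewrite -size_poly_eq0 size_XnsubC.
  by rewrite rmorphB rmorphXn rmorph1 /= hevX.
exists z => //; apply/eqP; rewrite -subr_eq0 -(in_pt_cst i P) rmorphB rmorph1 rmorphXn /=.
rewrite -(in_pt_congr (x := w1 ^+ A - 1)) //.
by rewrite opprB addrA subrK subrXX mulrC in_ptMl.
Qed.

Lemma wsing_w1 P : wsing w1 w2 z2 A P -> ~~ in_pt P w1.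
Proof.
move=> [_ PA _ _]; apply/negP => Pw; have := in_pt1 P.
by rewrite -[1](subKr (w1 ^+ A)) in_ptB // in_ptX A0.
Qed.

(** [w1] vanishes nowhere on the first set and everywhere on the second. *)
Lemma wsing_disjoint : wsing w1 w2 z2 A `&` wsing w2 w1 z1 B = set0.
Proof. by apply/seteqP; split=> // P [/wsing_w1/negP Pw1 [_ _ ]] /Pw1. Qed.

Lemma wsing_sub_Sing : wsing w1 w2 z2 A `<=` Sing F.
Proof.
move=> P PA; have [z zA Pz] := wsing_root PA; have [AK _ Pw2 Pz2] := PA.
have [p pK] := natf0_pchar A0 (introT eqP AK).
have [m [m0 AE alK]] := max_divisor_nmod_decomp pK A0 AK.
move: H A0 zA; rewrite AE => H' A0' zA'.
exact: (singular_not_regular A0' B0 H' pK alK m0 Pz Pw2 Pz2 zA').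
Qed.

Lemma Sing_sub_wsing P : Sing F P -> ~~ in_pt P w1 -> wsing w1 w2 z2 A P.
Proof.
move=> SP w1P; have [//|[AK Pw2 Pz2 [x xA Px]]] := regular_or_singular A0 B0 H w1P.
split=> //; have -> : w1 ^+ A - 1 = w1 ^+ A - i x ^+ A by rewrite -rmorphXn xA rmorph1.
by rewrite subrXX mulrC in_ptMl.
Qed.

Lemma wsing_type_A (p m al : nat) P : A = (al * p ^ m)%N -> p \in [pchar K] ->
  al%:R != 0 :> K -> (0 < m)%N -> wsing w1 w2 z2 A P -> sing_type_A i (p ^ m).-1 P.
Proof.
move=> AE pK alK m0 PA.
have [z zA Pz] := wsing_root PA; have [AK _ Pw2 Pz2] := PA.
have w1P := wsing_w1 PA.
have Pw20 : in_pt P (w2 - i 0) by rewrite rmorph0 subr0.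
have Pz20 : in_pt P (z2 - i 0) by rewrite rmorph0 subr0.
(* Up to powers of [w1], which are outside both primes, these coordinates generate the ideal of the
   point. *)
have uniqP Q : in_pt Q (w1 - i z) -> in_pt Q w2 -> in_pt Q z2 -> Q = P.
  have sub Q1 Q2 : in_pt Q1 (w1 - i z) -> in_pt Q1 w2 -> in_pt Q1 z2 ->
      in_pt Q2 (w1 - i z) -> in_pt Q2 w2 -> in_pt Q2 z2 ->
      forall f, in_pt Q1 f -> in_pt Q2 f.
    move=> h1 h2 h3 h4 h5 h6 f Qf.
    have [||n wf] := closed_point_gen H h1 (y := 0) (u := 0) _ _ Qf.
    - by rewrite rmorph0 subr0.
    - by rewrite rmorph0 subr0.
    have : in_pt Q2 (w1 ^+ n * f).
      move: wf; apply: ideal_gen_in_pt => g /=; rewrite !inE rmorph0 !subr0.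
      by move=> /or3P[] /eqP ->.
    have z0 : z != 0.
      by apply: contraTneq A0 => z0; move: zA; rewrite z0 expr0n; case: (A) => //= n' /esym/eqP;
        rewrite oner_eq0.
    have w1Q2 : in_pt Q2 w1 = false by rewrite (in_pt_congr h4) in_pt_cst (negPf z0).
    by rewrite in_ptM in_ptX w1Q2 andbF.
  by move=> h1 h2 h3; apply: Spec_eq => f; apply/idP/idP; exact: sub.
split.
- split; first exact: (chain_below_prime_chain (closed_point_chain2 A0 B0 H w1P Pz Pw20 Pz20)).
  by move=> /prime_chain_split[Q]; exact: (no_chain3 A0 B0 H).
- have -> : [set P] = ~` ~` Vset [set w1 - i z; w2; z2].
    rewrite setCK; apply/seteqP; split=> Q; first by move=> -> f [[]|] ->.
    by move=> V; apply: uniqP; apply: V; [do 2!left|left; right|right].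
  by apply: open_closedC; exists [set w1 - i z; w2; z2].
- move: (H) (A0) (zA); rewrite AE => H' A0' zA'.
  have [u [uz uE]] := root_cofactor A0' pK alK zA'.
  have Pu : ~~ in_pt P (hev i w1 u).
    have Pc : in_pt P (hev i w1 u - i u.[z]).
      have -> : i u.[z] = hev i (i z) u.
        apply: (hev_uniq (g := i \o horner_eval z)) => [c|] /=;
        by rewrite /horner_eval ?hornerC ?hornerX.
      suff : ideal_gen [set w1 - i z] (hev i w1 u - hev i (i z) u).
        by apply: ideal_gen_in_pt => g ->.
      apply: ideal_gen_hev => [c|]; last exact: mem_ideal_gen.
      by rewrite subrr; exact: ideal_gen0.
    by rewrite (in_pt_congr Pc) in_pt_cst.
  (* The factor [w1] removes the other component of the singular locus, the cofactor [u] the other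
     roots of unity. *)
  exists (~` Vset [set w1 * hev i w1 u]); first by exists [set w1 * hev i w1 u].
  apply/seteqP; split=> Q.
    move=> [VQ SQ]; have : ~~ in_pt Q (w1 * hev i w1 u).
      by apply/negP => h; apply: VQ => _ ->.
    rewrite in_ptM negb_or => /andP[w1Q uQ].
    have [_ QA Qw2 Qz2] := Sing_sub_wsing SQ w1Q; apply: uniqP => //.
    move: QA; rewrite AE (uE _ i) in_ptM !in_ptX (negPf uQ) andbF orbF.
    by case/andP.
  move=> ->; split; last exact: wsing_sub_Sing.
  move=> /(_ _ erefl); rewrite in_ptM (negPf w1P) (negPf Pu) //.
- move: (H) (A0) (zA); rewrite AE => H' A0' zA'.
  exact: (singular_completion A0' H' pK alK m0 Pz Pw2 Pz2 zA').
Qed.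

(** In characteristic [p] the polynomial for [A]-th roots of unity is a [p ^ m]-th power of the one
    for the part of [A] prime to [p]. If [A] is nonzero in K, both sides are empty. *)
Lemma wsing_roots (p : nat) (a : int) : A = `|a|%N -> is_characteristic K p ->
  wsing w1 w2 z2 A = \bigcup_(z in [set z : K | (max_divisor_nmod p A).-unity_root z])
    Vset [set a%:~R; w1 - i z; w2; z1 - i z^-1; z2].
Proof.
move=> Aa hp; have aE P : in_pt P (a%:~R : F) = (A%:R == 0 :> K).
  by rewrite -(rmorph_int i) in_pt_cst absz_natr_eq0 Aa.
apply/seteqP; split=> P.
  move=> PA; have [z zA Pz] := wsing_root PA; have [AK _ Pw2 Pz2] := PA.
  have pK := natr_eq0_pchar hp A0 AK.
  have [m [m0 AE alK]] := max_divisor_nmod_decomp pK A0 AK.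
  exists z.
    rewrite /= unity_rootE -subr_eq0; have := expr_pchar_pow m z (max_divisor_nmod p A) pK.
    by rewrite -AE zA subrr => /esym/eqP; rewrite expf_eq0 => /andP[].
  apply/Vset5; split=> //; first by rewrite aE AK.
  have := z1_const H (wsing_w1 PA) Pz (y := 0).
  by rewrite expr0n gtn_eqF // subr0 mul1r; apply; rewrite rmorph0 subr0.
move=> [z /= za /Vset5[Pa Pz Pw2 Pz1 Pz2]].
have AK : A%:R = 0 :> K by apply/eqP; rewrite -(aE P).
have pK := natr_eq0_pchar hp A0 AK.
have [m [m0 AE alK]] := max_divisor_nmod_decomp pK A0 AK.
split=> //; move: za; rewrite unity_rootE => /eqP za.
have -> : w1 ^+ A - 1 = w1 ^+ A - i z ^+ A.
  by rewrite -rmorphXn [in z ^+ A]AE exprM za expr1n rmorph1.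
by rewrite subrXX mulrC in_ptMl.
Qed.

(** The unit [l1 ^+ A] turns [x1 ^+ A + i e2] into [w1 ^+ A - 1]. The condition on [x1 * y1] follows
    from that on [x2] by the first relation. *)
Lemma Vset_wsing (x1 x2 y1 y2 : F) (e1 e2 l1 l2 m2 : K) (a : int) :
  A = `|a|%N -> l1 != 0 -> l2 != 0 -> m2 != 0 -> l1 ^+ A * e2 = -1 ->
  w1 = i l1 * x1 -> w2 = i l2 * x2 -> z2 = i m2 * y2 ->
  x1 * y1 = i e1 + x2 ^+ B ->
  Vset [set a%:~R; x1 ^+ A + i e2; x2; x1 * y1 - i e1; y2] = wsing w1 w2 z2 A.
Proof.
move=> Aa l10 l20 m20 le E1 E2 E4 rel.
have aE P : in_pt P (a%:~R : F) = (A%:R == 0 :> K).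
  by rewrite -(rmorph_int i) in_pt_cst absz_natr_eq0 Aa.
have lE P l x : l != 0 -> in_pt P (i l * x) = in_pt P x.
  by move=> l0; rewrite in_ptM in_pt_cst (negPf l0).
have PA P : in_pt P (x1 ^+ A + i e2) = in_pt P (w1 ^+ A - 1).
  rewrite -(lE P (l1 ^+ A)) ?expf_neq0 // mulrDr -rmorphM le rmorphN rmorph1.
  by rewrite E1 exprMn rmorphXn.
apply/seteqP; split=> P.
  move=> /Vset5[Pa P1 Px2 _ Py2]; split; first by apply/eqP; rewrite -(aE P).
  - by rewrite -PA.
  - by rewrite E2 lE.
  - by rewrite E4 lE.
move=> [/eqP AK P1 Pw2 Pz2]; apply/Vset5; rewrite aE PA AK -(lE P l2 x2) // -E2 -(lE P m2 y2) // -E4.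
split=> //; rewrite rel addrC addKr in_ptX B0 -(lE P l2 x2) // -E2 //.
Qed.

End Presented.

End SingularLocus.

(** * Normalization of the coefficients *)

Lemma closed_nth_root (K : closedFieldType) (c : K) n : (0 < n)%N -> exists x, x ^+ n = c.
Proof.
move=> n0; have [x xE] := solve_monicpoly (fun k => if k == 0%N then c else 0) n0.
exists x; rewrite xE (bigD1 (Ordinal n0)) //= expr0 mulr1 big1 ?addr0 // => k.
by rewrite -val_eqE /= => /negPf ->; rewrite mul0r.
Qed.

Lemma wsing_spec_map (K : closedFieldType) (F F' : comNzRingType) (f : {rmorphism F -> F'})
    (w1 w2 z2 : F) A :
  spec_map f @^-1` wsing K w1 w2 z2 A = wsing K (f w1) (f w2) (f z2) A.
Proof.
by apply/seteqP; split=> P [AK h1 h2 h3]; split=> //; move: h1;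
  rewrite /in_pt /= /spec_map_pred rmorphB rmorphXn rmorph1.
Qed.

(** Roots [l1 ^+ A = - e2^-1] and [l2 ^+ B = - e1^-1] produce the signs; [m1] and [m2] then
    normalize the constant terms. *)
Lemma gpres_normalize (K : closedFieldType) (F : comNzRingType) (i : {rmorphism K -> F})
    x1 x2 y1 y2 (e1 e2 : K) A B :
  (0 < A)%N -> (0 < B)%N -> e1 != 0 -> e2 != 0 -> gpres i x1 x2 y1 y2 e1 1 e2 1 A B ->
  exists l1 l2 m1 m2, [/\ l1 != 0 /\ l2 != 0, m1 != 0 /\ m2 != 0,
    l1 ^+ A * e2 = -1, l2 ^+ B * e1 = -1 &
    gpres i (i l1 * x1) (i l2 * x2) (i m1 * y1) (i m2 * y2) 1 (-1) 1 (-1) A B].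
Proof.
move=> A0 B0 e10 e20 H.
have root (e : K) n : (0 < n)%N -> e != 0 -> exists2 l, l != 0 & l ^+ n = - e^-1.
  move=> n0 e0; have [l lE] := closed_nth_root (- e^-1) n0; exists l => //.
  apply: contraNneq e0 => l0; move: lE; rewrite l0 expr0n gtn_eqF // => /esym/eqP.
  by rewrite oppr_eq0 invr_eq0.
have [l1 l10 l1E] := root e2 A A0 e20; have [l2 l20 l2E] := root e1 B B0 e10.
have m10 : (l1 * e1)^-1 != 0 by rewrite invr_eq0 mulf_neq0.
have m20 : (l2 * e2)^-1 != 0 by rewrite invr_eq0 mulf_neq0.
have mE (l e : K) : l != 0 -> e != 0 -> l * (l * e)^-1 = e^-1.
  by move=> l0 e0; rewrite invfM mulrA divff // mul1r.
exists l1, l2, (l1 * e1)^-1, (l2 * e2)^-1; split=> //.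
- by rewrite l1E mulNr mulVf.
- by rewrite l2E mulNr mulVf.
apply: gpres_rescale H; try exact: mulVf.
- by rewrite mE // mulVf.
- by rewrite mE // l2E mulr1 mulN1r opprK.
- by rewrite mE // mulVf.
- by rewrite mE // l1E mulr1 mulN1r opprK.
Qed.

Lemma Xfib_normalize (K : closedFieldType) (a b : int) (eta : Spec (laurent K)) (eta1 eta2 : K) :
  a != 0 -> b != 0 -> closed_point_at eta eta1 eta2 ->
  exists (i : {rmorphism K -> Xfib a b eta}) (w1 w2 z1 z2 : Xfib a b eta),
  [/\ forall c, i c = Xfib_cst a b eta c,
      gpres i w1 w2 z1 z2 1 (-1) 1 (-1) `|a|%N `|b|%N,
      Y_a a b eta eta1 eta2 = wsing K w1 w2 z2 `|a|%N &
      Y_b a b eta eta1 eta2 = wsing K w2 w1 z1 `|b|%N].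
Proof.
move=> a0 b0 heta; have [i [iE H]] := Xfib_gpres a b heta.
have [e10 e20] := closed_point_neq0 heta.
have A0 : (0 < `|a|)%N by rewrite absz_gt0.
have B0 : (0 < `|b|)%N by rewrite absz_gt0.
have [l1 [l2 [m1 [m2 [[l10 l20] [m10 m20] l1E l2E H']]]]] := gpres_normalize A0 B0 e10 e20 H.
exists i, (i l1 * Xfib_pi a b eta X4_0), (i l2 * Xfib_pi a b eta X4_1),
  (i m1 * Xfib_pi a b eta X4_2), (i m2 * Xfib_pi a b eta X4_3).
split; [exact: iE|exact: H'| |].
- transitivity (Vset [set a%:~R; Xfib_pi a b eta X4_0 ^+ `|a|%N + i eta2; Xfib_pi a b eta X4_1;
      Xfib_pi a b eta X4_0 * Xfib_pi a b eta X4_2 - i eta1; Xfib_pi a b eta X4_3]).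
    by rewrite /Y_a !iE.
  apply: (Vset_wsing B0 erefl l10 l20 m20 l1E erefl erefl erefl).
  by rewrite (gpres_rel1 H) rmorph1 mul1r.
- transitivity (Vset [set b%:~R; Xfib_pi a b eta X4_1 ^+ `|b|%N + i eta1; Xfib_pi a b eta X4_0;
      Xfib_pi a b eta X4_1 * Xfib_pi a b eta X4_3 - i eta2; Xfib_pi a b eta X4_2]).
    by rewrite /Y_b !iE; apply/seteqP; split=> P /Vset5[? ? ? ? ?]; exact/Vset5.
  apply: (Vset_wsing A0 erefl l20 l10 m10 l2E erefl erefl erefl).
  by rewrite (gpres_rel2 H) rmorph1 mul1r.
Qed.

(** On the cover the constant terms are [c1 ^+ B] and [c2 ^+ A]. Dividing [x1] by [c2] and [x2] by
    [c1] extracts these powers from the right-hand sides, and the factors of [y1] and [y2] restore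
    the balance. *)
Lemma root_cover_trivial (K : closedFieldType) (a b : int) :
  exists2 tau : {rmorphism laurent K -> laurent K}, root_cover a b tau &
    alg_isomorphic (cluster_cst (tau (laurent_c1 K)) (tau (laurent_c2 K)) a b)
      (cluster_cst (1 : laurent K) 1 a b).
Proof.
have [il ilE] := laurent_cst_rmorphism K.
set c1 := laurent_c1 K; set c2 := laurent_c2 K.
pose d1 : laurent K := laurent_pi X4_2; pose d2 : laurent K := laurent_pi X4_3.
have cd1 : c1 * d1 = 1 := laurent_rel1 K; have cd2 : c2 * d2 = 1 := laurent_rel2 K.
have pow1 (c d : laurent K) n : c * d = 1 -> c ^+ n * d ^+ n = 1.
  by move=> cd; rewrite -exprMn cd expr1n.
pose A := `|a|%N; pose B := `|b|%N.
have [tau [tauC tau1 tau2 _ _]] := laurent_univ il (pow1 _ _ B cd1) (pow1 _ _ A cd2).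
exists tau; first by split=> // k; rewrite tauC ilE.
rewrite [tau _]tau1 [tau _]tau2.
have [i [iE H]] := cluster_gpres (c1 ^+ B) (c2 ^+ A) a b.
have [i' [iE' H']] := cluster_gpres (1 : laurent K) 1 a b.
rewrite -/A -/B in H H'.
have Hr : gpres i (i d2 * cluster_pi (c1 ^+ B) (c2 ^+ A) a b X4_0)
    (i d1 * cluster_pi (c1 ^+ B) (c2 ^+ A) a b X4_1)
    (i (d1 ^+ B * c2) * cluster_pi (c1 ^+ B) (c2 ^+ A) a b X4_2)
    (i (d2 ^+ A * c1) * cluster_pi (c1 ^+ B) (c2 ^+ A) a b X4_3) 1 1 1 1 A B.
  apply: (gpres_rescale (l1' := c2) (l2' := c1) (m1' := c1 ^+ B * d2) (m2' := c2 ^+ A * d1)) H => //.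
  - by rewrite mulrACA pow1 // mul1r mulrC.
  - by rewrite mulrACA pow1 // mul1r mulrC.
  - by rewrite mulrCA (mulrC d2) cd2 mulr1 mulrC pow1.
  - by rewrite mulrCA (mulrC d2) cd2 mul1r !mulr1.
  - by rewrite mulrCA (mulrC d1) cd1 mulr1 mulrC pow1.
  - by rewrite mulrCA (mulrC d1) cd1 mul1r !mulr1.
have [f [fiso _ _ _ _]] := gpres_iso Hr H'.
exists f; case: fiso => fb fi; split=> // k.
by rewrite -iE' -fi iE.
Qed.

Theorem theorem8 (K : closedFieldType) (p : nat) (hp : is_characteristic K p)
    (a b : int) (ha : a != 0) (hb : b != 0) (hab : a * b < 0)
    (eta : Spec (laurent K)) (eta1 eta2 : K)
    (heta : closed_point_at eta eta1 eta2) :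
  let X : comNzRingType := Xfib a b eta in
  let Ya : set (Spec X) := Y_a a b eta eta1 eta2 in
  let Yb : set (Spec X) := Y_b a b eta eta1 eta2 in
  let alpha := max_divisor_nmod p `|a|%N in
  let beta := max_divisor_nmod p `|b|%N in
  [/\ (* (1) *)
      [/\ Sing X = Ya `|` Yb,
          Ya `&` Yb = set0,
          (forall (eta' : Spec (laurent K)) (eta1' eta2' : K),
             closed_point_at eta' eta1' eta2' ->
             exists f : {rmorphism Xfib a b eta' -> X},
               [/\ alg_isom (Xfib_cst a b eta') (Xfib_cst a b eta) f,
                   Ya = spec_map f @^-1` Y_a a b eta' eta1' eta2' &
                   Yb = spec_map f @^-1` Y_b a b eta' eta1' eta2']),
          ((a != 0 %[mod p])%Z -> Ya = set0) &
          ((b != 0 %[mod p])%Z -> Yb = set0)],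
      (* (2) *)
      [/\ (exists2 tau : {rmorphism laurent K -> laurent K},
             root_cover a b tau &
             alg_isomorphic
               (cluster_cst (tau (laurent_c1 K)) (tau (laurent_c2 K)) a b)
               (cluster_cst (1 : laurent K) 1 a b)),
          alg_isomorphic (Xfib_cst a b eta) (cluster_cst (1 : K) 1 a b) &
          alg_isomorphic (cluster_cst (1 : K) 1 a b) (wcluster_cst a b)],
      (* (3) *)
      exists f : {rmorphism wcluster K a b -> X},
        [/\ alg_isom (wcluster_cst a b) (Xfib_cst a b eta) f,
            Ya = spec_map f @^-1`
                   \bigcup_(zeta in [set z : K | alpha.-unity_root z]) W_a a b zeta,
            Yb = spec_map f @^-1`
                   \bigcup_(xi in [set z : K | beta.-unity_root z]) W_b a b xi,
            trivIset [set z : K | alpha.-unity_root z] (W_a a b) &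
            trivIset [set z : K | beta.-unity_root z] (W_b a b)] &
      (* (4) *)
      Sing X !=set0 ->
        (Ya !=set0 -> exists m : nat,
           [/\ (0 < m)%N, `|a|%N = (alpha * p ^ m)%N &
               forall C : set (Spec X), is_component Ya C ->
               forall v : Spec X, C v ->
                 sing_type_A (Xfib_cst a b eta) (p ^ m).-1 v]) /\
        (Yb !=set0 -> exists m : nat,
           [/\ (0 < m)%N, `|b|%N = (beta * p ^ m)%N &
               forall C : set (Spec X), is_component Yb C ->
               forall v : Spec X, C v ->
                 sing_type_A (Xfib_cst a b eta) (p ^ m).-1 v])].

Proof.
move=> X Ya Yb alpha beta.
have A0 : (0 < `|a|)%N by rewrite absz_gt0.
have B0 : (0 < `|b|)%N by rewrite absz_gt0.
have [i [w1 [w2 [v1 [v2 [iE HX YaE YbE]]]]]] := Xfib_normalize ha hb heta.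
have H := gpres_wpres HX; have H' := wpres_sym H.
have iX : Xfib_cst a b eta = i by apply: funext => c; rewrite iE.
(* If [w1] lies in [P], coprimality puts [w2] outside [P], and the exchanged presentation
   applies. *)
have SingE : Sing X = Ya `|` Yb.
  rewrite /Ya /Yb YaE YbE; apply/seteqP; split=> P.
    move=> SP; have [Pw1|Pw1] := boolP (in_pt P w1); last first.
      by left; exact: (Sing_sub_wsing A0 B0 H SP Pw1).
    right; apply: (Sing_sub_wsing B0 A0 H' SP); apply/negP => Pw2.
    have [u [v uv]] := w1_w2_coprime B0 H; have := in_pt1 P.
    by rewrite -uv in_ptD ?in_ptMl.
  by move=> [] PS; [exact: (wsing_sub_Sing A0 B0 H PS)|exact: (wsing_sub_Sing B0 A0 H' PS)].
split.
- split=> //.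
  + by rewrite /Ya /Yb YaE YbE; apply: wsing_disjoint.
  + move=> eta' eta1' eta2' heta'.
    (* Both fibers have the same normalized presentation, in which the two sets no longer depend on
       the point. *)
    have [i' [w1' [w2' [v1' [v2' [iE' HX' YaE' YbE']]]]]] := Xfib_normalize ha hb heta'.
    have [f [[fb fi] f1 f2 f3 f4]] := gpres_iso HX' HX; exists f; split.
    * by split=> // k; rewrite -iE' fi iE.
    * by rewrite YaE' wsing_spec_map f1 f2 f4 /Ya YaE.
    * by rewrite YbE' wsing_spec_map f1 f2 f3 /Yb YbE.
  + move=> /(char_ndvd hp) aK; rewrite /Ya YaE; apply/seteqP; split=> // P [/eqP].
    by rewrite (negPf aK).
  + move=> /(char_ndvd hp) bK; rewrite /Yb YbE; apply/seteqP; split=> // P [/eqP].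
    by rewrite (negPf bK).
- have [j [jE HC]] := cluster_gpres (1 : K) 1 a b.
  (* With trivial coefficients the normalization only changes signs, by means of roots of -1. *)
  have [l1 [l2 [m1 [m2 [_ _ _ _ HC']]]]] := gpres_normalize A0 B0 (oner_neq0 K) (oner_neq0 K) HC.
  have [j' [jE' HW]] := wcluster_gpres K a b.
  split; first exact: root_cover_trivial.
  + have [f [[fb fi] _ _ _ _]] := gpres_iso HX HC'; exists f; split=> // k.
    by rewrite -iE fi jE.
  + have [f [[fb fi] _ _ _ _]] := gpres_iso HC' HW; exists f; split=> // k.
    by rewrite -jE fi jE'.
- have [j [jE HW]] := wcluster_gpres K a b.
  have HW' := gpres_wpres HW.
  have [f [[fb fi] f1 f2 f3 f4]] := gpres_iso HW HX.
  (* A prime in two members contains the difference of their constants, which must then be 0. *)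
  have disj (W : K -> set (Spec (wcluster K a b))) (D : set K) (w : wcluster K a b) :
      (forall z P, W z P -> in_pt P (w - j z)) -> trivIset D W.
    move=> WP z z' _ _ [P [/WP Pz /WP Pz']]; apply/eqP; rewrite -subr_eq0 -(in_pt_cst j P).
    have -> : j (z - z') = (w - j z') - (w - j z).
      by rewrite rmorphB opprB [RHS]addrC addrA subrK.
    exact: in_ptB.
  exists f; split.
  + by split=> // k; rewrite -jE fi iE.
  + rewrite /Ya YaE -f1 -f2 -f4 -wsing_spec_map; congr (_ @^-1` _).
    rewrite (wsing_roots A0 B0 HW' erefl hp); apply: eq_bigcupr => z _.
    by rewrite /W_a !jE.
  + rewrite /Yb YbE -f1 -f2 -f3 -wsing_spec_map; congr (_ @^-1` _).
    rewrite (wsing_roots B0 A0 (wpres_sym HW') erefl hp); apply: eq_bigcupr => z _.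
    by rewrite /W_b !jE; apply/seteqP; split=> P /Vset5[? ? ? ? ?]; exact/Vset5.
  + by apply: (disj _ _ (wcluster_pi a b X4_0)) => z P /Vset5[_ h _ _ _]; rewrite jE.
  + by apply: (disj _ _ (wcluster_pi a b X4_1)) => z P /Vset5[_ _ h _ _]; rewrite jE.
- move=> _; split.
  + move=> [P]; rewrite {1}/Ya YaE => -[AK _ _ _].
    have pK := natr_eq0_pchar hp A0 AK.
    have [m [m0 AE alK]] := max_divisor_nmod_decomp pK A0 AK.
    (* The type is computed at every point of [Ya], and a component is contained in [Ya]. *)
    exists m; split=> // C [x _ ->] v /connected_component_sub; rewrite /Ya YaE iX => Pv.
    exact: (wsing_type_A A0 B0 H AE pK alK m0 Pv).
  + move=> [P]; rewrite {1}/Yb YbE => -[BK _ _ _].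
    have pK := natr_eq0_pchar hp B0 BK.
    have [m [m0 BE beK]] := max_divisor_nmod_decomp pK B0 BK.
    exists m; split=> // C [x _ ->] v /connected_component_sub; rewrite /Yb YbE iX => Pv.
    exact: (wsing_type_A B0 A0 H' BE pK beK m0 Pv).
Qed.
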